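(* Let $\mu$ be a log-concave probability measure supported on a convex body $K\subset\mathbb{R}^n$, and let $\|\cdot\|$ be an arbitrary norm on $\mathbb{R}^n$. Then for every measurable set $S\subset K$ with $0<\mu(S)\le 1/2$, $$(\operatorname{diam} K)\,\mu^+(S)\;\ge\;\mu(S)\,G\!\left(1/\mu(S)\right),$$ where $\operatorname{diam}K$ and $\mu^+$ are taken with respect to $\|\cdot\|$ and $G$ is the function defined in the context. Moreover, the bound is sharp: for every $x\in(0,1/2]$, every $D>0$, every dimension $n\ge1$ and every norm $\|\cdot\|$ on $\mathbb{R}^n$, the infimum of $(\operatorname{diam}K)\,\mu^+(S)/\mu(S)$ over all such triples $(\mu,K,S)$ with $\mu(S)=x$ and $\operatorname{diam}K=D$ equals $G(1/x)$.
   Context: A convex body is a closed, bounded convex set. A measure $\mu$ on $\mathbb{R}^n$ is log-concave if it has a density $F\ge 0$ (i.e. $\mu(A)=\int_A F$) with $\log F$ concave on the support of $F$; equivalently $\mu(tA+(1-t)B)\ge\mu(A)^t\mu(B)^{1-t}$ for all measurable $A,B$ and $t\in[0,1]$. For a norm $\|\cdot\|$, $\operatorname{diam}K=\sup\{\|a-b\|:a,b\in K\}$, and for $h>0$, $S_h=\{y:\exists s\in S,\ \|y-s\|\le h\}$. The generalized Minkowski measure is $\mu^+(S)=\lim_{h\to0^+}\mu(S_h\setminus S)/h$ (with respect to $\|\cdot\|$). The function $G:[2,\infty)\to\mathbb{R}$ is defined by $G(2)=2$ and, for $x\in(0,1/2)$, $G(1/x)=\dfrac{\gamma^2e^{\gamma}}{e^{\gamma}(\gamma-1)+1}$,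 where $\gamma>0$ is the unique solution of $x=\dfrac{e^{\gamma}(\gamma-1)+1}{(e^{\gamma}-1)^2}$ (the map $\gamma\mapsto \frac{e^{\gamma}(\gamma-1)+1}{(e^{\gamma}-1)^2}$ is a bijection from $(0,\infty)$ onto $(0,1/2)$). *)

(* Defs.v *)
(* MathComp + MathComp-Analysis, over an abstract R : realType.
   R^n is modelled as n.-tuple R, which MathComp-Analysis equips with the
   product (= Borel) sigma-algebra (measurable_structure.v, measurable_tuple). *)
From HB Require Import structures.
From mathcomp Require Import all_boot all_order all_algebra.
From mathcomp Require Import all_classical all_reals all_analysis.
Set Implicit Arguments. Unset Strict Implicit. Unset Printing Implicit Defensive.
Import Order.TTheory GRing.Theory Num.Theory.
Import numFieldNormedType.Exports.
Local Open Scope classical_set_scope.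
Local Open Scope ring_scope.

Definition vadd (R : realType) (n : nat) (x y : n.-tuple R) : n.-tuple R :=
  [tuple tnth x i + tnth y i | i < n].
Definition vscale (R : realType) (n : nat) (c : R) (x : n.-tuple R) : n.-tuple R :=
  [tuple c * tnth x i | i < n].
Definition vsub (R : realType) (n : nat) (x y : n.-tuple R) : n.-tuple R :=
  [tuple tnth x i - tnth y i | i < n].

Definition is_norm (R : realType) (n : nat) (N : n.-tuple R -> R) : Prop :=
  [/\ (forall x, 0 <= N x),
      (forall x, N x = 0 -> forall i, tnth x i = 0),
      (forall c x, N (vscale c x) = `|c| * N x) &
      (forall x y, N (vadd x y) <= N x + N y)].

Definition is_convex_set (R : realType) (n : nat) (K : set (n.-tuple R)) : Prop :=
  forall x y (t : R), K x -> K y -> 0 <= t <= 1 ->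
    K (vadd (vscale t x) (vscale (1 - t) y)).

Definition is_bounded_set (R : realType) (n : nat) (K : set (n.-tuple R)) : Prop :=
  exists M : R, forall x, K x -> forall i, `|tnth x i| <= M.

(* closedness for the usual (product / Euclidean) topology of R^n,
   via coordinatewise sequential convergence *)
Definition is_closed_set (R : realType) (n : nat) (K : set (n.-tuple R)) : Prop :=
  forall (u : nat -> n.-tuple R) (x : n.-tuple R),
    (forall k, K (u k)) ->
    (forall i, (fun k => tnth (u k) i) @ \oo --> tnth x i) -> K x.

Definition convex_body (R : realType) (n : nat) (K : set (n.-tuple R)) : Prop :=
  [/\ is_closed_set K, is_bounded_set K & is_convex_set K].

(* ---------- Lebesgue measure on R^n ----------
   lam is Lebesgue measure on the Borel sets of R^n: the (unique, by the
   pi-lambda theorem) measure giving every closed box its volume. *)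
Definition is_lebesgue (R : realType) (n : nat)
    (lam : {measure set (n.-tuple R) -> \bar R}) : Prop :=
  forall a b : n.-tuple R, (forall i, tnth a i <= tnth b i) ->
    lam [set x | forall i, tnth a i <= tnth x i <= tnth b i] =
    (\prod_(i < n) (tnth b i - tnth a i))%:E.

Definition dmeasure (R : realType) (n : nat)
    (lam : {measure set (n.-tuple R) -> \bar R}) (F : n.-tuple R -> R)
    (A : set (n.-tuple R)) : \bar R :=
  (\int[lam]_(x in A) (F x)%:E)%E.

(* outer measure (value of the completion on universally measurable sets,
   e.g. on S_h \ S, which need not be Borel) *)
Definition dmeasure_out (R : realType) (n : nat)
    (lam : {measure set (n.-tuple R) -> \bar R}) (F : n.-tuple R -> R)
    (A : set (n.-tuple R)) : \bar R :=
  ereal_inf [set dmeasure lam F B | B in [set B | measurable B /\ A `<=` B]].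

Definition logconcave_density (R : realType) (n : nat) (F : n.-tuple R -> R) : Prop :=
  (forall x, 0 <= F x) /\
  forall x y (t : R), 0 <= t <= 1 ->
    F x `^ t * F y `^ (1 - t) <= F (vadd (vscale t x) (vscale (1 - t) y)).

Definition logconcave_prob_on (R : realType) (n : nat)
    (lam : {measure set (n.-tuple R) -> \bar R}) (F : n.-tuple R -> R)
    (K : set (n.-tuple R)) : Prop :=
  [/\ measurable_fun setT F, logconcave_density F,
      dmeasure lam F setT = 1%E & dmeasure lam F (~` K) = 0%E].

Definition diam (R : realType) (n : nat) (N : n.-tuple R -> R)
    (K : set (n.-tuple R)) : \bar R :=
  ereal_sup [set r | exists a b, [/\ K a, K b & r = (N (vsub a b))%:E]].

Definition nbhd_set (R : realType) (n : nat) (N : n.-tuple R -> R)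
    (S : set (n.-tuple R)) (h : R) : set (n.-tuple R) :=
  [set y | exists2 s, S s & N (vsub y s) <= h].

Definition minkowski_content_is (R : realType) (n : nat) (N : n.-tuple R -> R)
    (lam : {measure set (n.-tuple R) -> \bar R}) (F : n.-tuple R -> R)
    (S : set (n.-tuple R)) (l : \bar R) : Prop :=
  (fun h : R => (dmeasure_out lam F (nbhd_set N S h `\` S) * (h^-1)%:E)%E)
    @ at_right 0 --> l.

Definition phiG (R : realType) (g : R) : R :=
  (expR g * (g - 1) + 1) / (expR g - 1) ^+ 2.

(* G(2) = 2; for y > 2, G(y) = g^2 e^g / (e^g (g-1) + 1) where g > 0 is the
   unique solution of phiG g = 1/y. (Values for y < 2 are irrelevant.) *)
Definition Gfun (R : realType) (y : R) : R :=
  if y == 2 then 2 else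
  let g := xget 0 [set g : R | 0 < g /\ phiG g = y^-1] in
  g ^+ 2 * expR g / (expR g * (g - 1) + 1).

(* Main.v *)
(* Put psi g = g / (e^g - 1) and let J x be the infimum over all real g of
   g x + psi g; then J x = x G(1/x) for 0 < x <= 1/2.

   Lower bound. On a segment of length L, a log-concave density m of mass M whose
   mass to the left of t is M x satisfies L m(t) >= M J x: compare m with the
   exponential that is tangent to it at t. Since J is symmetric and subadditive,
   on the line two sets at distance h, of masses M y and M z, leave out a mass M r
   with h J x' <= L r for some x' in [y, 1 - z].
   In dimension n, suppose that a neighbourhood S_h \ S were too small. Bisecting
   K repeatedly by pencils of hyperplanes {v (x_i - p) + w (x_j - q) = 0}, so that
   each time the proportion of S is preserved and S_h \ S stays too small in the
   chosen half, and running over a fine finite grid of points (p, q), leaves a piece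
   that is a thin tube around a segment. Its marginal along the segment is
   log-concave by Prekopa-Leindler, so the line case gives a contradiction. No limit
   of needles is needed, because h > 0 is fixed and S_h absorbs the thickness.

   Sharpness. Let xi be a linear form with xi(e_0) = 1 and norm 1 / |e_0|. On the
   thin tube {0 <= xi <= T, |y_j| <= eta T for j > 0} take the density
   proportional to exp(g xi / T) and S = {xi <= s}: moving along e_0 shows that S_h
   is exactly {xi <= s + h / |e_0|} inside the tube. The ratio tends to
   (g x + psi g) / x as eta -> 0, and g > 0 is chosen nearly optimal. *)
Require Import Defs.
From HB Require Import structures.
From mathcomp Require Import all_boot all_order all_algebra.
From mathcomp Require Import all_classical all_reals all_analysis.
From mathcomp Require Import measurable_realfun.
From mathcomp Require Import ring lra.
Set Implicit Arguments. Unset Strict Implicit. Unset Printing Implicit Defensive.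
Import Order.TTheory GRing.Theory Num.Theory.
Import numFieldNormedType.Exports.
Local Open Scope classical_set_scope.
Local Open Scope ring_scope.

(** * Lebesgue measure and the Tonelli theorem *)

(** The affine functions g x + psi g come from exponentials: for the density e^(g s) on [0, 1], the
    value at the point with a share x of the mass on its left, divided by the total mass, is g x +
    psi g. As an infimum of affine functions that are nonnegative on [0, 1], J gets symmetry,
    subadditivity and lower semicontinuity without any formula for the minimiser; calculus only
    enters to identify J x with x G(1/x). The set S is merely measurable and its traces on a needle
    may interlace arbitrarily, so the line case cannot be reduced to one cut point: windows are read
    from left to right, and every change of colour is paid for by the uncoloured mass in between.
    The resulting x' is only close to x, which semicontinuity of J makes harmless. If D r < J x for
    a content r, the inequality is strict. At one fixed h this leaves room for the thickness of the
    needle, the width of the windows, the truncation of the density and a Borel cover B of S_h \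
    S. *)

Lemma measurable_set_lt (R : realType) d (T : measurableType d) (f g : T -> R) :
  measurable_fun setT f -> measurable_fun setT g -> measurable [set x | f x < g x].
Proof.
move=> mf mg; have := measurable_fun_ltr mf mg measurableT (Y := [set true]).
by rewrite setTI; apply.
Qed.

Lemma measurable_set_le (R : realType) d (T : measurableType d) (f g : T -> R) :
  measurable_fun setT f -> measurable_fun setT g -> measurable [set x | f x <= g x].
Proof.
move=> mf mg; have := measurable_fun_ler mf mg measurableT (Y := [set true]).
by rewrite setTI; apply.
Qed.

Section lebesgue_tuple.
Context {R : realType}.
Implicit Types n : nat.

Definition box n (a b : n.-tuple R) : set (n.-tuple R) :=
  [set x | forall i, tnth a i <= tnth x i <= tnth b i].

Definition box_sys n : set (set (n.-tuple R)) :=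
  [set A | exists a b, A = box a b].

Lemma box_bigcap n (a b : n.-tuple R) :
  box a b = \bigcap_(i in [set: 'I_n])
    ((@tnth _ R ^~ i) @^-1` `[tnth a i, tnth b i]).
Proof.
apply/seteqP; split => x /= h i; first by move=> _ /=; rewrite in_itv /= h.
by have := h i I; rewrite /= in_itv.
Qed.

Lemma measurable_box n (a b : n.-tuple R) : measurable (box a b).
Proof.
rewrite box_bigcap; apply: fin_bigcap_measurable => // i _.
rewrite -[X in measurable X]setTI; exact: measurable_tnth.
Qed.

Lemma box_sys_setI n : setI_closed (@box_sys n).
Proof.
move=> _ _ [a [b ->]] [c [d ->]].
exists [tuple Num.max (tnth a i) (tnth c i) | i < n].
exists [tuple Num.min (tnth b i) (tnth d i) | i < n].
apply/seteqP; split => x /=.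
  move=> [h1 h2] i; rewrite !tnth_mktuple ge_max le_min.
  by have /andP[a1 b1] := h1 i; have /andP[c1 d1] := h2 i; rewrite a1 b1 c1 d1.
move=> h; split => i; have := h i; rewrite !tnth_mktuple ge_max le_min;
  by move=> /andP[/andP[a1 b1] /andP[c1 d1]]; rewrite ?a1 ?b1 ?c1 ?d1.
Qed.

Definition cube n (M : R) : set (n.-tuple R) :=
  box [tuple - M | i < n] [tuple M | i < n].

Lemma cubeP n (M : R) (x : n.-tuple R) :
  cube M x <-> forall i, `|tnth x i| <= M.
Proof.
split => h i; first by have := h i; rewrite !tnth_mktuple ler_norml.
by rewrite !tnth_mktuple -ler_norml.
Qed.

Lemma cube_cover n : \bigcup_(k in [set: nat]) (@cube n k%:R) = setT.
Proof.
apply/seteqP; split => // x _.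
pose m := \sum_(i < n) `|tnth x i|.
have m0 : 0 <= m by apply: sumr_ge0.
exists (Num.bound m) => //; apply/cubeP => i.
have le : `|tnth x i| <= m.
  by rewrite /m (bigD1 i)//= lerDl; apply: sumr_ge0 => j _.
exact: (le_trans le (ltW (archi_boundP m0))).
Qed.

(** The product sigma-algebra is generated by the half-spaces x <= y_i, and each of them is a
    countable union of closed boxes, the [g k] below. *)
Lemma measurable_box_sys n : measurable `<=` <<s @box_sys n >>.
Proof.
move=> A mA; apply: (@smallest_sub _ _ _ _ _ _ A mA).
  exact: smallest_sigma_algebra.
case: n A mA => [|n] A mA; first by rewrite big_ord0.
rewrite -bigcup_mkord_ord; apply: bigcup_sub => i Ii B [C mC <-]; rewrite setTI.
pose i' : 'I_n.+1 := inord i; rewrite -/i'.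
pose H := [set C : set R | <<s @box_sys n.+1 >> ((@tnth _ R ^~ i') @^-1` C)].
suff : measurable `<=` H by move=> /(_ _ mC).
have -> : (@measurable _ R : set (set R)) = (@RGenCInfty.G R).-sigma.-measurable.
  exact: RGenCInfty.measurableE.
apply: smallest_sub.
  split.
  - by rewrite /H/= preimage_set0; exact: sigma_algebra0.
  - move=> D HD; rewrite /H/= setTD preimage_setC.
    by rewrite -setTD; exact: sigma_algebraCD.
  - by move=> F HF; rewrite /H /= preimage_bigcup; exact: sigma_algebra_bigcup.
move=> D [x ->]; rewrite /H /=.
pose g (k : nat) := box [tuple if j == i' then x else - k%:R | j < n.+1]
                        [tuple k%:R | j < n.+1].
rewrite (_ : _ @^-1` _ = \bigcup_k g k).
  apply: sigma_algebra_bigcup => k; apply: sub_sigma_algebra.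
  by rewrite /g; eexists; eexists.
apply/seteqP; split=> [y /=|y [k _] /=].
  rewrite in_itv/= andbT => xy.
  have [k _ /cubeP hk] : (\bigcup_(k in [set: nat]) (@cube n.+1 k%:R)) y by rewrite cube_cover.
  exists k => // j; rewrite !tnth_mktuple; have := hk j; rewrite ler_norml => /andP[h1 ->].
  by rewrite andbT; case: eqP => [->|].
move=> /(_ i'); rewrite !tnth_mktuple eqxx in_itv /= andbT.
by move=> /andP[].
Qed.


(** [is_lebesgue] only speaks of boxes with ordered corners; the others are empty. *)
Lemma lebesgue_box_empty n (a b : n.-tuple R) (m : {measure set (n.-tuple R) -> \bar R}) :
  ~ (forall i, tnth a i <= tnth b i) -> m (box a b) = 0%E.
Proof.
move=> h; rewrite (_ : box a b = set0) ?measure0//.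
apply/seteqP; split => // x hx; apply: h => i.
by have /andP[/le_trans] := hx i; apply.
Qed.

Lemma is_lebesgue_cube n (lam : {measure set (n.-tuple R) -> \bar R}) (M : R) :
  is_lebesgue lam -> (lam (cube M) < +oo)%E.
Proof.
move=> hl; have [h|h] := pselect (forall i, tnth [tuple - M | i < n] i <= tnth [tuple M | i < n] i).
  by rewrite /cube (hl _ _ h) ltry.
by rewrite lebesgue_box_empty.
Qed.

Lemma is_lebesgue_unique n (l1 l2 : {measure set (n.-tuple R) -> \bar R}) :
  is_lebesgue l1 -> is_lebesgue l2 -> forall A, measurable A -> l1 A = l2 A.
Proof.
move=> h1 h2 A mA.
apply: (@g_sigma_algebra_measure_unique _ _ _ (@box_sys n) _ (fun k => cube k%:R)).
- by move=> _ [a [b ->]]; exact: measurable_box.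
- by move=> i; eexists; eexists.
- exact: cube_cover.
- exact: box_sys_setI.
- move=> _ [a [b ->]].
  have [h|h] := pselect (forall i, tnth a i <= tnth b i); first by rewrite (h1 _ _ h) (h2 _ _ h).
  by rewrite !lebesgue_box_empty.
- by move=> k; exact: is_lebesgue_cube.
- exact: measurable_box_sys.
Qed.

Lemma is_lebesgue_sigma_finite n (lam : {measure set (n.-tuple R) -> \bar R}) :
  is_lebesgue lam -> sigma_finite setT lam.
Proof.
move=> hl; exists (fun k => cube k%:R); first by rewrite cube_cover.
by move=> k; split; [exact: measurable_box | exact: is_lebesgue_cube].
Qed.

(** Inverse of the splitting of R^(n+1) into coordinate k and the remaining ones. *)
Definition ins n (k : 'I_n.+1) (t : R) (y : n.-tuple R) : n.+1.-tuple R :=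
  [tuple if unlift k i is Some j then tnth y j else t | i < n.+1].

Lemma tnth_ins n (k : 'I_n.+1) t y : tnth (ins k t y) k = t.
Proof. by rewrite tnth_mktuple unlift_none. Qed.

Lemma tnth_ins_lift n (k : 'I_n.+1) t y j : tnth (ins k t y) (lift k j) = tnth y j.
Proof. by rewrite tnth_mktuple liftK. Qed.

Lemma measurable_idTR : measurable_fun setT (idfun : measurableTypeR R -> R).
Proof. by move=> _ A mA; rewrite setTI. Qed.

Lemma measurable_ins n (k : 'I_n.+1) :
  measurable_fun setT (fun z : measurableTypeR R * n.-tuple R => ins k z.1 z.2).
Proof.
apply/measurable_fun_tnthP => i; rewrite /comp /=.
under eq_fun do rewrite tnth_mktuple.
case: unliftP => [j _|_]; last exact: (measurableT_comp measurable_idTR).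
apply: (@measurableT_comp _ _ _ _ _ _ (fun y : n.-tuple R => tnth y j)) => //.
exact: measurable_tnth.
Qed.

Definition drop_coord n (k : 'I_n.+1) (x : n.+1.-tuple R) : n.-tuple R :=
  [tuple tnth x (lift k j) | j < n].

Lemma measurable_drop_coord n (k : 'I_n.+1) : measurable_fun setT (@drop_coord n k).
Proof.
apply/measurable_fun_tnthP => i; rewrite /comp /=.
under eq_fun do rewrite tnth_mktuple.
exact: measurable_tnth.
Qed.

Definition unit_slab n : set (n.+1.-tuple R) :=
  (@tnth _ R ^~ ord0) @^-1` `[0, 1].

Lemma measurable_unit_slab n : measurable (@unit_slab n).
Proof. by rewrite -[X in measurable X]setTI; exact: measurable_tnth. Qed.

(** The measure of A is taken to be the [lam]-measure of [0, 1] times A. Inductions on the dimension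
    can thus start from the one given Lebesgue measure. *)
Lemma is_lebesgue_pred n (lam : {measure set (n.+1.-tuple R) -> \bar R}) :
  is_lebesgue lam ->
  exists lam' : {sigma_finite_measure set (n.-tuple R) -> \bar R}, is_lebesgue lam'.
Proof.
move=> hl.
pose mp := measure_function_pushforward__canonical__measure_function_Measure.
pose m0 : {measure set (n.-tuple R) -> \bar R} :=
  mp _ _ _ _ _ (mrestr lam (@measurable_unit_slab n)) _ (@measurable_drop_coord n ord0).
have lm0 : is_lebesgue m0.
  move=> a b ab.
  have -> : m0 (box a b) = lam (box (ins ord0 0 a) (ins ord0 1 b)).
    rewrite /m0 /= /pushforward /mrestr; congr (lam _).
    apply/seteqP; split => x /=.
      move=> [h1]; rewrite /unit_slab /= in_itv /= => h2 i.
      case: (unliftP ord0 i) => [j ->|->]; last by rewrite !tnth_ins.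
      by rewrite !tnth_ins_lift; have := h1 j; rewrite tnth_mktuple.
    move=> h; split.
      by move=> j; have := h (lift ord0 j); rewrite !tnth_ins_lift tnth_mktuple.
    by rewrite /unit_slab /= in_itv /=; have := h ord0; rewrite !tnth_ins.
  rewrite hl; last first.
    by move=> i; case: (unliftP ord0 i) => [j ->|->]; rewrite ?tnth_ins_lift ?tnth_ins.
  rewrite big_ord_recl !tnth_ins subr0 mul1r; congr EFin.
  by apply: eq_bigr => j _; rewrite !tnth_ins_lift.
pose sm := Measure_isSigmaFinite.Build _ _ _ m0 (is_lebesgue_sigma_finite lm0).
pose lam' : {sigma_finite_measure set (n.-tuple R) -> \bar R} := HB.pack (Measure.sort m0) sm.
by exists lam'.
Qed.

(** The image of the product measure under [ins k] gives every box its volume, so it is [lam] by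
    uniqueness. *)
Lemma lebesgue_prod n (lam : {measure set (n.+1.-tuple R) -> \bar R})
    (lam' : {sigma_finite_measure set (n.-tuple R) -> \bar R}) k
    (f : n.+1.-tuple R -> \bar R) :
  is_lebesgue lam -> is_lebesgue lam' ->
  measurable_fun setT f -> (forall x, 0 <= f x)%E ->
  (\int[lam]_x f x = \int[lebesgue_measure \x lam']_z f (ins k z.1 z.2))%E.
Proof.
move=> hl lm0 mf f0.
pose mp := measure_function_pushforward__canonical__measure_function_Measure.
pose prod : {measure set (measurableTypeR R * n.-tuple R) -> \bar R} := (lebesgue_measure \x lam')%E.
have pE A B : measurable A -> measurable B ->
    prod (A `*` B) = (lebesgue_measure A * lam' B)%E by exact: product_measure1E.
pose m1 : {measure set (n.+1.-tuple R) -> \bar R} := mp _ _ _ _ _ prod _ (@measurable_ins n k).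
have lm1 : is_lebesgue m1.
  move=> a b ab.
  rewrite -[m1 _]/(prod (_ @^-1` _)).
  rewrite (_ : _ @^-1` _ = `[tnth a k, tnth b k]%classic `*` box (drop_coord k a) (drop_coord k b)).
    rewrite pE//; last exact: measurable_box.
    rewrite lebesgue_measure_itv/= lte_fin.
    rewrite (lm0 (drop_coord k a)); last by move=> i; rewrite !tnth_mktuple.
    rewrite (bigD1_ord k)//=.
    under eq_bigr do rewrite !tnth_mktuple.
    case: ltP => h; first by rewrite -EFinB -EFinM.
    have -> : tnth a k = tnth b k by apply/eqP; rewrite eq_le ab h.
    by rewrite mul0e subrr mul0r.
  apply/seteqP; split => [[t y]/=|[t y]/= [h1 h2] i].
    move=> h; split; first by rewrite in_itv /=; have := h k; rewrite tnth_ins.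
    by move=> j; have := h (lift k j); rewrite tnth_ins_lift !tnth_mktuple.
  case: (unliftP k i) => [j ->|->]; last by rewrite !tnth_ins; move: h1; rewrite in_itv.
  by rewrite !tnth_ins_lift; have := h2 j; rewrite !tnth_mktuple.
have -> : (\int[lam]_x f x = \int[m1]_x f x)%E.
  by apply: eq_measure_integral => A mA _; exact: is_lebesgue_unique.
have mi := @measurable_ins n k.
rewrite /m1 ge0_integral_pushforward//.
Qed.

Lemma measurable_comp_ins n k (f : n.+1.-tuple R -> \bar R) :
  measurable_fun setT f ->
  measurable_fun setT (fun z : measurableTypeR R * n.-tuple R => f (ins k z.1 z.2)).
Proof. by move=> mf; apply: measurableT_comp => //; exact: measurable_ins. Qed.

Lemma lebesgue_fubini n (lam : {measure set (n.+1.-tuple R) -> \bar R})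
    (lam' : {sigma_finite_measure set (n.-tuple R) -> \bar R}) k
    (f : n.+1.-tuple R -> \bar R) :
  is_lebesgue lam -> is_lebesgue lam' ->
  measurable_fun setT f -> (forall x, 0 <= f x)%E ->
  (\int[lam]_x f x = \int[lebesgue_measure]_t \int[lam']_y f (ins k t y))%E.
Proof.
move=> hl hl' mf f0; rewrite (lebesgue_prod k hl hl')// fubini_tonelli1//.
exact: measurable_comp_ins.
Qed.

Lemma lebesgue_fubini_rev n (lam : {measure set (n.+1.-tuple R) -> \bar R})
    (lam' : {sigma_finite_measure set (n.-tuple R) -> \bar R}) k
    (f : n.+1.-tuple R -> \bar R) :
  is_lebesgue lam -> is_lebesgue lam' ->
  measurable_fun setT f -> (forall x, 0 <= f x)%E ->
  (\int[lam]_x f x = \int[lam']_y \int[lebesgue_measure]_t f (ins k t y))%E.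
Proof.
move=> hl hl' mf f0; rewrite (lebesgue_fubini k hl hl')//.
apply: (@fubini_tonelli _ _ _ _ _ (@lebesgue_measure R) lam' (fun z => f (ins k z.1 z.2))) => //.
exact: measurable_comp_ins.
Qed.

Lemma measurable_marginal n k (f : n.+1.-tuple R -> \bar R) :
  measurable_fun setT f -> (forall x, 0 <= f x)%E ->
  measurable_fun setT (fun y => \int[lebesgue_measure]_t f (ins k t y))%E.
Proof.
move=> mf f0.
apply: (@measurable_fun_fubini_tonelli_G _ _ _ _ _ (@lebesgue_measure R)
  (fun z => f (ins k z.1 z.2))) => //.
exact: measurable_comp_ins.
Qed.

End lebesgue_tuple.

(** * The Prekopa-Leindler inequality on the line *)

Section prekopa1.
Context {R : realType}.
Notation leb := (@lebesgue_measure R).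
Implicit Types (f : measurableTypeR R -> R).

Lemma amgm2 (t x y : R) : 0 < t < 1 -> 0 <= x -> 0 <= y ->
  x `^ t * y `^ (1 - t) <= t * x + (1 - t) * y.
Proof.
move=> /andP[t0 t1] x0 y0; have t1' : 0 < 1 - t by rewrite subr_gt0.
have := @conjugate_powR R (x `^ t) (y `^ (1 - t)) t^-1 (1 - t)^-1 (powR_ge0 _ _) (powR_ge0 _ _).
rewrite !invr_gt0 !invrK -!powRrM !divff ?gt_eqF// !powRr1// subrKC.
by rewrite (mulrC x) (mulrC y); apply.
Qed.

(** Region under the graph of f / k, cut at height 1. Its horizontal sections are the sets
    [lev f k u], its vertical ones have length min (1, f / k) for f >= 0; Tonelli on it is the layer
    cake formula. *)
Definition hypo f (k : R) : set (measurableTypeR R * measurableTypeR R) :=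
  [set z | z.2 \in `[0, 1] /\ k * z.2 < f z.1].

Lemma measurable_hypo f k : measurable_fun setT f -> measurable (hypo f k).
Proof.
move=> mf.
rewrite (_ : hypo f k = (snd @^-1` `[0, 1]%classic) `&`
   [set z | k * z.2 < f z.1]); last first.
  by apply/seteqP; split => z /=; rewrite /hypo/= inE/=.
apply: measurableI.
  by rewrite -[X in measurable X]setTI; apply: measurable_snd.
apply: (@measurable_set_lt _ _ _ (fun z : measurableTypeR R * measurableTypeR R => k * z.2) (fun z => f z.1)).
  by apply: measurable_funM => //; apply: (measurableT_comp (@measurable_idTR R)).
exact: measurableT_comp.
Qed.

Definition lev f (k u : R) : set (measurableTypeR R) := [set s | k * u < f s].

Lemma measurable_lev f k u : measurable_fun setT f -> measurable (lev f k u).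
Proof.
by move=> mf; exact: measurable_set_lt.
Qed.

Lemma ysection_hypo f k u : u \in `[0, 1] -> ysection (hypo f k) u = lev f k u.
Proof.
by move=> u01; rewrite ysectionE; apply/seteqP; split => s /=; [case|move=> h; split].
Qed.

Lemma measurable_fun_lev f k : measurable_fun setT f ->
  measurable_fun (`[0, 1]%classic : set (measurableTypeR R)) (fun u => leb (lev f k u)).
Proof.
move=> mf; apply: (eq_measurable_fun (leb \o ysection (hypo f k))).
  move=> u; rewrite inE/= => u01; congr (leb _); exact: ysection_hypo.
apply: measurable_funTS; apply: measurable_fun_ysection; exact: measurable_hypo.
Qed.

Lemma layer_cake f (k : R) : 0 < k -> measurable_fun setT f -> (forall s, 0 <= f s) ->
  (\int[leb]_(u in `[0%R, 1%R]) leb (lev f k u) =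
   \int[leb]_s (Num.min 1 (f s / k))%:E)%E.
Proof.
move=> k0 mf f0.
have mh := measurable_hypo k mf.
have := indic_fubini_tonelli (@lebesgue_measure R) (@lebesgue_measure R) mh.
rewrite indic_fubini_tonelli_FE// indic_fubini_tonelli_GE// => E.
rewrite integral_mkcond.
transitivity (\int[leb]_y (leb \o ysection (hypo f k)) y)%E.
  apply: eq_integral => u _; rewrite patchE /=.
  case: ifPn => [|u01].
    by rewrite inE/= => u01; rewrite ysection_hypo.
  rewrite (_ : ysection _ _ = set0) ?measure0//.
  apply/seteqP; split => // s; rewrite ysectionE /= /hypo /= => -[h _].
  by move/negP : u01; apply; rewrite inE.
rewrite -E; apply: eq_integral => s _ /=.
have [h|h] := ltP 1 (f s / k).
  rewrite (_ : xsection _ _ = `[0, 1]%classic).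
    by rewrite lebesgue_measure_itv/= lte_fin ltr01 sube0.
  rewrite xsectionE; apply/seteqP; split => u; first by case.
  move=> u01; split => //=.
  rewrite mulrC -ltr_pdivlMr//; apply: le_lt_trans h.
  by move: u01; rewrite /= in_itv/= => /andP[].
rewrite (_ : xsection _ _ = `[0, f s / k[%classic).
  rewrite lebesgue_measure_itv/= lte_fin oppr0 adde0.
  case: ltP => // h'; congr EFin; apply/eqP; rewrite eq_le h' andbT.
  by rewrite divr_ge0// ltW.
rewrite xsectionE; apply/seteqP; split => u; rewrite /hypo /= !in_itv/=.
  by move=> [/andP[u0 u1] h2]; rewrite u0/= ltr_pdivlMr// mulrC.
move=> /andP[u0 u1].
by split; [rewrite u0/= (le_trans (ltW u1))|rewrite mulrC -ltr_pdivlMr].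
Qed.

Lemma conv_itv (p q u : R) : 0 <= u <= 1 -> p <= q -> p <= (1 - u) * p + u * q <= q.
Proof. by move=> /andP[u0 u1] pq; apply/andP; split; nra. Qed.

(** Brunn-Minkowski on the line, for bounded intervals: points p, p' of A and q, q' of B are taken
    within e / 2 of the ends, and convexity of A and B puts the whole segment from t p + (1 - t) q
    to t p' + (1 - t) q' into C. *)
Lemma interval_mix (A B C : set (measurableTypeR R)) (t : R) : 0 < t < 1 ->
  measurable A -> measurable B -> measurable C ->
  A !=set0 -> B !=set0 -> is_interval A -> is_interval B ->
  has_ubound A -> has_lbound A -> has_ubound B -> has_lbound B ->
  (forall p q, A p -> B q -> C (t * p + (1 - t) * q)) ->
  (t%:E * leb A + (1 - t)%:E * leb B <= leb C)%E.
Proof.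
move=> /andP[t0 t1] mA mB mC A0 B0 iA iB uA lA uB lB ABC.
have t1' : 0 < 1 - t by rewrite subr_gt0.
have key (D : set (measurableTypeR R)) : measurable D -> D !=set0 -> has_ubound D -> has_lbound D ->
    (leb D <= (sup D - inf D)%:E)%E.
  move=> mD D0 uD lD.
  have : (leb D <= leb `[inf D, sup D]%classic)%E.
    apply: le_measure; rewrite ?inE//.
    by move=> x Dx /=; rewrite in_itv /=; rewrite ge_inf// ub_le_sup.
  rewrite lebesgue_measure_itv/= lte_fin; case: ltP => h; first by rewrite EFinB.
  move=> /le_trans; apply; rewrite lee_fin subr_ge0.
  by case: D0 => x Dx; apply: (@le_trans _ _ x); [exact: ge_inf|exact: ub_le_sup].
have hA := key _ mA A0 uA lA; have hB := key _ mB B0 uB lB.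
apply: (@le_trans _ _ (t * (sup A - inf A) + (1 - t) * (sup B - inf B))%:E).
  by rewrite [leRHS]EFinD [(t * _)%:E]EFinM [((1 - t) * _)%:E]EFinM leeD// lee_pmul2l ?fin_numE ?lte_fin.
apply/lee_addgt0Pr => e e0.
have e20 : 0 < e / 2 by rewrite divr_gt0.
have [p Ap pA] := inf_adherent e20 (conj A0 lA).
have [p' Ap' pA'] := sup_adherent e20 (conj A0 uA).
have [q Bq qB] := inf_adherent e20 (conj B0 lB).
have [q' Bq' qB'] := sup_adherent e20 (conj B0 uB).
set x := t * p + (1 - t) * q; set y := t * p' + (1 - t) * q'.
apply: (@le_trans _ _ (y - x + e)%:E).
  rewrite lee_fin /x /y.
  have h1 : t * (sup A - inf A) <= t * (p' - p + e) by rewrite ler_pM2l//; lra.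
  have h2 : (1 - t) * (sup B - inf B) <= (1 - t) * (q' - q + e) by rewrite ler_pM2l//; lra.
  by move: h1 h2; nra.
rewrite [leLHS]EFinD leeD2r//.
have [xy|xy] := ltP y x.
  by apply: (@le_trans _ _ 0%E); rewrite ?measure_ge0// lee_fin; lra.
have : (leb `[x, y]%classic <= leb C)%E.
  apply: le_measure; rewrite ?inE// => z /=; rewrite in_itv/= => /andP[xz zy].
  have [xy'|xy'] := eqVneq x y.
    have -> : z = x by apply/eqP; rewrite eq_le xz xy' zy.
    exact: ABC.
  have xy0 : 0 < y - x by rewrite subr_gt0 lt_neqAle xy' xy.
  pose u := (z - x) / (y - x).
  have u0 : 0 <= u by rewrite divr_ge0 ?subr_ge0.
  have u1 : u <= 1 by rewrite ler_pdivrMr// mul1r lerD2r.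
  have zE : z = t * ((1 - u) * p + u * p') + (1 - t) * ((1 - u) * q + u * q').
    have : u * (y - x) = z - x by rewrite divfK// gt_eqF.
    rewrite /x /y; set w := z; nra.
  rewrite zE; apply: ABC.
    have [pp|/ltW pp] := leP p p'; first by apply: (iA p p') => //; apply: conv_itv; rewrite ?u0.
    have -> : (1 - u) * p + u * p' = (1 - (1 - u)) * p' + (1 - u) * p by ring.
    by apply: (iA p' p) => //; apply: conv_itv => //; lra.
  have [pp|/ltW pp] := leP q q'; first by apply: (iB q q') => //; apply: conv_itv; rewrite ?u0.
  have -> : (1 - u) * q + u * q' = (1 - (1 - u)) * q' + (1 - u) * q by ring.
  by apply: (iB q' q) => //; apply: conv_itv => //; lra.
rewrite lebesgue_measure_itv/= lte_fin; case: ltP => h; first by rewrite EFinB.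
by move=> h0; apply: le_trans h0; rewrite lee_fin; lra.
Qed.

Lemma lev_interval f k u : (forall s s' r, s <= r <= s' -> Num.min (f s) (f s') <= f r) ->
  is_interval (lev f k u).
Proof.
move=> qc x y hx hy z xzy; rewrite /lev /=; apply: lt_le_trans (qc _ _ _ xzy).
by rewrite lt_min; apply/andP; split.
Qed.

Lemma lev_bounded f k u M : 0 <= k -> 0 <= u -> (forall s, M < `|s| -> f s = 0) ->
  has_ubound (lev f k u) /\ has_lbound (lev f k u).
Proof.
move=> k0 u0 fM.
have h s : lev f k u s -> `|s| <= M.
  move=> /= hs; rewrite leNgt; apply/negP => /fM E.
  by move: hs; rewrite /lev /= E ltNge mulr_ge0.
split; [exists M|exists (- M)] => s /h; rewrite ler_norml => /andP[] //.
Qed.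

Lemma integral_layer f k I : 0 < k -> measurable_fun setT f -> (forall s, 0 <= f s) ->
  (forall s, f s <= k) -> (\int[leb]_s (f s)%:E = I%:E)%E ->
  (\int[leb]_(u in `[0%R, 1%R]) leb (lev f k u) = (I / k)%:E)%E.
Proof.
move=> k0 mf f0 fk fI; rewrite layer_cake//.
under eq_integral.
  move=> s _; rewrite min_r; last by rewrite ler_pdivrMr// mul1r.
  rewrite mulrC EFinM; over.
rewrite ge0_integralZl//.
- by rewrite fI -EFinM mulrC.
- exact/measurable_EFinP.
- by move=> s _; rewrite lee_fin.
- by rewrite lee_fin invr_ge0 ltW.
Qed.

(** Dividing a and b by their suprema makes all their level sets at heights u < 1 nonempty;
    quasi-concavity makes them intervals. [interval_mix] at each height and the layer cake formula
    then give the additive bound t Ia / sa + (1 - t) Ib / sb, and the arithmetic-geometric mean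
    inequality turns it into the multiplicative one. *)
Lemma prekopa_leindler1 (a b c : measurableTypeR R -> R) (t M Ia Ib : R) :
  0 < t < 1 ->
  measurable_fun setT a -> measurable_fun setT b -> measurable_fun setT c ->
  (forall s, 0 <= a s) -> (forall s, 0 <= b s) -> (forall s, 0 <= c s) ->
  (forall s s' r, s <= r <= s' -> Num.min (a s) (a s') <= a r) ->
  (forall s s' r, s <= r <= s' -> Num.min (b s) (b s') <= b r) ->
  has_ubound (range a) -> has_ubound (range b) ->
  (forall s, M < `|s| -> a s = 0) -> (forall s, M < `|s| -> b s = 0) ->
  (forall s s', a s `^ t * b s' `^ (1 - t) <= c (t * s + (1 - t) * s')) ->
  (\int[leb]_s (a s)%:E = Ia%:E)%E -> (\int[leb]_s (b s)%:E = Ib%:E)%E ->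
  ((Ia `^ t * Ib `^ (1 - t))%:E <= \int[leb]_s (c s)%:E)%E.
Proof.
move=> t01 ma mb mc a0 b0 c0 qa qb ua ub aM bM abc hIa hIb.
have /andP[t0 t1] := t01; have t1' : 0 < 1 - t by rewrite subr_gt0.
have c00 : (0 <= \int[leb]_s (c s)%:E)%E by apply: integral_ge0 => s _; rewrite lee_fin.
have Ia0 : 0 <= Ia by rewrite -lee_fin -hIa; apply: integral_ge0 => s _; rewrite lee_fin.
have Ib0 : 0 <= Ib by rewrite -lee_fin -hIb; apply: integral_ge0 => s _; rewrite lee_fin.
have [Ia00|Ian0] := eqVneq Ia 0; first by rewrite Ia00 powR0 ?gt_eqF// mul0r.
have [Ib00|Ibn0] := eqVneq Ib 0; first by rewrite Ib00 powR0 ?gt_eqF// mulr0.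
have supP (g : measurableTypeR R -> R) I : (forall s, 0 <= g s) -> has_ubound (range g) ->
    (\int[leb]_s (g s)%:E = I%:E)%E -> I != 0 ->
    (forall s, g s <= sup (range g)) /\ 0 < sup (range g).
  move=> g0 ug gI I0.
  have h s : g s <= sup (range g) by apply: ub_le_sup => //; exists s.
  split => //; rewrite ltNge; apply/negP => h'; move/eqP : I0; apply.
  apply: EFin_inj; rewrite -gI integral0_eq// => s _; congr EFin; apply/eqP.
  by rewrite eq_le g0 andbT (le_trans (h s)).
have [asa sa0] := supP a Ia a0 ua hIa Ian0.
have [bsb sb0] := supP b Ib b0 ub hIb Ibn0.
set sa := sup (range a) in asa sa0; set sb := sup (range b) in bsb sb0.
pose k := sa `^ t * sb `^ (1 - t).
have k0 : 0 < k by rewrite mulr_gt0// powR_gt0.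
have La := integral_layer sa0 ma a0 asa hIa.
have Lb := integral_layer sb0 mb b0 bsb hIb.
have Lc := layer_cake k0 mc c0.
have levne (g : measurableTypeR R -> R) u : 0 < sup (range g) -> (0 <= u < 1) ->
    lev g (sup (range g)) u !=set0.
  move=> sg0 /andP[u0 u1].
  have [||y [s _ <-] hy] := @sup_gt R (range g) (sup (range g) * u).
  - by exists (g 0); exists 0.
  - by rewrite gtr_pMr.
  - by exists s.
have main : (\int[leb]_(u in `[0%R, 1%R]) (t%:E * leb (lev a sa u) + (1 - t)%:E * leb (lev b sb u))
    <= \int[leb]_(u in `[0%R, 1%R]) leb (lev c k u))%E.
  apply: ge0_le_integral => //.
  - by move=> u _; rewrite adde_ge0// mule_ge0// lee_fin ltW.
  - apply: emeasurable_funD; apply: measurable_funeM; exact: measurable_fun_lev.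
  - exact: measurable_fun_lev.
  move=> u; rewrite /= in_itv/= => /andP[u0 u1].
  have [->|un1] := eqVneq u 1.
    have -> : lev a sa 1 = set0.
      by apply/seteqP; split => // s; rewrite /lev/= mulr1 ltNge asa.
    have -> : lev b sb 1 = set0.
      by apply/seteqP; split => // s; rewrite /lev/= mulr1 ltNge bsb.
    by rewrite !measure0 !mule0 adde0.
  have u1' : 0 <= u < 1 by rewrite u0 lt_neqAle un1.
  have [ua' la'] := lev_bounded (ltW sa0) u0 aM.
  have [ub' lb'] := lev_bounded (ltW sb0) u0 bM.
  apply: interval_mix => //; try exact: measurable_lev; try exact: lev_interval; try exact: levne.
  move=> p q; rewrite /lev /= => hp hq; apply: lt_le_trans (abc p q).
  have -> : k * u = (sa * u) `^ t * (sb * u) `^ (1 - t).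
    rewrite (powRM _ (ltW sa0) u0) (powRM _ (ltW sb0) u0) mulrACA -powRD ?subrKC ?powRr1//.
    by rewrite oner_eq0.
  have [->|u00] := eqVneq u 0.
    rewrite !mulr0 !powR0 ?gt_eqF// mul0r mulr_gt0// powR_gt0//.
      by apply: le_lt_trans hp; rewrite mulr_ge0 // ltW.
    by apply: le_lt_trans hq; rewrite mulr_ge0 // ltW.
  have up : 0 < u by rewrite lt_neqAle eq_sym u00.
  apply: ltr_pM; rewrite ?powR_ge0//.
    by apply: gt0_ltr_powR => //; rewrite nnegrE// mulr_ge0// ltW.
  by apply: gt0_ltr_powR => //; rewrite nnegrE// mulr_ge0// ltW.
move: main; rewrite ge0_integralD//; last 4 first.
- by move=> u _; rewrite mule_ge0// lee_fin ltW.
- by apply: measurable_funeM; exact: measurable_fun_lev.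
- by move=> u _; rewrite mule_ge0// lee_fin ltW.
- by apply: measurable_funeM; exact: measurable_fun_lev.
rewrite !ge0_integralZl//; try exact: measurable_fun_lev; try by rewrite lee_fin ltW.
rewrite La Lb Lc => main.
have kc : (k%:E * \int[leb]_s (Num.min 1 (c s / k))%:E <= \int[leb]_s (c s)%:E)%E.
  rewrite -ge0_integralZl//; last 3 first.
  - apply/measurable_EFinP; apply: measurable_minr => //.
    by apply: measurable_funM.
  - by move=> s _; rewrite lee_fin le_min ler01 divr_ge0// ltW.
  - by rewrite lee_fin ltW.
  apply: ge0_le_integral => //.
  - by move=> s _; rewrite mule_ge0// lee_fin ?(ltW k0)// le_min ler01 divr_ge0// ltW.
  - apply/measurable_EFinP; apply: measurable_funM => //; apply: measurable_minr => //.
    by apply: measurable_funM.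
  - exact/measurable_EFinP.
  - move=> s _; rewrite -EFinM lee_fin.
    by apply: (@le_trans _ _ (k * (c s / k))); [rewrite ler_pM2l// ge_min lexx orbT|rewrite mulrC divfK// gt_eqF].
apply: le_trans kc.
apply: (@le_trans _ _ (k * (t * (Ia / sa) + (1 - t) * (Ib / sb)))%:E); last first.
  by rewrite [leLHS]EFinM lee_pmul2l// ?lte_fin.
rewrite lee_fin.
have := @amgm2 t (Ia / sa) (Ib / sb) t01 (divr_ge0 Ia0 (ltW sa0)) (divr_ge0 Ib0 (ltW sb0)).
move=> /(ler_wpM2l (ltW k0)); apply: le_trans.
have E (x y r : R) : 0 <= x -> 0 < y -> y `^ r * (x / y) `^ r = x `^ r.
  by move=> x0 y0; rewrite -powRM ?divr_ge0 ?(ltW y0)// mulrC divfK ?gt_eqF.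
by rewrite /k mulrACA !E.
Qed.

End prekopa1.

(** * Marginals of log-concave functions *)

Section marginal.
Context {R : realType}.
Notation leb := (@lebesgue_measure R).

(** Bounds on the values and on the support make all marginals finite, and the class is stable under
    integrating out one coordinate, with B replaced by 2 B M. *)
Definition bounded_logconcave n (f : n.-tuple R -> R) (B M : R) :=
  [/\ measurable_fun setT f, logconcave_density f, (forall x, f x <= B) &
      forall x i, M < `|tnth x i| -> f x = 0].

Definition logconcave1 (m : measurableTypeR R -> R) :=
  (forall s, 0 <= m s) /\
  forall s s' t : R, 0 <= t <= 1 ->
    m s `^ t * m s' `^ (1 - t) <= m (t * s + (1 - t) * s').

Lemma vscale0_vadd n (x y : n.-tuple R) : vadd (vscale 0 x) (vscale (1 - 0) y) = y.
Proof. by apply: eq_from_tnth => i; rewrite !tnth_mktuple mul0r add0r subr0 mul1r. Qed.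

Lemma vscale1_vadd n (x y : n.-tuple R) : vadd (vscale 1 x) (vscale (1 - 1) y) = x.
Proof. by apply: eq_from_tnth => i; rewrite !tnth_mktuple subrr mul0r addr0 mul1r. Qed.

Lemma ins_conv n (k : 'I_n.+1) (s s' t : R) (y y' : n.-tuple R) :
  ins k (t * s + (1 - t) * s') (vadd (vscale t y) (vscale (1 - t) y')) =
  vadd (vscale t (ins k s y)) (vscale (1 - t) (ins k s' y')).
Proof.
apply: eq_from_tnth => i; rewrite !tnth_mktuple.
by case: unliftP => // j _; rewrite !tnth_mktuple.
Qed.

Lemma min_le_powR (x y t : R) : 0 <= t <= 1 -> 0 <= x -> 0 <= y ->
  Num.min x y <= x `^ t * y `^ (1 - t).
Proof.
move=> /andP[t0 t1] x0 y0.
have t1' : 0 <= 1 - t by rewrite subr_ge0.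
have m0 : 0 <= Num.min x y by rewrite le_min x0.
have -> : Num.min x y = Num.min x y `^ t * Num.min x y `^ (1 - t).
  by rewrite -powRD ?subrKC ?powRr1// oner_eq0.
by apply: ler_pM; rewrite ?powR_ge0//; apply: ge0_ler_powR; rewrite ?nnegrE ?ge_min ?lexx ?orbT.
Qed.

Lemma logconcave1_quasi (m : measurableTypeR R -> R) s s' r : logconcave1 m ->
  s <= r <= s' -> Num.min (m s) (m s') <= m r.
Proof.
move=> [m0 mc] /andP[sr rs'].
have [E|ss'] := eqVneq s s'.
  have -> : r = s by apply/eqP; rewrite eq_le sr E rs'.
  by rewrite ge_min lexx.
have h : 0 < s' - s by rewrite subr_gt0 lt_neqAle ss' (le_trans sr).
pose t := (s' - r) / (s' - s).
have t01 : 0 <= t <= 1.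
  apply/andP; split; first by rewrite divr_ge0 ?(ltW h)// subr_ge0.
  by rewrite ler_pdivrMr// mul1r lerD2l lerN2.
have -> : r = t * s + (1 - t) * s'.
  have : t * (s' - s) = s' - r by rewrite divfK// gt_eqF.
  by lra.
by apply: le_trans (mc _ _ _ t01); apply: min_le_powR.
Qed.

Lemma slice_logconcave1 n (k : 'I_n.+1) (f : n.+1.-tuple R -> R) y :
  logconcave_density f -> logconcave1 (fun t => f (ins k t y)).
Proof.
move=> [f0 fc]; split => // s s' t t01; apply: le_trans (fc _ _ _ t01) _.
rewrite -ins_conv le_eqVlt; apply/orP; left; apply/eqP; congr (f (ins k _ _)).
apply: eq_from_tnth => i; rewrite !tnth_mktuple; lra.
Qed.

Lemma measurable_slice n (k : 'I_n.+1) (f : n.+1.-tuple R -> R) y :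
  measurable_fun setT f ->
  measurable_fun setT (fun t : measurableTypeR R => f (ins k t y)).
Proof.
move=> mf; apply: measurableT_comp => //.
apply/measurable_fun_tnthP => i; rewrite /comp /=.
under eq_fun do rewrite tnth_mktuple.
by case: unliftP => [j _|_]; [exact: measurable_cst|exact: measurable_idTR].
Qed.

Section step.
Variables (n : nat) (k : 'I_n.+1) (f : n.+1.-tuple R -> R) (B M : R).
Hypotheses (M0 : 0 <= M) (hf : bounded_logconcave f B M).

Let f0 x : 0 <= f x. Proof. by case: hf => _ []. Qed.

Let supp t y : M < `|t| -> f (ins k t y) = 0.
Proof. by move=> h; case: hf => _ _ _ /(_ (ins k t y) k); apply; rewrite tnth_ins. Qed.

Lemma integral_slice_le y : (\int[leb]_t (f (ins k t y))%:E <= (B * (M + M))%:E)%E.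
Proof.
have [mf _ fB _] := hf.
have B0 : 0 <= B by apply: le_trans (fB (ins k 0 y)); exact: f0.
have -> : ((B * (M + M))%:E = \int[leb]_(t in `[(- M)%R, M]) (cst B%:E) t)%E.
  rewrite integral_cst//= lebesgue_measure_itv/= lte_fin.
  case: ltP => h; first by rewrite opprK.
  have -> : M = 0.
    by apply/eqP; rewrite eq_le M0 andbT -oppr_ge0; exact: (le_trans M0 h).
  by rewrite addr0 mulr0 mule0.
rewrite [leRHS]integral_mkcond; apply: ge0_le_integral => //.
- by move=> t _; rewrite lee_fin.
- by apply/measurable_EFinP; exact: measurable_slice.
- by apply/(measurable_restrictT _ _).1 => //; exact: measurable_cst.
move=> t _; rewrite patchE; case: ifPn => [_|]; first by rewrite lee_fin.
rewrite notin_setE /= in_itv /= -ler_norml => /negP; rewrite -ltNge => h.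
by rewrite supp.
Qed.

Definition marg (y : n.-tuple R) : R := fine (\int[leb]_t (f (ins k t y))%:E)%E.

Lemma margE y : (\int[leb]_t (f (ins k t y))%:E = (marg y)%:E)%E.
Proof.
rewrite /marg fineK// ge0_fin_numE; first exact: le_lt_trans (integral_slice_le y) (ltry _).
by apply: integral_ge0 => t _; rewrite lee_fin.
Qed.

(** Log-concavity comes from [prekopa_leindler1] on the slices over y, over y' and over their
    combination; t = 0 and t = 1 are outside its range and immediate. *)
Lemma marg_bounded_logconcave : bounded_logconcave marg (B * (M + M)) M.
Proof.
have [mf lcf fB fM] := hf; split.
- apply: (measurableT_comp (fine_measurable measurableT)).
  apply: (measurable_marginal k (f := fun x => (f x)%:E)).
    exact/measurable_EFinP.
  by move=> x; rewrite lee_fin.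
- split=> [y|y y' t t01].
    by apply: fine_ge0; apply: integral_ge0 => t _; rewrite lee_fin.
  have [->|t0] := eqVneq t 0.
    by rewrite powRr0 mul1r vscale0_vadd subr0 powRr1// fine_ge0// integral_ge0// => s _; rewrite lee_fin.
  have [->|t1] := eqVneq t 1.
    by rewrite vscale1_vadd subrr powRr0 mulr1 powRr1// fine_ge0// integral_ge0// => s _; rewrite lee_fin.
  have t01' : 0 < t < 1 by case/andP: t01 => ? ?; rewrite !lt_neqAle t1 eq_sym t0; apply/andP.
  rewrite -lee_fin -margE.
  apply: (@prekopa_leindler1 R (fun s => f (ins k s y)) (fun s => f (ins k s y'))
     _ t M (marg y) (marg y')) => //; rewrite ?margE//; try exact: measurable_slice.
  + by move=> s s' r; exact: (logconcave1_quasi (slice_logconcave1 k y lcf)).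
  + by move=> s s' r; exact: (logconcave1_quasi (slice_logconcave1 k y' lcf)).
  + by exists B => _ [s _ <-].
  + by exists B => _ [s _ <-].
  + by move=> s; apply: supp.
  + by move=> s; apply: supp.
  by move=> s s'; rewrite ins_conv; case: lcf => _; apply.
- by move=> y; rewrite -lee_fin -margE; exact: integral_slice_le.
- move=> y i h; rewrite /marg integral0_eq// => t _; congr EFin.
  by apply: (fM _ (lift k i)); rewrite tnth_ins_lift.
Qed.
End step.

Definition slab n (k : 'I_n) (I : set (measurableTypeR R)) : set (n.-tuple R) :=
  [set x | I (tnth x k)].

Lemma measurable_slab n (k : 'I_n) (I : set (measurableTypeR R)) :
  measurable I -> measurable (slab k I).
Proof. by move=> mI; rewrite -[X in measurable X]setTI; exact: measurable_tnth. Qed.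

(** Coordinates other than k are integrated out one by one. The clause on zeros of m carries the
    support along, so that the segment of [density_J] can be the projection of K. *)
Lemma marginal_density n (lam : {measure set (n.+1.-tuple R) -> \bar R})
    (k : 'I_n.+1) (f : n.+1.-tuple R -> R) (B M : R) :
  is_lebesgue lam -> 0 <= M -> bounded_logconcave f B M ->
  exists m : measurableTypeR R -> R,
    [/\ measurable_fun setT m, logconcave1 m,
        (forall t, (forall x, tnth x k = t -> f x = 0) -> m t = 0) &
        forall I, measurable I ->
          (\int[lam]_(x in slab k I) (f x)%:E = \int[leb]_(t in I) (m t)%:E)%E].
Proof.
elim: n lam k f B => [|n IH] lam k f B hl M0 hf.
  have [lam' hl'] := is_lebesgue_pred hl.
  have [mf lcf fB fM] := hf.
  have f0 x : 0 <= f x by case: lcf.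
  exists (fun t => f (ins k t [tuple])); split.
  - exact: measurable_slice.
  - exact: slice_logconcave1.
  - by move=> t; apply; rewrite tnth_ins.
  move=> I mI; rewrite integral_mkcond (lebesgue_fubini k hl hl')//; last 2 first.
  - apply/(measurable_restrictT _ _).1; first exact: measurable_slab.
    by apply: measurable_funTS; exact/measurable_EFinP.
  - by apply: erestrict_ge0 => x _; rewrite lee_fin.
  rewrite [RHS]integral_mkcond; apply: eq_integral => t _.
  (* R^0 is one point, a box whose volume is the empty product. *)
  have l1 : (lam' setT = 1)%E.
    rewrite (_ : setT = box [tuple] [tuple]); first by rewrite (hl' [tuple] [tuple]) ?big_ord0// => -[].
    by apply/seteqP; split => // x _ [].
  rewrite (eq_integral (cst (((fun x => (f x)%:E) \_ (slab k I)) (ins k t [tuple])))); last first.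
    by move=> y _; rewrite (tuple0 y).
  rewrite integral_cst// [X in (_ * X)%E]l1 mule1 !patchE.
  by rewrite (_ : (_ \in slab k I) = (t \in I))//; apply/idP/idP; rewrite !inE /slab/= tnth_ins.
have [lam' hl'] := is_lebesgue_pred hl.
(* Some coordinate different from k. *)
pose j := lift k ord0.
have [k' kE] : exists k', k = lift j k'.
  case: (unliftP j k) => [k' ->|E]; first by exists k'.
  by have := neq_lift k ord0; rewrite -/j -E eqxx.
have [m [mm lm m0 mI]] := IH lam' k' _ _ hl' M0 (marg_bounded_logconcave j M0 hf).
have [mf lcf fB fM] := hf.
have f0 x : 0 <= f x by case: lcf.
exists m; split => //.
  move=> t ht; apply: m0 => y hy; rewrite /marg integral0_eq// => s _.
  by rewrite ht// kE tnth_ins_lift.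
move=> I mI'; rewrite -mI// integral_mkcond (lebesgue_fubini_rev j hl hl')//; last 2 first.
- apply/(measurable_restrictT _ _).1; first exact: measurable_slab.
  by apply: measurable_funTS; exact/measurable_EFinP.
- by apply: erestrict_ge0 => x _; rewrite lee_fin.
rewrite [RHS]integral_mkcond; apply: eq_integral => y _.
rewrite patchE -(margE j M0 hf).
case: ifPn => yI.
  apply: eq_integral => t _; rewrite patchE ifT// inE /slab/= kE tnth_ins_lift.
  by move: yI; rewrite inE.
rewrite integral0_eq// => t _; rewrite patchE ifF//; apply/negbTE.
by move: yI; rewrite !notin_setE /slab/= kE tnth_ins_lift.
Qed.

End marginal.

(** * The profile J and the density of a log-concave measure on a segment *)

Lemma divr_itv01 (R : realType) (a b : R) : 0 <= a <= b -> 0 < b -> 0 <= a / b <= 1.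
Proof.
move=> /andP[a0 ab] b0; apply/andP; split; first by rewrite divr_ge0// ltW.
by rewrite ler_pdivrMr// mul1r.
Qed.

Section J.
Context {R : realType}.
Implicit Types g x y z j : R.

Definition psi g : R := if g == 0 then 1 else g / (expR g - 1).

Lemma psi0 : psi 0 = 1. Proof. by rewrite /psi eqxx. Qed.

Lemma psiE g : g != 0 -> psi g = g / (expR g - 1).
Proof. by rewrite /psi => /negbTE ->. Qed.

Lemma expRB1_neq0 g : g != 0 -> expR g - 1 != 0.
Proof. by move=> g0; rewrite subr_eq0 -expR0 (inj_eq (@expR_inj R)). Qed.

Lemma psi_gt0 g : 0 < psi g.
Proof.
have [->|g0] := eqVneq g 0; first by rewrite psi0.
rewrite psiE//; have [gp|gn] := ltP 0 g.
  by rewrite divr_gt0// subr_gt0 expR_gt1.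
have gn' : g < 0 by rewrite lt_neqAle g0.
by rewrite nmulr_rgt0// invr_lt0 subr_lt0 expR_lt1.
Qed.

(** Reflecting the segment exchanges g with - g and x with 1 - x; this identity is what makes J
    symmetric. *)
Lemma psiN g : psi (- g) = psi g + g.
Proof.
have [->|g0] := eqVneq g 0; first by rewrite oppr0 addr0.
rewrite !psiE ?oppr_eq0// expRN.
have h := expRB1_neq0 g0.
have e0 : expR g != 0 by rewrite expR_eq0.
field.
by rewrite h e0 /= mulN1r -oppr_eq0 opprB.
Qed.

Lemma affine_psi_ge0 g x : 0 <= x <= 1 -> 0 <= g * x + psi g.
Proof.
move=> /andP[x0 x1]; have [g0|g0] := leP 0 g.
  by rewrite addr_ge0 ?mulr_ge0// ltW// psi_gt0.
have := psi_gt0 (- g); rewrite psiN => h.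
have : 0 <= (- g) * (1 - x) by rewrite mulr_ge0 ?oppr_ge0 ?subr_ge0// ltW.
lra.
Qed.

Definition J x : R := inf (range (fun g => g * x + psi g)).

Lemma J_le x g : 0 <= x <= 1 -> J x <= g * x + psi g.
Proof.
move=> x01; apply: ge_inf; last by exists g.
by exists 0 => _ [h _ <-]; exact: affine_psi_ge0.
Qed.

Lemma J_ge x j : (forall g, j <= g * x + psi g) -> j <= J x.
Proof.
move=> h; apply: lb_le_inf; first by exists (0 * x + psi 0); exists 0.
by move=> _ [g _ <-].
Qed.

Lemma J_ge0 x : 0 <= x <= 1 -> 0 <= J x.
Proof. by move=> x01; apply: J_ge => g; exact: affine_psi_ge0. Qed.

Lemma J_sym x : 0 <= x <= 1 -> J (1 - x) = J x.
Proof.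
move=> x01; apply/eqP; rewrite eq_le; apply/andP; split; apply: J_ge => g.
  have -> : g * x + psi g = (- g) * (1 - x) + psi (- g) by rewrite psiN; ring.
  by apply: J_le; lra.
have -> : g * (1 - x) + psi g = (- g) * x + psi (- g) by rewrite psiN; ring.
exact: J_le.
Qed.

(** Each affine function has a positive value psi g at 0, so shrinking its argument by u costs at
    most a factor u. Subadditivity and semicontinuity of J both rest on this. *)
Lemma J_scale (u z : R) : 0 <= u <= 1 -> 0 <= z <= 1 -> u * J z <= J (u * z).
Proof.
move=> /andP[u0 u1] z01; apply: J_ge => g.
apply: (@le_trans _ _ (u * (g * z + psi g))); first by rewrite ler_wpM2l// J_le.
have : u * psi g <= psi g by rewrite ler_piMl// ltW// psi_gt0.
lra.
Qed.

Lemma J_subadd x y : 0 <= x -> 0 <= y -> x + y <= 1 -> J (x + y) <= J x + J y.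
Proof.
move=> x0 y0 xy1; have [xy0|xy0] := leP (x + y) 0.
  have -> : x = 0 by lra. have -> : y = 0 by lra.
  by rewrite addr0 lerDl J_ge0// lexx ler01.
have h (a b : R) : 0 <= a -> 0 <= b -> 0 < a + b -> a + b <= 1 ->
    a / (a + b) * J (a + b) <= J a.
  move=> a0 b0 ab0 ab1.
  have ab01 : 0 <= a / (a + b) <= 1 by apply: divr_itv01 => //; lra.
  have := J_scale ab01 (z := a + b); rewrite (ltW ab0) ab1 => /(_ isT).
  by rewrite divfK// gt_eqF.
have h1 := h _ _ x0 y0 xy0 xy1.
have h2 : y / (x + y) * J (x + y) <= J y.
  by rewrite (addrC x); apply: h => //; rewrite addrC.
suff : x / (x + y) * J (x + y) + y / (x + y) * J (x + y) = J (x + y) by lra.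
by rewrite -mulrDl -mulrDl divff ?mul1r// gt_eqF.
Qed.

Lemma J0 : J 0 = 0.
Proof.
apply/eqP; rewrite eq_le J_ge0 ?lexx ?ler01// andbT.
apply/ler_addgt0Pr => e e0; rewrite add0r.
(* At g = 2 / e the bound e^g - 1 >= g^2 / 2 gives psi g <= 2 / g = e. *)
have g0 : 0 < 2 / e by rewrite divr_gt0.
apply: le_trans (@J_le 0 (2 / e) _) _; first by rewrite lexx ler01.
rewrite mulr0 add0r psiE ?gt_eqF//.
have h := @expR_ge1Dxn R (2 / e) 1 (ltW g0).
have g1 : 0 < expR (2 / e) - 1 by rewrite subr_gt0 expR_gt1.
rewrite ler_pdivrMr//.
apply: (@le_trans _ _ (e * ((2 / e) ^+ 2 / 2))); last first.
  by rewrite ler_pM2l//; move: h; rewrite (_ : 2`!%:R = 2 :> R)//; lra.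
have e0' : e != 0 by rewrite gt_eqF.
have E : e * ((2 / e) ^+ 2 / 2) = 2 / e by field.
by rewrite E.
Qed.

Lemma J1 : J 1 = 0.
Proof. by rewrite -[1]subr0 J_sym ?J0// lexx ler01. Qed.

(** An affine function on [x, y] is smallest at the end selected by the sign of g. *)
Lemma J_min x y z : 0 <= x -> y <= 1 -> x <= z <= y -> Num.min (J x) (J y) <= J z.
Proof.
move=> x0 y1 /andP[xz zy].
apply: J_ge => g; have [g0|g0] := leP 0 g.
  rewrite ge_min; apply/orP; left; apply: le_trans (J_le g _) _; first by apply/andP; split; lra.
  by rewrite lerD2r ler_wpM2l.
rewrite ge_min; apply/orP; right; apply: le_trans (J_le g _) _; first by apply/andP; split; lra.
by rewrite lerD2r ler_wnM2l// ltW.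
Qed.

Lemma J_right x y : 0 <= x -> x < 1 -> x <= y <= 1 -> (1 - y) / (1 - x) * J x <= J y.
Proof.
move=> x0 x1 /andP[xy y1].
rewrite -(J_sym (x := y)); last by lra.
rewrite -(J_sym (x := x)); last by lra.
have x1' : 0 < 1 - x by lra.
have {2}-> : 1 - y = (1 - y) / (1 - x) * (1 - x) by rewrite divfK// gt_eqF.
apply: J_scale; last by lra.
by apply: divr_itv01 => //; lra.
Qed.
End J.

Section density.
Context {R : realType}.
Notation leb := (@lebesgue_measure R).

Lemma integral_expR (g t a b : R) : g != 0 -> a <= b ->
  (\int[leb]_(s in `[a, b]) (expR (g * (s - t)))%:E =
   ((expR (g * (b - t)) - expR (g * (a - t))) / g)%:E)%E.
Proof.
move=> g0; rewrite le_eqVlt => /predU1P[->|ab].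
  by rewrite subrr mul0r set_itv1 integral_set1.
pose F (s : R) := expR (g * (s - t)) / g.
have dF (s : R) : is_derive s 1 F (expR (g * (s - t))).
  rewrite /F; apply: is_derive_eq.
  rewrite /GRing.scale/=; field => //.
have cf : continuous (fun s : R => expR (g * (s - t))).
  move=> s; apply: continuous_comp; last exact: continuous_expR.
  apply: continuousM; first exact: cvg_cst.
  by apply: continuousB; [exact: cvg_id|exact: cvg_cst].
have cF : continuous F.
  by move=> s; apply: differentiable_continuous; apply/derivable1_diffP; have [] := dF s.
rewrite (@continuous_FTC2 _ _ F)//.
- by rewrite /F -EFinB mulrBl.
- exact: continuous_subspaceT.
- split; first by move=> s _; have [] := dF s.
  + by apply: cvg_at_right_filter; exact: cF.
  + by apply: cvg_at_left_filter; exact: cF.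
- by move=> s _; rewrite derive1E; have [_ ->] := dF s.
Qed.

Lemma integral_le_on (m h : measurableTypeR R -> R) (A : set (measurableTypeR R)) (a b I : R) :
  measurable A -> measurable_fun setT m -> measurable_fun setT h ->
  (forall s, 0 <= m s) -> (forall s, 0 <= h s) -> (forall s, A s -> ~ `[a, b]%classic s -> m s = 0) ->
  (forall s, A s -> m s <= h s) ->
  (\int[leb]_(s in `[a, b]) (h s)%:E = I%:E)%E ->
  (\int[leb]_(s in A) (m s)%:E <= I%:E)%E.
Proof.
move=> mA mm mh m0 h0 supp mh' <-.
rewrite integral_mkcond [leRHS]integral_mkcond.
apply: ge0_le_integral => //.
- by move=> s _; apply: erestrict_ge0 => x _; rewrite lee_fin.
- apply/(measurable_restrictT _ _).1 => //.
  by apply: measurable_funTS; exact/measurable_EFinP.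
- apply/(measurable_restrictT _ _).1 => //.
  by apply: measurable_funTS; exact/measurable_EFinP.
move=> s _; rewrite !patchE; case: ifPn => [|_]; last first.
  by case: ifPn => // _; rewrite lee_fin.
rewrite inE => As; case: ifPn => sab; first by rewrite lee_fin mh'.
by rewrite supp//; move: sab; rewrite notin_setE.
Qed.

(** By concavity of ln m, chord slopes to the right of t are at most those to its left, and g is the
    supremum of the right ones. The point s1 makes that set nonempty and s0 bounds it. *)
Lemma supergradient (m : measurableTypeR R -> R) (t s0 s1 : R) : logconcave1 m ->
  s0 < t -> t < s1 -> 0 < m s0 -> 0 < m s1 ->
  exists g : R, forall s : R, m s <= m t * expR (g * (s - t)).
Proof.
move=> [m0 mc] s0t ts1 ms0 ms1.
have slope (a b : R) : a < t -> t < b -> 0 < m a -> 0 < m b ->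
    0 < m t /\ (ln (m b) - ln (m t)) / (b - t) <= (ln (m t) - ln (m a)) / (t - a).
  move=> at' tb ma mb.
  pose u := (b - t) / (b - a).
  have ba : 0 < b - a by lra.
  have ta : 0 < t - a by lra.
  have bt : 0 < b - t by lra.
  have u01 : 0 <= u <= 1 by apply: divr_itv01 => //; lra.
  have ut : u * a + (1 - u) * b = t.
    have : u * (b - a) = b - t by rewrite divfK// gt_eqF.
    lra.
  have h := mc a b u u01; rewrite ut in h.
  have mt : 0 < m t by apply: lt_le_trans h; rewrite mulr_gt0// powR_gt0.
  split => //.
  have := h; rewrite -(@ler_ln R) ?posrE ?mulr_gt0 ?powR_gt0//.
  rewrite lnM ?posrE ?powR_gt0// !ln_powR => h'.
  have u1 : 1 - u = (t - a) / (b - a) by rewrite /u; field; rewrite gt_eqF.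
  rewrite u1 /u -!mulrA ![(b - a)^-1 * _]mulrC !mulrA -mulrDl ler_pdivrMr// in h'.
  rewrite ler_pdivrMr// mulrAC ler_pdivlMr//.
  move: h'; lra.
have [mt _] := slope _ _ s0t ts1 ms0 ms1.
pose E := [set q : R | exists s, [/\ t < s, 0 < m s & q = (ln (m s) - ln (m t)) / (s - t)]].
have E0 : E !=set0 by exists ((ln (m s1) - ln (m t)) / (s1 - t)); exists s1.
have uE a : a < t -> 0 < m a -> ubound E ((ln (m t) - ln (m a)) / (t - a)).
  by move=> at' ma _ [s [ts ms ->]]; have [] := slope a s at' ts ma ms.
exists (sup E) => s.
have [ms|ms] := eqVneq (m s) 0; first by rewrite ms mulr_ge0 ?expR_ge0.
have ms' : 0 < m s by rewrite lt_neqAle eq_sym ms m0.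
suff : ln (m s) <= ln (m t) + sup E * (s - t).
  move=> h; rewrite -(lnK (x := m s)) ?posrE// -{1}(lnK (x := m t)) ?posrE// -expRD ler_expR//.
have [st|ts|<-] := ltgtP s t; last by rewrite subrr mulr0 addr0.
  have : sup E <= (ln (m t) - ln (m s)) / (t - s) by apply: ge_sup => //; exact: uE.
  by rewrite ler_pdivlMr ?subr_gt0//; lra.
have : (ln (m s) - ln (m t)) / (s - t) <= sup E.
  apply: ub_le_sup; first by eexists; exact: (uE s0).
  by exists s.
by rewrite ler_pdivrMr ?subr_gt0//; lra.
Qed.

(** If X or Y is 0, so is the value of J. Otherwise m is positive somewhere on each side of t,
    [supergradient] applies, and J is estimated by its affine function of slope g (b - a). *)
Lemma density_J (m : measurableTypeR R -> R) (a b t X Y : R) :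
  logconcave1 m -> measurable_fun setT m -> a < b ->
  (forall s, ~~ (a <= s <= b) -> m s = 0) ->
  (\int[leb]_(s in `]-oo, t[) (m s)%:E = X%:E)%E ->
  (\int[leb]_(s in `[t, +oo[) (m s)%:E = Y%:E)%E ->
  0 < X + Y ->
  (X + Y) * J (X / (X + Y)) <= (b - a) * m t.
Proof.
move=> lm mm ab supp hX hY XY.
have [m0 mc] := lm.
have ba : 0 < b - a by lra.
have X0 : 0 <= X by rewrite -lee_fin -hX; apply: integral_ge0 => s _; rewrite lee_fin.
have Y0 : 0 <= Y by rewrite -lee_fin -hY; apply: integral_ge0 => s _; rewrite lee_fin.
have [X00|Xn0] := eqVneq X 0; first by rewrite X00 mul0r J0 mulr0 mulr_ge0// ltW.
have [Y00|Yn0] := eqVneq Y 0.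
  by rewrite Y00 addr0 divff// J1 mulr0 mulr_ge0// ltW.
have ex (A : set (measurableTypeR R)) I : (\int[leb]_(s in A) (m s)%:E = I%:E)%E -> I != 0 ->
    exists2 s, A s & 0 < m s.
  move=> hI I0; apply: contrapT => h; move/eqP : I0; apply; apply: EFin_inj.
  rewrite -hI integral0_eq// => s As; congr EFin; apply/eqP; rewrite eq_le m0 andbT leNgt.
  by apply/negP => ms; apply: h; exists s.
have [s0 /= s0t ms0] := ex _ _ hX Xn0.
rewrite in_itv/= in s0t.
have mt0 : leb [set t] = 0%E by exact: lebesgue_measure_set1.
have hY' : (\int[leb]_(s in `]t, +oo[) (m s)%:E = Y%:E)%E.
  rewrite -hY; apply/esym; rewrite -(integral_itv_obnd_cbnd (r := t))//.
  by apply: measurable_funTS; exact/measurable_EFinP.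
have [s1 /= s1t ms1] := ex _ _ hY' Yn0.
rewrite in_itv/= andbT in s1t.
have [g hg] := supergradient lm s0t s1t ms0 ms1.
have s0ab : a <= s0 <= b by apply: contraLR ms0 => /supp ->; rewrite ltxx.
have s1ab : a <= s1 <= b by apply: contraLR ms1 => /supp ->; rewrite ltxx.
have at' : a <= t by lra. have tb : t <= b by lra.
pose h (s : measurableTypeR R) := m t * expR (g * (s - t)).
have mh : measurable_fun setT h.
  apply: measurable_funM => //; apply: measurableT_comp; first exact: measurable_expR.
  by apply: measurable_funM => //; apply: measurable_funB => //; exact: measurable_idTR.
have h0 s : 0 <= h s by rewrite mulr_ge0 ?expR_ge0.
have nin (s u v : R) : ~ `[u, v]%classic s -> ~~ (u <= s <= v).
  by rewrite /= in_itv/= => /negP.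
have leX I : (\int[leb]_(s in `[a, t]) (h s)%:E = I%:E)%E -> X <= I.
  move=> hI; rewrite -lee_fin -hX; apply: integral_le_on hI => //.
  by move=> s; rewrite /= in_itv/= => st /nin st'; apply: supp; apply: contra st' => /andP[-> _]; rewrite ltW.
have leY I : (\int[leb]_(s in `[t, b]) (h s)%:E = I%:E)%E -> Y <= I.
  move=> hI; rewrite -lee_fin -hY; apply: integral_le_on hI => //.
  by move=> s; rewrite /= in_itv/= andbT => st /nin st'; apply: supp; apply: contra st' => /andP[_ ->]; rewrite st.
have inth (u v : R) : u <= v -> (\int[leb]_(s in `[u, v]) (h s)%:E =
     (m t * if g == 0 then v - u else (expR (g * (v - t)) - expR (g * (u - t))) / g)%:E)%E.
  move=> uv.
  rewrite (_ : (\int[leb]_(s in `[u, v]) (h s)%:E = (m t)%:E * \int[leb]_(s in `[u, v]) (expR (g * (s - t)))%:E)%E); last first.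
    rewrite -ge0_integralZl//.
      apply/measurable_EFinP; apply: measurable_funTS; apply: measurableT_comp; first exact: measurable_expR.
      by apply: measurable_funM => //; apply: measurable_funB => //; exact: measurable_idTR.
    by rewrite lee_fin.
  case: eqP => [->|/eqP g0]; last by rewrite integral_expR.
  rewrite EFinM; congr (_ * _)%E.
  under eq_integral do rewrite mul0r expR0.
  rewrite integral_cst//= mul1e lebesgue_measure_itv/= lte_fin.
  by case: ltgtP uv => // -> _; rewrite subrr.
have {leX} leX := leX _ (inth _ _ at').
have {leY} leY := leY _ (inth _ _ tb).
have XY0 : X + Y != 0 by rewrite gt_eqF.
have X1 : 0 <= X / (X + Y) <= 1.
  by apply: divr_itv01 => //; lra.
apply: (@le_trans _ _ ((X + Y) * (g * (b - a) * (X / (X + Y)) + psi (g * (b - a))))).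
  by rewrite ler_pM2l// J_le.
move: leX leY; case: eqP => [->|/eqP g0] leX leY.
  by rewrite !mul0r psi0 add0r mulr1; move: leX leY; lra.
have gL0 : g * (b - a) != 0 by rewrite mulf_neq0// gt_eqF.
rewrite psiE//; move: ba gL0.
set L := b - a; set e := expR (g * L) => ba gL0.
have e1 : e - 1 != 0 by exact: expRB1_neq0.
(* The weights e and 1 of X and Y are the ones for which the two exponential bounds add up to m t (e
   - 1) / g, without further dependence on t. *)
have -> : (X + Y) * (g * L * (X / (X + Y)) + g * L / (e - 1)) = g / (e - 1) * L * (e * X + Y).
  by field; rewrite e1.
have ge : 0 < g / (e - 1).
  have := psi_gt0 (g * L); rewrite psiE// -/e mulrAC.
  by rewrite pmulr_lgt0.
have -> : L * m t = g / (e - 1) * L * (m t * ((e - 1) / g)).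
  by field; rewrite e1 g0.
rewrite ler_pM2l; last exact: mulr_gt0.
have e0 : 0 < e by exact: expR_gt0.
apply: le_trans (lerD (ler_wpM2l (ltW e0) leX) leY) _.
rewrite subrr !mulr0 expR0.
have -> : e * (m t * ((1 - expR (g * (a - t))) / g)) + m t * ((expR (g * (b - t)) - 1) / g)
   = m t * ((e - e * expR (g * (a - t)) + expR (g * (b - t)) - 1) / g) by field.
rewrite /e -expRD /L -mulrDr.
have -> : b - a + (a - t) = b - t by ring.
by rewrite subrK.
Qed.

End density.

(** * Gaps between two sets on the line *)

Section windows.
Context {R : realType}.
(* The segment is cut into W windows [tau i, tau i.+1[ and Phi i is the proportion of mass
   before tau i. A window meeting the first (second) set has colour Some true
   (Some false), and every other window has colour None. *)
Variables (L h : R) (W : nat) (Phi tau : nat -> R) (col : nat -> option bool).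
Hypotheses (L0 : 0 <= L) (h0 : 0 < h).
Hypothesis Phi_nd : forall i j, (i <= j)%N -> Phi i <= Phi j.
Hypotheses (Phi0 : Phi 0%N = 0) (PhiW : Phi W = 1).
Hypothesis gap : forall i j, (i < j)%N -> (j <= W)%N ->
  exists2 k, k = i \/ k = j & (tau j - tau i) * J (Phi k) <= L * (Phi j - Phi i).
Hypothesis sep : forall i j c, (i < j)%N -> (j < W)%N -> col i = Some c -> col j = Some (~~ c) ->
  h <= tau j - tau i.+1.

Definition wsum (o : option bool) (n : nat) : R :=
  \sum_(i < n | col i == o) (Phi i.+1 - Phi i).

Lemma wsumS o n : wsum o n.+1 = wsum o n + (if col n == o then Phi n.+1 - Phi n else 0).
Proof. by rewrite /wsum big_mkcond big_ord_recr -big_mkcond. Qed.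

Let Phi01 i : (i <= W)%N -> 0 <= Phi i <= 1.
Proof. by move=> iW; rewrite -Phi0 -PhiW !Phi_nd. Qed.

(** Either nothing is coloured yet, or the mass before the end of a coloured window i is split into
    P for its colour c and Q for the other colour. Uncoloured mass has already paid for h J Q; the
    term L (Phi n - Phi i.+1) keeps the mass after window i in reserve for the next change of
    colour. *)
Let inv n := (wsum (Some true) n = 0 /\ wsum (Some false) n = 0 /\ wsum None n = Phi n) \/
  exists i c P Q, [/\ (i < n)%N, col i = Some c, 0 <= P, 0 <= Q & P + Q = Phi i.+1] /\
    [/\ wsum (Some c) n <= P, wsum (Some (~~ c)) n <= Q &
        h * J Q + L * (Phi n - Phi i.+1) <= L * wsum None n].

Let invP n : (n <= W)%N -> inv n.
Proof.
elim: n => [_|n IH nW].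
  by left; rewrite /wsum !big_ord0 Phi0.
have dPhi : 0 <= Phi n.+1 - Phi n by rewrite subr_ge0 Phi_nd.
have PhiS := Phi01 nW; have PhiN := Phi01 (ltnW nW).
case: (IH (ltnW nW)) => [[w1 [w2 w3]]|[i [c [P [Q [[iN ci P0 Q0 PQ] [wP wQ hN]]]]]]].
  case En : (col n) => [c|].
    right; exists n, c, (Phi n.+1), 0; split; first by split; rewrite ?addr0//; lra.
    rewrite !wsumS En J0 mulr0 subrr mulr0 addr0 w3 addr0.
    have h1 : 0 <= L * Phi n by rewrite mulr_ge0//; lra.
    by case: c {En}; rewrite /= w1 w2; split => //; lra.
  by left; rewrite !wsumS En/= w1 w2 w3; split; [|split]; lra.
right; case En : (col n) => [c'|]; last first.
  exists i, c, P, Q; rewrite !wsumS En/= !addr0; split; first by split => //; exact: ltnW.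
  by split => //; move: hN; lra.
have [E|E] := eqVneq c' c.
  (* The colour does not change: the uncoloured stretch is handed to P and its reserve is given
     up. *)
  exists n, c, (P + (Phi n.+1 - Phi i.+1)), Q; rewrite !wsumS En E.
  have iPhi : Phi i.+1 <= Phi n by exact: Phi_nd.
  have h1 : 0 <= L * (Phi n - Phi i.+1) by rewrite mulr_ge0 ?subr_ge0.
  rewrite eqxx (_ : Some c == Some (~~ c) = false); last by case: c {ci wP wQ E En}.
  by rewrite subrr mulr0 !addr0; split; split => //; lra.
have {E} E : c' = ~~ c by case: c c' E {ci wP wQ En} => -[].
(* Adjacent windows cannot have opposite colours, for [sep] would give h <= 0. *)
have iSn : (i.+1 < n)%N.
  rewrite ltn_neqAle iN andbT; apply/eqP => E'.
  have := sep iN nW ci; rewrite En E => /(_ erefl); rewrite -E' subrr leNgt h0//.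
have [k kin hk] := gap iSn (ltnW nW).
have hle := sep iN nW ci; rewrite En E in hle; have {}hle := hle erefl.
have kb : Phi i.+1 <= Phi k <= Phi n by case: kin => ->; rewrite lexx ?Phi_nd ?(ltnW iSn).
have kW : 0 <= Phi k <= 1 by lra.
(* The stretch between the two colours is cut at k. The new Q is Phi k - Q; by symmetry and
   subadditivity its J is at most J (Phi k) + J Q, and the reserve pays for h J (Phi k). *)
exists n, (~~ c), (Q + (Phi n.+1 - Phi k)), (P + (Phi k - Phi i.+1)).
rewrite !wsumS En E negbK eqxx.
rewrite (_ : Some (~~ c) == Some c = false); last by case: c {ci wP wQ E En}.
rewrite subrr mulr0 !addr0; split; first by split => //; lra.
split; [lra|lra|].
have -> : P + (Phi k - Phi i.+1) = Phi k - Q by lra.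
rewrite -J_sym; last by lra.
have -> : 1 - (Phi k - Q) = (1 - Phi k) + Q by ring.
have Jle : J ((1 - Phi k) + Q) <= J (Phi k) + J Q.
  by rewrite -(J_sym kW); apply: J_subadd; lra.
have J1' : h * J ((1 - Phi k) + Q) <= h * (J (Phi k) + J Q) by rewrite ler_pM2l.
have J2 : h * J (Phi k) <= (tau n - tau i.+1) * J (Phi k) by rewrite ler_wpM2r// J_ge0.
by rewrite mulrDr in J1'; lra.
Qed.

Lemma windows_J : exists x,
  wsum (Some true) W <= x <= 1 - wsum (Some false) W /\ h * J x <= L * wsum None W.
Proof.
case: (invP (leqnn W)) => [[w1 [w2 w3]]|[i [c [P [Q [[iW ci P0 Q0 PQ] [wP wQ hN]]]]]]].
  by exists 0; rewrite w1 w2 w3 subr0 J0 mulr0 PhiW mulr1 lexx ler01.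
have h1 : 0 <= L * (Phi W - Phi i.+1) by rewrite mulr_ge0// subr_ge0 Phi_nd.
have := Phi01 iW => Pi.
have wN : 0 <= Phi W - Phi i.+1 by rewrite subr_ge0 Phi_nd.
(* Q bounds the share of the colour opposite to the last one, so the first set corresponds to Q or
   to 1 - Q, where J agrees. *)
exists (if c then 1 - Q else Q).
have JQ : J (if c then 1 - Q else Q) = J Q by case: c {ci wP wQ}; rewrite ?J_sym//; lra.
rewrite JQ; split; last by lra.
by move: wP wQ; case: c {ci JQ} => /= wP wQ; apply/andP; split; lra.
Qed.

Lemma wsum_total n : wsum (Some true) n + wsum (Some false) n + wsum None n = Phi n.
Proof.
elim: n => [|n IH]; first by rewrite /wsum !big_ord0 Phi0 !addr0.
by rewrite !wsumS; case: (col n) => [[]|] /=; lra.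
Qed.

End windows.

Section gap.
Context {R : realType}.
Notation leb := (@lebesgue_measure R).

(** [density_J] is integrated over [p, q[ after [J_min] has replaced J at the running proportion by
    the smaller of its end values; t is the end where that value occurs. *)
Lemma gap_J (m : measurableTypeR R -> R) (a b M : R) (C : R -> R) (p q : R) :
  logconcave1 m -> measurable_fun setT m -> a < b ->
  (forall s, ~~ (a <= s <= b) -> m s = 0) ->
  (\int[leb]_s (m s)%:E = M%:E)%E -> 0 < M ->
  (forall t, \int[leb]_(s in `]-oo, t[) (m s)%:E = (C t)%:E)%E ->
  p < q ->
  exists2 t, t = p \/ t = q & (q - p) * J (C t / M) <= (b - a) * (C q / M - C p / M).
Proof.
move=> lm mm ab supp hM M0 hC pq.
have [m0 _] := lm.
have splt (x u v : itv_bound R) : (u <= x)%O -> (x <= v)%O ->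
    (\int[leb]_(s in [set` Interval u v]) (m s)%:E =
    \int[leb]_(s in [set` Interval u x]) (m s)%:E +
    \int[leb]_(s in [set` Interval x v]) (m s)%:E)%E.
  move=> ux xv; rewrite (itv_bndbnd_setU ux xv).
  apply: ge0_integral_setU => //.
  - by apply: measurable_funTS; exact/measurable_EFinP.
  - by move=> s _; rewrite lee_fin.
  - apply/disj_setPS => s [] /=; rewrite !itv_boundlr => /andP[_ h1] /andP[h2 _].
    by have := le_trans h1 h2; rewrite bnd_simp ltxx.
have hY t : (\int[leb]_(s in `[t, +oo[) (m s)%:E = (M - C t)%:E)%E.
  have := splt (BLeft t) -oo%O +oo%O isT isT.
  have -> : [set` `]-oo, +oo[ ] = [set: measurableTypeR R] by rewrite set_itvE.
  rewrite hM hC => /(congr1 (fun x => x - (C t)%:E)%E).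
  by rewrite addeAC subee// add0e -EFinB => <-.
have hCC u v : u <= v -> (\int[leb]_(s in `[u, v[) (m s)%:E = (C v - C u)%:E)%E.
  move=> uv; have := splt (BLeft u) -oo%O (BLeft v) isT uv.
  rewrite !hC => /(congr1 (fun x => x - (C u)%:E)%E).
  by rewrite addeAC subee// add0e -EFinB => <-.
have Cp t : 0 <= C t.
  by rewrite -lee_fin -hC; apply: integral_ge0 => s _; rewrite lee_fin.
have CM t : C t <= M.
  by rewrite -subr_ge0 -lee_fin -hY; apply: integral_ge0 => s _; rewrite lee_fin.
have Cnd u v : u <= v -> C u <= C v.
  move=> uv; rewrite -subr_ge0 -lee_fin -hCC//; apply: integral_ge0 => s _; by rewrite lee_fin.
pose j := Num.min (J (C p / M)) (J (C q / M)).
have ba : 0 < b - a by lra.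
have key : (q - p) * j <= (b - a) * (C q / M - C p / M).
  rewrite -mulrBl mulrA ler_pdivlMr//.
  have : ((((q - p) * j * M) / (b - a))%:E <= (C q - C p)%:E)%E.
    rewrite -(hCC _ _ (ltW pq)).
    apply: (@le_trans _ _ (\int[leb]_(s in `[p, q[) cst ((M * j) / (b - a))%:E s)%E).
      rewrite integral_cst//= lebesgue_measure_itv/= lte_fin pq.
      rewrite -EFinB -EFinM lee_fin le_eqVlt; apply/orP; left; apply/eqP; ring.
    apply: ge0_le_integral => //.
    - move=> s _; rewrite lee_fin divr_ge0 ?mulr_ge0 ?(ltW M0) ?(ltW ba)//.
      rewrite le_min !J_ge0//; apply: divr_itv01 => //; rewrite Cp CM //.
    - by apply: measurable_funTS; exact/measurable_EFinP.
    - move=> s; rewrite /= in_itv/= => /andP[ps sq]; rewrite lee_fin ler_pdivrMr// [m s * _]mulrC.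
      apply: le_trans (density_J lm mm ab supp (hC s) (hY s) _); last by rewrite subrKC.
      rewrite subrKC ler_pM2l//; apply: J_min.
      + by rewrite divr_ge0// ltW.
      + by rewrite ler_pdivrMr// mul1r.
      + by rewrite !ler_pM2r ?invr_gt0// !Cnd// ltW.
  by rewrite lee_fin ler_pdivrMr// [_ * (b - a)]mulrC.
have [jp|jq] := leP (J (C p / M)) (J (C q / M)).
  by exists p; [left|move: key; rewrite /j min_l].
by exists q; [right|move: key; rewrite /j min_r// ltW].
Qed.
End gap.

(** * Bisection *)

Section mass.
Context {R : realType} (n : nat) (lam : {measure set (n.-tuple R) -> \bar R}).
Variable F : n.-tuple R -> R.
Hypotheses (mF : measurable_fun setT F) (F0 : forall x, 0 <= F x).
Hypothesis iF : (dmeasure lam F setT < +oo)%E.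
Implicit Types A B : set (n.-tuple R).

Definition mass A : R := fine (dmeasure lam F A).

Let mEF A : measurable_fun A (EFin \o F).
Proof. by apply: measurable_funTS; exact/measurable_EFinP. Qed.

Lemma dmeasure_ge0 A : (0 <= dmeasure lam F A)%E.
Proof. by apply: integral_ge0 => x _; rewrite lee_fin. Qed.

Lemma dmeasure_le A B : measurable A -> measurable B -> A `<=` B ->
  (dmeasure lam F A <= dmeasure lam F B)%E.
Proof.
move=> mA mB AB; apply: ge0_subset_integral => //.
by move=> x _; rewrite lee_fin.
Qed.

Lemma massE A : measurable A -> dmeasure lam F A = (mass A)%:E.
Proof.
move=> mA; rewrite /mass fineK// ge0_fin_numE ?dmeasure_ge0//.
exact: le_lt_trans (dmeasure_le mA measurableT _) iF.
Qed.

Lemma mass_ge0 A : 0 <= mass A.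
Proof. by rewrite fine_ge0// dmeasure_ge0. Qed.

Lemma mass_le A B : measurable A -> measurable B -> A `<=` B -> mass A <= mass B.
Proof. by move=> mA mB AB; rewrite -lee_fin -!massE// dmeasure_le. Qed.

Lemma massU A B : measurable A -> measurable B -> A `&` B = set0 ->
  mass (A `|` B) = mass A + mass B.
Proof.
move=> mA mB AB; apply: EFin_inj; rewrite EFinD -!massE//; last exact: measurableU.
apply: ge0_integral_setU => //; first by move=> x _; rewrite lee_fin.
by rewrite disj_set2E AB.
Qed.

Lemma massD A B : measurable A -> measurable B -> mass A = mass (A `&` B) + mass (A `\` B).
Proof.
move=> mA mB; rewrite -massU; [by rewrite setUIDK| exact: measurableI|exact: measurableD|].
by rewrite setDE setIACA setICr setI0.
Qed.

Lemma mass_null A : measurable A -> lam A = 0%E -> mass A = 0.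
Proof. by move=> mA A0; rewrite /mass /dmeasure null_set_integral//; exact: mEF. Qed.

Lemma mass_cvg (A : set (n.-tuple R)) (H : nat -> set (n.-tuple R)) (H' N : set (n.-tuple R)) :
  measurable A -> (forall k, measurable (H k)) -> measurable H' -> measurable N -> lam N = 0%E ->
  (forall x, ~ N x -> \forall k \near \oo, H k x <-> H' x) ->
  mass (A `&` H k) @[k --> \oo] --> mass (A `&` H').
Proof.
move=> mA mH mH' mN N0 hH.
have ind B x : ((fun x => (F x)%:E) \_ B) x = (F x * \1_B x)%:E.
  by rewrite patchE indicE; case: (x \in B); rewrite ?mulr1 ?mulr0.
have intE B : measurable B -> (\int[lam]_(x in A) (F x * \1_B x)%:E)%E = dmeasure lam F (A `&` B).
  move=> mB; rewrite /dmeasure [RHS]integral_mkcondr.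
  by apply: eq_integral => x _; rewrite ind.
have mFB B : measurable B -> measurable_fun A (fun x => (F x * \1_B x)%:E).
  move=> mB; apply: measurable_funTS; apply/measurable_EFinP.
  by apply: measurable_funM => //; exact: measurable_indic.
apply: fine_cvg; rewrite -massE; last exact: measurableI.
have [] := @dominated_convergence _ _ _ lam A mA (fun k x => (F x * \1_(H k) x)%:E)
   (fun x => (F x * \1_H' x)%:E) (fun x => (F x)%:E).
- by move=> k; exact: mFB.
- exact: mFB.
- exists N; split => // x /= hx; apply: contrapT => Nx; apply: hx => _.
  apply: cvg_near_cst; near=> k; congr (_%:E); rewrite !indicE; congr (_ * (nat_of_bool _)%:R).
  have : H k x <-> H' x by near: k; exact: hH.
  by move=> hk; apply/idP/idP; rewrite !inE => /hk.
- apply/integrableP; split; first exact: mEF.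
  under eq_integral do rewrite gee0_abs ?lee_fin//.
  exact: le_lt_trans (dmeasure_le mA measurableT (@subsetT _ A)) iF.
- apply/aeW => x k _; rewrite gee0_abs ?lee_fin ?mulr_ge0// ler_piMr//.
move=> _ _; rewrite intE//.
by under eq_fun do rewrite intE//.
Unshelve. all: end_near. Qed.

End mass.

(** * Pencils of half-spaces *)

Section halfspaces.
Context {R : realType}.

(** A line in the direction of a coordinate with nonzero coefficient meets the hyperplane in the
    single point [t0]. *)
Lemma hyperplane_null n (lam : {measure set (n.-tuple R) -> \bar R}) (i j : 'I_n) (v w c : R) :
  is_lebesgue lam -> i != j -> (v != 0) || (w != 0) ->
  measurable [set x : n.-tuple R | v * tnth x i + w * tnth x j = c] /\
  lam [set x : n.-tuple R | v * tnth x i + w * tnth x j = c] = 0%E.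
Proof.
wlog v0 : i j v w / v != 0.
  move=> H hl ij /orP[v0|w0]; first by apply: H; rewrite ?v0.
  have := H j i w v w0 hl; rewrite eq_sym ij w0 => /(_ isT isT).
  by under eq_set do rewrite addrC.
move=> hl ij _; case: n i j lam hl ij => [[]//|n i j lam hl ij].
set H := [set x | _].
have mH : measurable H.
  rewrite (_ : H = (fun x => v * tnth x i + w * tnth x j) @^-1` [set c]); last by [].
  rewrite -[X in measurable X]setTI.
  have mf : measurable_fun setT (fun x : n.+1.-tuple R => v * tnth x i + w * tnth x j).
    by apply: measurable_funD; apply: measurable_funM => //; exact: measurable_tnth.
  exact: mf.
split => //.
have [lam' hl'] := is_lebesgue_pred hl.
have -> : lam H = (\int[lam]_x (\1_H x)%:E)%E by rewrite integral_indic// setIT.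
rewrite (lebesgue_fubini_rev i hl hl')//; last first.
  by apply/measurable_EFinP; exact: measurable_indic.
case: (unliftP i j) => [j' jE|jE]; last by rewrite jE eqxx in ij.
rewrite integral0_eq// => y _.
pose t0 := (c - w * tnth y j') / v.
have m1 : measurable [set t0 : measurableTypeR R] by exact: measurable_set1.
rewrite (eq_integral (fun t : measurableTypeR R => (\1_[set t0] t)%:E)).
  rewrite integral_indic//= setIT; exact: lebesgue_measure_set1.
move=> t _; rewrite !indicE; congr ((nat_of_bool _)%:R%:E).
apply/idP/idP; rewrite !inE /H /= jE tnth_ins tnth_ins_lift => E.
  by rewrite /t0 -E addrK mulrAC divff// mul1r.
by rewrite E /t0 mulrC divfK// subrK.
Qed.

(** A half-turn around the plane x_i = p, x_j = q without trigonometry: the coefficients (t, 1 -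
    t^2) never vanish together and run from (-1, 0) to (1, 0) as t goes from -1 to 1. *)
Definition pencil n (i j : 'I_n) (p q t : R) (x : n.-tuple R) : R :=
  t * (tnth x i - p) + (1 - t ^+ 2) * (tnth x j - q).

Lemma measurable_pencil n (i j : 'I_n) (p q t : R) : measurable_fun setT (pencil i j p q t).
Proof.
by apply: measurable_funD; apply: measurable_funM => //; apply: measurable_funB => //;
  exact: measurable_tnth.
Qed.

Lemma pencil_null n (lam : {measure set (n.-tuple R) -> \bar R}) (i j : 'I_n) (p q t : R) :
  is_lebesgue lam -> i != j ->
  measurable [set x : n.-tuple R | pencil i j p q t x = 0] /\
  lam [set x : n.-tuple R | pencil i j p q t x = 0] = 0%E.
Proof.
move=> hl ij.
have nz : (t != 0) || (1 - t ^+ 2 != 0).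
  by have [->|//] := eqVneq t 0; rewrite expr0n/= subr0 oner_eq0.
have := @hyperplane_null n lam i j t (1 - t ^+ 2) (t * p + (1 - t ^+ 2) * q) hl ij nz.
rewrite (_ : [set x | _] = [set x | pencil i j p q t x = 0])//.
apply/seteqP; split => x /=; rewrite /pencil; lra.
Qed.

Lemma pencil_split n (lam : {measure set (n.-tuple R) -> \bar R}) (F : n.-tuple R -> R)
  (i j : 'I_n) (p q t : R) (C : set (n.-tuple R)) :
  is_lebesgue lam -> i != j ->
  measurable_fun setT F -> (forall x, 0 <= F x) -> (dmeasure lam F setT < +oo)%E ->
  measurable C ->
  mass lam F (C `&` [set z | 0 <= pencil i j p q t z]) +
  mass lam F (C `&` [set z | pencil i j p q t z <= 0]) = mass lam F C.
Proof.
move=> hl ij mF F0 iF mC.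
set H := [set z | 0 <= _].
have mH : measurable H by apply: measurable_set_le => //; exact: measurable_pencil.
rewrite (massD mF F0 iF mC mH); congr (_ + _).
have [mN N0] := pencil_null p q t hl ij.
have mCN := measurableI _ _ mC mN; have mCD := measurableD mC mH.
have m0 : mass lam F (C `&` [set z | pencil i j p q t z = 0]) = 0.
  apply/eqP; rewrite eq_le mass_ge0// andbT -[leRHS](mass_null mF mN N0).
  by apply: mass_le => //; exact: subIsetr.
rewrite (_ : C `&` [set z | pencil i j p q t z <= 0] =
   (C `\` H) `|` (C `&` [set z | pencil i j p q t z = 0])).
  rewrite massU//; first by rewrite m0 addr0.
  apply/seteqP; split => // z [[Cz h] [_ h']]; apply: h; rewrite /H /= h'//.
apply/seteqP; split => z; rewrite /H /=.
  move=> [Cz h]; have [h'|h'] := leP 0 (pencil i j p q t z).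
    by right; split => //; lra.
  by left; split => //; apply/negP; rewrite -ltNge.
move=> [[Cz /negP]|[Cz ->]]; last by split.
by rewrite -ltNge => h; split => //; rewrite ltW.
Qed.

(** The defect [g t] is continuous because every boundary in the pencil is null. The half-spaces at
    t = 1 and t = -1 are complementary up to a null set and the total defect is 0, so g 1 = - g (-1)
    and the intermediate value theorem applies. *)
Lemma bisect n (lam : {measure set (n.-tuple R) -> \bar R}) (F : n.-tuple R -> R)
  (i j : 'I_n) (p q : R) (A B : set (n.-tuple R)) (x : R) :
  is_lebesgue lam -> i != j ->
  measurable_fun setT F -> (forall x, 0 <= F x) -> (dmeasure lam F setT < +oo)%E ->
  measurable A -> measurable B ->
  mass lam F A = x * mass lam F B ->
  exists t, mass lam F (A `&` [set z | 0 <= pencil i j p q t z]) =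
       x * mass lam F (B `&` [set z | 0 <= pencil i j p q t z]).
Proof.
move=> hl ij mF F0 iF mA mB AB.
pose H t := [set z : n.-tuple R | 0 <= pencil i j p q t z].
have mH t : measurable (H t) by apply: measurable_set_le => //; exact: measurable_pencil.
have cont C : measurable C -> continuous (fun t => mass lam F (C `&` H t)).
  move=> mC t; apply/continuous_withinNx/cvgr_dnbhsP => u [_ ut].
  have [mN N0] := pencil_null p q t hl ij.
  apply: (mass_cvg mF F0 iF mC _ _ mN N0) => // z /eqP Nz.
  have cz : pencil i j p q (u k) z @[k --> \oo] --> pencil i j p q t z.
    apply: cvgD; apply: cvgM => //; try exact: cvg_cst.
    by apply: cvgB; [exact: cvg_cst|exact: cvgM].
  rewrite /H /=; have [h|h] := ltP 0 (pencil i j p q t z).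
    by near=> k; split => // _; [rewrite ltW|apply: ltW; near: k; exact: cvgr_gt cz _ h].
  have {}h : pencil i j p q t z < 0 by rewrite lt_neqAle Nz.
  near=> k; split; last by rewrite leNgt h.
  by rewrite leNgt => /negP; case; near: k; exact: cvgr_lt cz _ h.
have half C : measurable C -> mass lam F (C `&` H 1) + mass lam F (C `&` H (-1)) = mass lam F C.
  move=> mC; rewrite -(pencil_split p q 1 hl ij mF F0 iF mC); congr (_ + mass _ _ (_ `&` _)).
  by apply/seteqP; split => z; rewrite /H /= /pencil; lra.
pose g t := mass lam F (A `&` H t) - x * mass lam F (B `&` H t).
have cg : continuous g.
  move=> t; apply: cvgB; first exact: cont.
  by apply: cvgM; [exact: cvg_cst|exact: cont].
have gE : g 1 = - g (-1).
  have := half A mA; have := half B mB; rewrite /g => h1 h2.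
  have : x * (mass lam F (B `&` H 1) + mass lam F (B `&` H (-1))) = x * mass lam F B by rewrite h1.
  lra.
have [|||t _ ht] := @IVT R g (-1) 1 0.
- by lra.
- exact: continuous_subspaceT.
- rewrite gE; have [h|/ltW h] := leP 0 (g (-1)).
    by rewrite ge_min le_max h oppr_le0 h !orbT.
  by rewrite ge_min le_max oppr_ge0 h orbT.
by exists t; move/eqP: ht; rewrite /g subr_eq0 => /eqP.
Unshelve. all: end_near. Qed.

End halfspaces.

Section cuts.
Context {R : realType} (n : nat) (lam : {measure set (n.-tuple R) -> \bar R}).
Variable F : n.-tuple R -> R.
Hypotheses (hl : is_lebesgue lam) (mF : measurable_fun setT F) (F0 : forall x, 0 <= F x).
Hypothesis iF : (dmeasure lam F setT < +oo)%E.
Variables (S B : set (n.-tuple R)) (x c : R).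
Hypotheses (mS : measurable S) (mB : measurable B).

(* A piece violating the inequality to be proved, with B standing for S_h \ S;
   bisection keeps one half that still violates it. *)
Definition bad_piece (K : set (n.-tuple R)) :=
  [/\ measurable K, is_convex_set K, mass lam F (S `&` K) = x * mass lam F K &
      mass lam F (B `&` K) < c * mass lam F K].

(** All that later steps retain of a cut; unlike the cut itself it passes to smaller pieces. *)
Definition one_sided (K : set (n.-tuple R)) (i j : 'I_n) (p q : R) :=
  exists v w, (v != 0) || (w != 0) /\
    forall z, K z -> 0 <= v * (tnth z i - p) + w * (tnth z j - q).

Lemma one_sidedS K K' i j p q : K' `<=` K -> one_sided K i j p q -> one_sided K' i j p q.
Proof. by move=> KK [v [w [h1 h2]]]; exists v, w; split => // z /KK; exact: h2. Qed.

Lemma pencil_conv (i j : 'I_n) (p q t s : R) (y z : n.-tuple R) :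
  pencil i j p q t (vadd (vscale s y) (vscale (1 - s) z)) =
  s * pencil i j p q t y + (1 - s) * pencil i j p q t z.
Proof. by rewrite /pencil !tnth_mktuple; ring. Qed.

(** Both halves inherit the equality for S. The masses in the strict inequality are additive, so it
    cannot fail on both halves; for c > 0 it also forces positive mass on the one that is kept. *)
Lemma cut_step (K : set (n.-tuple R)) (i j : 'I_n) (p q : R) : i != j -> bad_piece K ->
  exists K', [/\ K' `<=` K, bad_piece K' & one_sided K' i j p q].
Proof.
move=> ij [mK cK SK BK].
have mSK := measurableI _ _ mS mK.
have [t ht] := bisect p q hl ij mF F0 iF mSK mK SK.
have nz : (t != 0) || (1 - t ^+ 2 != 0).
  by have [->|//] := eqVneq t 0; rewrite expr0n/= subr0 oner_eq0.
set H := [set z | 0 <= pencil i j p q t z] in ht.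
pose H' := [set z | pencil i j p q t z <= 0].
have mH : measurable H by apply: measurable_set_le => //; exact: measurable_pencil.
have mH' : measurable H' by apply: measurable_set_le => //; exact: measurable_pencil.
have sp C := pencil_split p q t hl ij mF F0 iF (C := C).
have s1 := sp _ mSK; have s2 := sp _ mK; have s3 := sp _ (measurableI _ _ mB mK).
rewrite -/H -/H' in s1 s2 s3.
have [h|h] := ltP (mass lam F (B `&` (K `&` H))) (c * mass lam F (K `&` H)).
  exists (K `&` H); split; first exact: subIsetl.
    split => //; first exact: measurableI.
      move=> y z s [Ky Hy] [Kz Hz] s01; split; first exact: cK.
      rewrite /H /= pencil_conv addr_ge0// mulr_ge0//; lra.
    by rewrite setIA.
  by exists t, (1 - t ^+ 2); split => // z [].
exists (K `&` H'); split; first exact: subIsetl.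
  split => //; first exact: measurableI.
  - move=> y z s [Ky Hy] [Kz Hz] s01; split; first exact: cK.
    rewrite /H' /= pencil_conv; rewrite /H' /= in Hy Hz.
    have a1 : 0 <= s * (- pencil i j p q t y) by rewrite mulr_ge0//; lra.
    have a2 : 0 <= (1 - s) * (- pencil i j p q t z) by rewrite mulr_ge0//; lra.
    lra.
  - rewrite setIA; have : x * (mass lam F (K `&` H) + mass lam F (K `&` H')) = x * mass lam F K by rewrite s2.
    lra.
  - rewrite setIA; move: h; rewrite setIA => h.
    have : c * (mass lam F (K `&` H) + mass lam F (K `&` H')) = c * mass lam F K by rewrite s2.
    lra.
exists (- t), (- (1 - t ^+ 2)); split; first by rewrite !oppr_eq0.
move=> z [_]; rewrite /H' /= /pencil; lra.
Qed.

Lemma cut_seq (K : set (n.-tuple R)) (s : seq ('I_n * 'I_n * R * R)) :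
  (forall u, u \in s -> u.1.1.1 != u.1.1.2) -> bad_piece K ->
  exists K', [/\ K' `<=` K, bad_piece K' &
    forall u, u \in s -> one_sided K' u.1.1.1 u.1.1.2 u.1.2 u.2].
Proof.
elim: s K => [|u s IH] K hs bK; first by exists K; split.
have [|K1 [K1K bK1 hK1]] := IH K _ bK.
  by move=> v vs; apply: hs; rewrite inE vs orbT.
have [K2 [K21 bK2 hK2]] := cut_step u.1.2 u.2 (hs u (mem_head _ _)) bK1.
exists K2; split => //; first exact: subset_trans K21 K1K.
move=> v; rewrite inE => /predU1P[->//|vs].
exact: (one_sidedS K21 (hK1 _ vs)).
Qed.

End cuts.

(** * Pieces that are one-sided over a fine grid are thin tubes *)

Section thin.
Context {R : realType}.

Lemma grid_exists (Q d : R) : 0 < d -> 0 <= Q ->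
  exists G : seq R, forall y, - Q <= y <= Q -> exists2 g, g \in G & y < g <= y + d.
Proof.
move=> d0 Q0.
(* The last grid point lies beyond Q, so that y = Q has one above it too. *)
exists [seq d * m%:R - Q | m <- iota 0 (Num.truncn ((Q + Q) / d)).+2] => y /andP[y1 y2].
have yQ : 0 <= (y + Q) / d by apply: divr_ge0; [lra|exact: ltW].
exists (d * (Num.truncn ((y + Q) / d)).+1%:R - Q).
  apply/mapP; exists (Num.truncn ((y + Q) / d)).+1 => //.
  rewrite mem_iota/= add0n !ltnS; apply: le_truncn.
  by rewrite ler_pM2r ?invr_gt0// lerD2r.
have /andP[h1 h2] := truncn_itv yQ.
rewrite ler_pdivlMr// in h1; rewrite ltr_pdivrMr// in h2.
by rewrite -[_.+1]addn1 natrD in h2 *; apply/andP; split; lra.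
Qed.

(** The grid supplies points to the right of a given value, so for e < x the search starts from x -
    2 d. In both cases g is within 2 d of x, at most half of the way to e. *)
Lemma grid_between (G : seq R) (Q d x e : R) : 0 < d ->
  (forall y, - Q <= y <= Q -> exists2 g, g \in G & y < g <= y + d) ->
  `|x| <= Q -> `|e| <= Q -> 4 * d <= `|e - x| ->
  exists g, [/\ g \in G, Num.min x e < g < Num.max x e & 0 < (g - x) / (e - x) <= 1 / 2].
Proof.
move=> d0 hG; rewrite !ler_norml => /andP[x1 x2] /andP[e1 e2] he.
have [ex|ex] := leP x e.
  rewrite ger0_norm ?subr_ge0// in he.
  have /hG[g gG /andP[g1 g2]] : - Q <= x <= Q by rewrite x1.
  exists g; rewrite gG; split => //; first by apply/andP; split; lra.
  have ex' : 0 < e - x by lra.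
  by apply/andP; split; [rewrite divr_gt0//; lra|rewrite ler_pdivrMr//; lra].
rewrite ltr0_norm ?subr_lt0// in he.
have /hG[g gG /andP[g1 g2]] : - Q <= x - 2 * d <= Q by apply/andP; split; lra.
exists g; rewrite gG; split => //; first by apply/andP; split; lra.
rewrite -[g - _]opprB -[e - _]opprB invrN mulrNN.
have ex' : 0 < x - e by lra.
by apply/andP; split; [rewrite divr_gt0//; lra|rewrite ler_pdivrMr//; lra].
Qed.

Variables (n : nat) (K : set (n.-tuple R)) (k : 'I_n) (G : seq R) (Q d : R).
Hypotheses (d0 : 0 < d) (cK : is_convex_set K).
Hypothesis KQ : forall z i, K z -> `|tnth z i| <= Q.
Hypothesis hG : forall y, - Q <= y <= Q -> exists2 g, g \in G & y < g <= y + d.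
Hypothesis hK : forall j g g', j != k -> g \in G -> g' \in G -> one_sided K k j g g'.

(** Otherwise some grid value g' lies strictly between z_j and z'_j. The half-space that contains K
    and has (g, g') on its boundary must then have w = 0 because of z and z', and v = 0 because of a
    and b. *)
Let column j a b z z' g : j != k -> K a -> K b -> K z -> K z' -> g \in G ->
  tnth a k < g < tnth b k -> tnth z k = g -> tnth z' k = g ->
  tnth z' j - tnth z j <= d.
Proof.
move=> jk Ka Kb Kz Kz' gG /andP[ag gb] zg z'g; rewrite leNgt; apply/negP => h.
have /hG[g' g'G /andP[h1 h2]] : - Q <= tnth z j <= Q by rewrite -ler_norml KQ.
have [v [w [vw hvw]]] := hK jk gG g'G.
have := hvw _ Kz; have := hvw _ Kz'; rewrite zg z'g subrr mulr0 !add0r.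
rewrite pmulr_lge0 ?subr_gt0; last by lra.
rewrite nmulr_lge0 ?subr_lt0// => w1 w2.
have w0 : w = 0 by apply/eqP; rewrite eq_le w1 w2.
have := hvw _ Ka; have := hvw _ Kb; rewrite w0 !mul0r !addr0.
rewrite pmulr_lge0 ?subr_gt0// nmulr_lge0 ?subr_lt0// => v1 v2.
have v0 : v = 0 by apply/eqP; rewrite eq_le v1 v2.
by move: vw; rewrite v0 w0 eqxx.
Qed.

(** A contraction towards e moves the fibre of z onto a grid value, where [column] applies. Since u
    <= 1 / 2, it keeps at least half of the width. *)
Let width_side j e z z' : j != k -> K e -> K z -> K z' -> tnth z k = tnth z' k ->
  4 * d <= `|tnth e k - tnth z k| -> tnth z' j - tnth z j <= 2 * d.
Proof.
have d0' := d0; move=> jk Ke Kz Kz' zz' he.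
have [g [gG gzne u12]] := grid_between d0 hG (KQ k Kz) (KQ k Ke) he.
have ez : tnth e k - tnth z k != 0.
  by apply/eqP => E; move: he; rewrite E normr0; lra.
have uE : (g - tnth z k) / (tnth e k - tnth z k) * (tnth e k - tnth z k) = g - tnth z k by rewrite divfK.
set u := (g - _) / _ in u12 uE.
pose w y := vadd (vscale (1 - u) y) (vscale (1 - (1 - u)) e).
have wk y : tnth y k = tnth z k -> tnth (w y) k = g.
  by move=> yk; rewrite !tnth_mktuple yk; lra.
have Kw y : K y -> K (w y) by move=> Ky; apply: cK => //; lra.
have hcol : tnth (w z') j - tnth (w z) j <= d.
  have [h|h] := leP (tnth z k) (tnth e k).
    by apply: (column jk Kz Ke (Kw _ Kz) (Kw _ Kz') gG); rewrite ?wk//; move: gzne; rewrite min_l// max_r.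
  by apply: (column jk Ke Kz (Kw _ Kz) (Kw _ Kz') gG); rewrite ?wk//; move: gzne;
    rewrite min_r ?max_l// ltW.
rewrite leNgt; apply/negP => h; move: hcol; rewrite !tnth_mktuple.
set D := tnth z' j - tnth z j in h.
have -> : (1 - u) * tnth z' j + (1 - (1 - u)) * tnth e j -
  ((1 - u) * tnth z j + (1 - (1 - u)) * tnth e j) = (1 - u) * D by rewrite /D; ring.
have : 1 / 2 * D <= (1 - u) * D by rewrite ler_wpM2r//; lra.
lra.
Qed.

Lemma width j a b z z' : j != k -> K a -> K b -> 8 * d <= tnth b k - tnth a k ->
  K z -> K z' -> tnth z k = tnth z' k -> `|tnth z' j - tnth z j| <= 2 * d.
Proof.
have d0' := d0; move=> jk Ka Kb ab Kz Kz' zz'.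
have [e Ke he] : exists2 e, K e & 4 * d <= `|tnth e k - tnth z k|.
  have [h|h] := leP (tnth z k - tnth a k) (4 * d).
    by exists b => //; apply: le_trans (ler_norm _); lra.
  by exists a => //; rewrite distrC; apply: le_trans (ler_norm _); lra.
rewrite ler_norml; apply/andP; split; last exact: (width_side jk Ke).
by rewrite lerNl opprB; apply: (width_side jk Ke) => //; rewrite -zz'.
Qed.

(** Over the chord from a to b this is [width]. Beyond one of its ends, the segment from z to the
    opposite end crosses the fibre of the nearer end, and extrapolating from there at most doubles
    the error, because no two points of K are more than twice as far apart in coordinate k as a and
    b. *)
Lemma chord_dev j a b z : j != k -> K a -> K b -> 8 * d <= tnth b k - tnth a k ->
  (forall y y', K y -> K y' -> tnth y k - tnth y' k <= 2 * (tnth b k - tnth a k)) ->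
  K z ->
  `|tnth z j - tnth a j - (tnth z k - tnth a k) / (tnth b k - tnth a k) * (tnth b j - tnth a j)| <= 4 * d.
Proof.
have d0' := d0; move=> jk Ka Kb ab spr Kz.
set l := tnth b k - tnth a k; have l0 : 0 < l by rewrite /l; lra.
set r := _ / l; have rl : r * l = tnth z k - tnth a k by rewrite divfK// gt_eqF.
have wd := width jk Ka Kb ab.
have [r0|r0] := ltP r 0.
  pose s := 1 - r.
  have s1 : 1 < s by rewrite /s; lra.
  have s2 : s <= 2.
    have h : s * l <= 2 * l by have := spr _ _ Kb Kz; rewrite /s -/l mulrBl rl /l; lra.
    by rewrite ler_pM2r in h.
  have si : 0 <= s^-1 <= 1 by rewrite invr_ge0 invf_le1//; lra.
  have sn : s != 0 by rewrite gt_eqF//; lra.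
  pose a' := vadd (vscale s^-1 z) (vscale (1 - s^-1) b).
  have Ka' : K a' by exact: cK.
  have E i : s * (tnth a' i - tnth b i) = tnth z i - tnth b i.
    by rewrite !tnth_mktuple mulrDr mulrN; field.
  have a'k : tnth a' k = tnth a k.
    apply: (mulfI sn); have := E k; rewrite mulrBr; move: rl; rewrite /s /l; lra.
  have := wd _ _ Ka Ka' (esym a'k) => h.
  have -> : tnth z j - tnth a j - r * (tnth b j - tnth a j) = s * (tnth a' j - tnth a j).
    have := E j; rewrite /s; lra.
  rewrite normrM gtr0_norm; last by lra.
  apply: (@le_trans _ _ (s * (2 * d))); first by rewrite ler_pM2l//; lra.
  have h2 : s * (2 * d) <= 2 * (2 * d) by rewrite ler_pM2r//; lra.
  lra.
have [r1|r1] := leP r 1.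
  pose y := vadd (vscale r b) (vscale (1 - r) a).
  have Ky : K y by apply: cK => //; rewrite r0.
  have E i : tnth y i = r * (tnth b i - tnth a i) + tnth a i by rewrite !tnth_mktuple; ring.
  have h := wd _ _ Ky Kz _; rewrite E -/l rl subrK in h; have := h erefl.
  rewrite E => h'; have -> : tnth z j - tnth a j - r * (tnth b j - tnth a j) =
    tnth z j - (r * (tnth b j - tnth a j) + tnth a j) by ring.
  by apply: le_trans h' _; lra.
have r2 : r <= 2.
  have h : r * l <= 2 * l by have := spr _ _ Kz Ka; rewrite rl.
  by rewrite ler_pM2r in h.
have si : 0 <= r^-1 <= 1 by rewrite invr_ge0 invf_le1//; lra.
have rn : r != 0 by rewrite gt_eqF//; lra.
pose b' := vadd (vscale r^-1 z) (vscale (1 - r^-1) a).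
have Kb' : K b' by exact: cK.
have E i : r * (tnth b' i - tnth a i) = tnth z i - tnth a i.
  by rewrite !tnth_mktuple mulrDr mulrN; field.
have b'k : tnth b' k = tnth b k.
  apply: (mulfI rn); have := E k; rewrite mulrBr; move: rl; rewrite /l; lra.
have h := wd _ _ Kb Kb' (esym b'k).
have -> : tnth z j - tnth a j - r * (tnth b j - tnth a j) = r * (tnth b' j - tnth b j).
  have := E j; lra.
rewrite normrM gtr0_norm; last by lra.
apply: (@le_trans _ _ (r * (2 * d))); first by rewrite ler_pM2l//; lra.
have h2 : r * (2 * d) <= 2 * (2 * d) by rewrite ler_pM2r//; lra.
lra.
Qed.
End thin.

(** * Needles *)

Lemma mass_setU_le (R : realType) n (lam : {measure set (n.-tuple R) -> \bar R})
    (F : n.-tuple R -> R) (A B : set (n.-tuple R)) :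
  measurable_fun setT F -> (forall x, 0 <= F x) -> (dmeasure lam F setT < +oo)%E ->
  measurable A -> measurable B ->
  mass lam F (A `|` B) <= mass lam F A + mass lam F B.
Proof.
move=> mF F0 iF mA mB; have mD := measurableD mB mA.
have -> : A `|` B = A `|` (B `\` A)
  by apply/seteqP; split => z [Az|]; [left| |left|case; right] => //; have [] := pselect (A z); [left|right].
rewrite massU//; first by rewrite lerD2l; apply: mass_le => // z [].
by apply/seteqP; split => // z [Az []].
Qed.

Section norm.
Context {R : realType} (n : nat) (N : n.-tuple R -> R).
Hypothesis hN : is_norm N.

Definition vzero : n.-tuple R := [tuple 0 | i < n].
Definition vbasis (j : 'I_n) : n.-tuple R := [tuple (i == j)%:R | i < n].

Lemma norm_vzero : N vzero = 0.
Proof.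
have [_ _ NZ _] := hN.
have -> : vzero = vscale 0 vzero by apply: eq_from_tnth => i; rewrite !tnth_mktuple mulr0.
by rewrite NZ normr0 mul0r.
Qed.

Definition norm_cst : R := \sum_(j < n) N (vbasis j).

Lemma norm_cst_ge0 : 0 <= norm_cst.
Proof. by have [N0 _ _ _] := hN; apply: sumr_ge0. Qed.

(** Triangle inequality along the truncations [tr m], one coordinate at a time. *)
Lemma norm_le_coord (e : n.-tuple R) (d : R) :
  (forall i, `|tnth e i| <= d) -> N e <= norm_cst * d.
Proof.
have [N0 _ NZ ND] := hN => ed.
pose tr m := [tuple if (i < m)%N then tnth e i else 0 | i < n].
have H m : (m <= n)%N -> N (tr m) <= \sum_(j < n | (j < m)%N) `|tnth e j| * N (vbasis j).
  elim: m => [|m IH] mn.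
    by rewrite big_pred0// (_ : tr 0%N = vzero) ?norm_vzero.
  pose jm := Ordinal mn.
  have -> : tr m.+1 = vadd (tr m) (vscale (tnth e jm) (vbasis jm)).
    apply: eq_from_tnth => i; rewrite !tnth_mktuple ltnS leq_eqVlt.
    have [im|im] := eqVneq i jm.
      by rewrite im eqxx ltnn add0r mulr1.
    rewrite (_ : (val i == m) = false) /= ?mulr0 ?addr0//.
    by apply/negbTE; apply: contra im => /eqP im; apply/eqP/val_inj.
  apply: (le_trans (ND _ _)).
  rewrite NZ (bigD1 jm)//= [leLHS]addrC lerD2l; apply: le_trans (IH (ltnW mn)) _.
  rewrite le_eqVlt; apply/orP; left; apply/eqP; apply: eq_bigl => i.
  have [->|im] := eqVneq i jm; first by rewrite /= ltnn andbF.
  rewrite andbT ltnS [RHS]leq_eqVlt (_ : (val i == m) = false)//.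
  by apply/negbTE; apply: contra im => /eqP im; apply/eqP/val_inj.
have -> : e = tr n by apply: eq_from_tnth => i; rewrite tnth_mktuple ltn_ord.
apply: le_trans (H n (leqnn n)) _; rewrite /norm_cst mulr_suml.
rewrite (eq_bigl xpredT); last by move=> i; rewrite ltn_ord.
by apply: ler_sum => i _; rewrite mulrC ler_wpM2l.
Qed.

End norm.

Section restrict.
Context {R : realType} (n : nat).

Lemma logconcave_restrict (F : n.-tuple R -> R) (K : set (n.-tuple R)) :
  logconcave_density F -> is_convex_set K -> logconcave_density (fun x => F x * \1_K x).
Proof.
move=> [F0 Fc] cK.
split=> [x|x y t t01]; first by rewrite mulr_ge0.
have /andP[t0 t1] := t01.
have g0 z : 0 <= F z * \1_K z by rewrite mulr_ge0.
(* A power with exponent 0 is 1 even at base 0, so both extreme values of t must go before a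
   vanishing factor can be used. *)
have [->|tn0] := eqVneq t 0.
  by rewrite powRr0 mul1r vscale0_vadd subr0 powRr1.
have [->|tn1] := eqVneq t 1.
  by rewrite vscale1_vadd subrr powRr0 mulr1 powRr1.
have [xK|xK] := boolP (x \in K); last first.
  by rewrite [X in X `^ t * _ <= _](_ : _ = 0) ?powR0// ?mul0r ?g0// indicE (negbTE xK) mulr0.
have [yK|yK] := boolP (y \in K); last first.
  rewrite [X in _ * X `^ (1 - t) <= _](_ : _ = 0); last by rewrite indicE (negbTE yK) mulr0.
  by rewrite powR0 ?mulr0 ?g0// subr_eq0 eq_sym.
rewrite !indicE xK yK (_ : _ \in K); first by rewrite !mulr1; exact: Fc.
by rewrite inE; apply: cK => //; rewrite -inE.
Qed.

Lemma bounded_logconcave_restrict (F : n.-tuple R -> R) (K : set (n.-tuple R)) (c M : R) :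
  measurable_fun setT F -> logconcave_density F -> (forall x, F x <= c) ->
  measurable K -> is_convex_set K -> (forall x i, K x -> `|tnth x i| <= M) ->
  bounded_logconcave (fun x => F x * \1_K x) c M.
Proof.
move=> mF lcF Fb mK cK KM; have [F0 _] := lcF; split.
- by apply: measurable_funM => //; exact: measurable_indic.
- exact: logconcave_restrict.
- move=> x; apply: le_trans (Fb x); rewrite ler_piMr// indicE.
- move=> x i h; rewrite indicE (_ : (x \in K) = false) ?mulr0//.
  apply/negbTE; rewrite notin_setE => /(KM _ i).
  by rewrite leNgt h.
Qed.
End restrict.

Lemma window_dist (R : realType) (ti tj eta s y : R) (b : bool) :
  (b -> ti <= tj) -> (~~ b -> tj <= ti) ->
  ti <= s -> s < ti + eta -> tj <= y -> y < tj + eta ->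
  `|y - s| <= (if b then tj - (ti + eta) else ti - (tj + eta)) + 2 * eta.
Proof.
rewrite ler_norml; case: b => [/(_ isT) h _|_ /(_ isT) h] *; apply/andP; split; lra.
Qed.

Lemma window_apart (R : realType) (a g eta nu h e h' : R) :
  h - e < a -> a <= (g + 2 * eta) * nu -> 2 * (eta * nu) <= h - e - h' -> h' < g * nu.
Proof. by rewrite mulrDl; lra. Qed.

Section needle.
Context {R : realType} (n : nat) (lam : {measure set (n.+1.-tuple R) -> \bar R}).

(** In each window that A meets, its mass is bounded by that of all of K there. *)
Lemma slab_mass_sum (F : n.+1.-tuple R -> R) (k : 'I_n.+1) (K A : set (n.+1.-tuple R)) (M : R)
    (tau Phi : nat -> R) (col : nat -> option bool) (o : bool) (W : nat) :
  measurable_fun setT F -> (forall x, 0 <= F x) -> (dmeasure lam F setT < +oo)%E ->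
  measurable K -> measurable A -> A `<=` K -> 0 < M ->
  (forall i, tau i <= tau i.+1) ->
  (forall i, Phi i = mass lam F (K `&` slab k `]-oo, tau i[) / M) ->
  mass lam F (A `&` slab k `]-oo, tau 0%N[) = 0 ->
  (forall i, (i < W)%N -> A `&` slab k `[tau i, tau i.+1[ !=set0 -> col i = Some o) ->
  forall i, (i <= W)%N -> mass lam F (A `&` slab k `]-oo, tau i[) <= M * wsum Phi col (Some o) i.
Proof.
move=> mF F0 iF mK mA AK M0 taund PhiE A0 hcol.
have ms I : measurable I -> measurable (slab k I) by exact: measurable_slab.
have mslt t : measurable (slab k `]-oo, t[) by exact: ms.
have msw i : measurable (slab k `[tau i, tau i.+1[) by exact: ms.
have spl C i : measurable C -> mass lam F (C `&` slab k `]-oo, tau i.+1[) =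
    mass lam F (C `&` slab k `]-oo, tau i[) + mass lam F (C `&` slab k `[tau i, tau i.+1[).
  move=> mC; rewrite -massU//; try exact: measurableI.
    rewrite -setIUr; congr (mass _ _ (_ `&` _)).
    apply/seteqP; split => z; rewrite /slab /= !in_itv/=.
      by move=> h; have [h'|h'] := ltP (tnth z k) (tau i); [left|right].
    by move=> [h|/andP[_ //]]; exact: lt_le_trans h (taund i).
  apply/seteqP; split => // z [[_ h1] [_ h2]]; move: h1 h2; rewrite /slab /= !in_itv/=.
  by move=> h1 /andP[h2 _]; move: (le_lt_trans h2 h1); rewrite ltxx.
elim=> [_|i IH iW]; first by rewrite A0 /wsum big_ord0 mulr0.
rewrite spl// wsumS mulrDr; apply: lerD; first exact: IH (ltnW iW).
have [ne|em] := pselect (A `&` slab k `[tau i, tau i.+1[ !=set0).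
  rewrite (hcol i iW ne) eqxx !PhiE -mulrBl mulrC divfK ?gt_eqF// spl// addrAC subrr add0r.
  by apply: mass_le => //; [exact: measurableI|exact: measurableI|exact: setSI].
have -> : A `&` slab k `[tau i, tau i.+1[ = set0.
  by apply/seteqP; split => // z hz; apply: em; exists z.
rewrite mass_null//.
case: ifP => _; last by rewrite mulr0.
rewrite mulr_ge0 ?(ltW M0)// !PhiE -mulrBl divr_ge0 ?(ltW M0)// subr_ge0.
apply: mass_le => //; try exact: measurableI.
by apply: setIS => z; rewrite /slab /= !in_itv/= => h; exact: lt_le_trans h (taund i).
Qed.

End needle.

(** K is a tube: up to e, the distance of two points is nu times their distance in coordinate k.
    Windows in that coordinate are coloured by S and by Y, the part of K outside S and B. These sets
    are more than h apart, so windows of opposite colours are at least h' / nu apart, the difference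
    h - e - h' absorbing their widths, and [windows_J] applies to the marginal. *)
Lemma needle (R : realType) n (lam : {measure set (n.-tuple R) -> \bar R})
    (F N : n.-tuple R -> R) (K S B : set (n.-tuple R))
    (k : 'I_n) (c Q h e nu D h' : R) :
  is_lebesgue lam -> measurable_fun setT F -> logconcave_density F -> (forall x, F x <= c) ->
  (dmeasure lam F setT < +oo)%E ->
  measurable K -> is_convex_set K -> 0 <= Q -> (forall x i, K x -> `|tnth x i| <= Q) ->
  measurable S -> measurable B -> 0 < mass lam F K ->
  (forall s y, S s -> K s -> K y -> ~ S y -> ~ B y -> h < N (vsub y s)) ->
  0 < nu ->
  (forall z z', K z -> K z' -> N (vsub z z') <= `|tnth z k - tnth z' k| * nu + e) ->
  (forall z z', K z -> K z' -> `|tnth z k - tnth z' k| * nu <= D) ->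
  (exists z z', [/\ K z, K z' & tnth z k < tnth z' k]) ->
  0 < h' < h - e ->
  let x := mass lam F (S `&` K) / mass lam F K in
  let g := mass lam F (B `&` K) / mass lam F K in
  exists x', [/\ x <= x' <= x + g, x' <= 1 & h' * J x' <= D * g].
Proof.
case: n lam F N K S B k => [? ? ? ? ? ? []//|n lam F N K S B k].
move=> hl mF lcF Fc iF mK cK Q0 KQ mS mB M0 sep nu0 hN hD [z0 [z1 [Kz0 Kz1 z01]]] /andP[h'0 h'h] x g.
have [F0 _] := lcF.
have [m [mm lm m0 mI]] := marginal_density k hl Q0 (bounded_logconcave_restrict mF lcF Fc mK cK KQ).
set M := mass lam F K in M0 x g *.
have massK I : measurable I -> (\int[@lebesgue_measure R]_(t in I) (m t)%:E = (mass lam F (K `&` slab k I))%:E)%E.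
  move=> mI'; rewrite -mI// -massE//; last by apply: measurableI => //; exact: measurable_slab.
  rewrite [K `&` _]setIC /dmeasure integral_mkcondr; apply: eq_integral => z _.
  by rewrite patchE indicE; case: (z \in K); rewrite ?mulr1 ?mulr0.
pose P := [set t | exists2 z, K z & t = tnth z k].
have PK z : K z -> P (tnth z k) by exists z.
have uP : has_ubound P.
  by exists Q => _ [z Kz ->]; apply: le_trans (ler_norm _) (KQ _ _ Kz).
have lP : has_lbound P.
  by exists (- Q) => _ [z Kz ->]; have := KQ _ k Kz; rewrite ler_norml => /andP[].
have P0 : P !=set0 by exists (tnth z0 k); exact: PK.
pose al := inf P; pose be := sup P.
have alK z : K z -> al <= tnth z k by move=> Kz; apply: ge_inf => //; exact: PK.
have beK z : K z -> tnth z k <= be by move=> Kz; apply: ub_le_sup => //; exact: PK.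
have ab : al < be by apply: le_lt_trans (alK _ Kz0) (lt_le_trans z01 (beK _ Kz1)).
have abnu : (be - al) * nu <= D.
  rewrite -ler_pdivlMr// lerBlDr; apply: ge_sup => // _ [z Kz ->].
  rewrite -lerBlDl; apply: lb_le_inf => // _ [z' Kz' ->].
  rewrite lerBlDl -lerBlDr ler_pdivlMr//; apply: le_trans (hD _ _ Kz Kz').
  by rewrite ler_wpM2r ?(ltW nu0)// ler_norm.
have supp s : ~~ (al <= s <= be) -> m s = 0.
  move=> hs; apply: m0 => z zs; rewrite indicE; have [zK|] := boolP (z \in K); last by rewrite mulr0.
  by move: zK; rewrite inE => zK; move: hs; rewrite -zs alK// beK.
have hM : (\int[@lebesgue_measure R]_s (m s)%:E = M%:E)%E.
  by rewrite massK// (_ : slab k setT = setT) ?setIT//; apply/seteqP; split.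
pose C t := mass lam F (K `&` slab k `]-oo, t[).
have hC t : (\int[@lebesgue_measure R]_(s in `]-oo, t[) (m s)%:E = (C t)%:E)%E by rewrite massK.
have gapJ p q pq := @gap_J R m al be M C p q lm mm ab supp hM M0 hC pq.
pose L := be - al; have L0 : 0 < L by rewrite /L subr_gt0.
have hh : 0 < h - e - h' by lra.
have D0 : 0 <= D by apply: le_trans abnu; rewrite mulr_ge0 ?(ltW nu0)// ltW.
(* Enough windows for 2 eta nu = 4 L nu / W <= 4 D / W to be at most h - e - h'. *)
pose W := (Num.truncn (4 * D / (h - e - h'))).+1.
have W0 : 0 < W%:R :> R by rewrite ltr0n.
have W1 : 4 * D / W%:R <= h - e - h'.
  rewrite ler_pdivrMr// [leRHS]mulrC -ler_pdivrMr//; apply: ltW; exact: truncnS_gt.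
(* The factor 2 puts tau W strictly beyond the supremum [be], as half-open windows require. *)
pose eta := 2 * L / W%:R.
have eta0 : 0 < eta by rewrite divr_gt0// mulr_gt0.
have etanu : 2 * (eta * nu) <= h - e - h'.
  apply: le_trans W1; rewrite /eta.
  have -> : 2 * (2 * L / W%:R * nu) = 4 * (L * nu) / W%:R by ring.
  by rewrite ler_pM2r ?invr_gt0// ler_pM2l.
pose tau (i : nat) := al + i%:R * eta.
have tauS i : tau i.+1 = tau i + eta by rewrite /tau -[i.+1]addn1 natrD; ring.
have taund i j : (i <= j)%N -> tau i <= tau j.
  by move=> ij; rewrite /tau lerD2l ler_pM2r// ler_nat.
have taund1 i : tau i <= tau i.+1 by apply: taund.
pose Phi i := C (tau i) / M.
have mCt t : measurable (K `&` slab k `]-oo, t[) by apply: measurableI => //; exact: measurable_slab.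
have Phi_nd i j : (i <= j)%N -> Phi i <= Phi j.
  move=> ij; rewrite ler_pM2r ?invr_gt0//; apply: mass_le => //.
  by apply: setIS => z; rewrite /slab /= !in_itv/= => hz; apply: lt_le_trans hz (taund _ _ ij).
have below (A : set (n.+1.-tuple R)) : A `<=` K -> A `&` slab k `]-oo, tau 0%N[ = set0.
  move=> AK; apply/seteqP; split => // z [/AK /alK]; rewrite /slab /= in_itv/= /tau mul0r addr0.
  by rewrite leNgt => /negP.
have above (A : set (n.+1.-tuple R)) : A `<=` K -> A `&` slab k `]-oo, tau W[ = A.
  move=> AK; apply/seteqP; split => [z []//|z Az]; split => //.
  rewrite /slab /= in_itv/=; apply: le_lt_trans (beK _ (AK _ Az)) _.
  rewrite /tau /eta mulrC divfK ?gt_eqF//; rewrite /L; lra.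
have mass0 : mass lam F set0 = 0 by rewrite mass_null.
have Phi0 : Phi 0%N = 0 by rewrite /Phi /C below// mass0 mul0r.
have PhiW : Phi W = 1 by rewrite /Phi /C above// divff// gt_eqF.
pose Y := K `\` (S `|` B).
have mY : measurable Y by apply: measurableD => //; exact: measurableU.
pose win i := slab k `[tau i, tau i.+1[ : set (n.+1.-tuple R).
pose col i := if pselect ((S `&` K) `&` win i !=set0) then Some true
              else if pselect (Y `&` win i !=set0) then Some false else None.
have colT i : col i = Some true -> (S `&` K) `&` win i !=set0.
  by rewrite /col; case: (pselect ((S `&` K) `&` win i !=set0)) => //= _; case: (pselect (Y `&` win i !=set0)).
have colF i : col i = Some false -> Y `&` win i !=set0.
  by rewrite /col; case: (pselect ((S `&` K) `&` win i !=set0)) => //= _; case: (pselect (Y `&` win i !=set0)).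
have apart s y i j : S s -> K s -> Y y -> win i s -> win j y ->
    h' < (if (i <= j)%N then tau j - tau i.+1 else tau i - tau j.+1) * nu.
  move=> Ss Ks [Ky SBy] wi wj.
  have hN' := sep s y Ss Ks Ky (fun h => SBy (or_introl h)) (fun h => SBy (or_intror h)).
  have := hN y s Ky Ks => hN2.
  have : h - e < `|tnth y k - tnth s k| * nu by lra.
  move=> hlt; move: wi wj; rewrite /win /slab /= !in_itv/= !tauS => /andP[w1 w2] /andP[w3 w4].
  have bnd : `|tnth y k - tnth s k| <= (if (i <= j)%N then tau j - (tau i + eta) else tau i - (tau j + eta)) + 2 * eta.
    apply: window_dist => //; first exact: taund.
    by rewrite -ltnNge => ij; apply: taund; exact: ltnW.
  apply: window_apart hlt _ etanu.
  by rewrite ler_pM2r.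
(* One window cannot meet both sets, as its points are too close together; the order of the tests in
   [col] therefore does not matter. *)
have colY i : Y `&` win i !=set0 -> col i = Some false.
  move=> hY; rewrite /col; case: (pselect ((S `&` K) `&` win i !=set0)) => /= hSK; last by case: (pselect (Y `&` win i !=set0)).
  have [s [[Ss Ks] ws]] := hSK.
  have [y [Yy wy]] := hY.
  have := apart s y i i Ss Ks Yy ws wy; rewrite leqnn tauS => hlt.
  exfalso; have : 0 <= eta * nu by rewrite mulr_ge0// ltW.
  lra.
have sepc i j b : (i < j)%N -> (j < W)%N -> col i = Some b -> col j = Some (~~ b) ->
    h' / nu <= tau j - tau i.+1.
  move=> ij _ ci cj; rewrite ler_pdivrMr//; apply: ltW.
  case: b ci cj => /=.
    move=> /colT [s [[Ss Ks] ws]] /colF [y [Yy wy]].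
    by have := apart s y i j Ss Ks Yy ws wy; rewrite (ltnW ij).
  move=> /colF [y [Yy wy]] /colT [s [[Ss Ks] ws]].
  by have := apart s y j i Ss Ks Yy ws wy; rewrite leqNgt ij.
have gapc i j : (i < j)%N -> (j <= W)%N ->
    exists2 l, l = i \/ l = j & (tau j - tau i) * J (Phi l) <= L * (Phi j - Phi i).
  move=> ij _.
  have tij : tau i < tau j by rewrite /tau ltrD2l ltr_pM2r// ltr_nat.
  by have [t [->|->] ht] := gapJ _ _ tij; [exists i; [left|]|exists j; [right|]].
have hnu : 0 < h' / nu by rewrite divr_gt0.
have [x' [/andP[x1 x2] hx']] := windows_J (ltW L0) hnu Phi_nd Phi0 PhiW gapc sepc.
have tot := wsum_total col Phi0 W.
have mSK := measurableI _ _ mS mK.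
have sA : mass lam F (S `&` K) <= M * wsum Phi col (Some true) W.
  have := @slab_mass_sum R n lam F k K (S `&` K) M tau Phi col true W mF F0 iF mK mSK (@subIsetr _ _ _) M0
    taund1 (fun i => erefl) _ _ W (leqnn W).
  rewrite above; last exact: subIsetr.
  apply; first by rewrite below//; exact: subIsetr.
  by move=> i _ hi; rewrite /col; case: (pselect ((S `&` K) `&` win i !=set0)).
have sB : mass lam F Y <= M * wsum Phi col (Some false) W.
  have YK : Y `<=` K by move=> z [].
  have := @slab_mass_sum R n lam F k K Y M tau Phi col false W mF F0 iF mK mY YK M0
    taund1 (fun i => erefl) _ _ W (leqnn W).
  rewrite above// below//; apply => // i _ hi; exact: colY.
have totM : M <= mass lam F (S `&` K) + mass lam F (B `&` K) + mass lam F Y.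
  rewrite /M (massD mF F0 iF mK (measurableU _ _ mS mB)) lerD2r.
  rewrite setIUr ![K `&` _]setIC; exact: (mass_setU_le mF F0 iF mSK (measurableI _ _ mB mK)).
have xA : x <= wsum Phi col (Some true) W by rewrite ler_pdivrMr// mulrC.
have yB : 1 - x - g <= wsum Phi col (Some false) W.
  rewrite -(ler_pM2l M0); apply: le_trans sB.
  by rewrite !mulrBr mulr1 /x /g ![M * _]mulrC !divfK ?gt_eqF//; lra.
have wF0 : 0 <= wsum Phi col (Some false) W.
  by apply: sumr_ge0 => i _; rewrite subr_ge0 Phi_nd.
exists x'; split; [apply/andP; split; lra|lra|].
have gN : wsum Phi col None W <= g by rewrite PhiW in tot; lra.
have : (h' / nu * J x') * nu <= (L * wsum Phi col None W) * nu by rewrite ler_pM2r.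
have -> : h' / nu * J x' * nu = h' * J x' by field; rewrite gt_eqF.
move=> /le_trans; apply.
have -> : L * wsum Phi col None W * nu = (L * nu) * wsum Phi col None W by ring.
apply: ler_pM => //; first by rewrite mulr_ge0// ltW.
by apply: sumr_ge0 => i _; rewrite subr_ge0 Phi_nd.
Qed.

(** * The isoperimetric inequality at a fixed h *)

Section finite.
Context {R : realType}.

(** A widest pair need not exist without compactness; one within a factor 2 of the supremum is what
    [chord_dev] asks for. *)
Lemma near_max_pair (T : Type) (K : set T) (f : T -> R) (Q d : R) (z0 z1 : T) :
  (forall z, K z -> `|f z| <= Q) -> 0 < d -> K z0 -> K z1 -> d <= f z1 - f z0 ->
  exists a b, [/\ K a, K b, d <= f b - f a &
    forall y y', K y -> K y' -> f y - f y' <= 2 * (f b - f a)].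
Proof.
move=> KQ d0 Kz0 Kz1 dz.
pose P := [set r | exists y y', [/\ K y, K y' & r = f y - f y']].
have P0 : P !=set0 by exists (f z1 - f z0), z1, z0.
have uP : has_ubound P.
  exists (Q + Q) => _ [y [y' [Ky Ky' ->]]].
  have := KQ _ Ky; have := KQ _ Ky'; rewrite !ler_norml; lra.
have sP : d <= sup P by apply: le_trans dz _; apply: ub_le_sup => //; exists z1, z0.
have leSup y y' : K y -> K y' -> f y - f y' <= sup P.
  by move=> Ky Ky'; apply: ub_le_sup => //; exists y, y'.
have [h|h] := leP (sup P) (2 * (f z1 - f z0)).
  exists z0, z1; split => // y y' Ky Ky'; exact: le_trans (leSup _ _ Ky Ky') h.
have s0 : 0 < sup P / 2 by rewrite divr_gt0//; lra.
have [_ [b [a [Kb Ka ->]]] hr] := sup_adherent s0 (conj P0 uP).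
exists a, b; split => //; first by lra.
by move=> y y' Ky Ky'; have := leSup _ _ Ky Ky'; lra.
Qed.

(** nu is the length of the chord per unit of coordinate k. A difference z - z' is a multiple of b -
    a up to a vector with coordinates at most 2 d. *)
Lemma norm_vsub_affine n (N : n.-tuple R -> R) (k : 'I_n) (K : set (n.-tuple R)) (a b : n.-tuple R) (d : R) :
  is_norm N -> tnth a k < tnth b k -> 0 <= d ->
  (forall j z, K z -> `|tnth z j - tnth a j - (tnth z k - tnth a k) / (tnth b k - tnth a k) * (tnth b j - tnth a j)| <= d) ->
  let nu := N (vsub b a) / (tnth b k - tnth a k) in
  [/\ 0 < nu,
   (forall z z', K z -> K z' -> N (vsub z z') <= `|tnth z k - tnth z' k| * nu + norm_cst N * (2 * d)) &
   (forall z z', K z -> K z' -> `|tnth z k - tnth z' k| * nu <= N (vsub z z') + norm_cst N * (2 * d))].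
Proof.
move=> hN ab d0 hd nu; have [N0 Nz NZ ND] := hN.
have l0 : 0 < tnth b k - tnth a k by rewrite subr_gt0.
have nu0 : 0 < nu.
  rewrite divr_gt0// lt_neqAle N0 andbT eq_sym; apply/eqP => /Nz /(_ k).
  by rewrite !tnth_mktuple => /eqP; rewrite gt_eqF.
pose r z := (tnth z k - tnth a k) / (tnth b k - tnth a k).
have rB z z' : r z - r z' = (tnth z k - tnth z' k) / (tnth b k - tnth a k).
  by rewrite /r -mulrBl; congr (_ / _); ring.
have Nr z z' : N (vscale (r z - r z') (vsub b a)) = `|tnth z k - tnth z' k| * nu.
  by rewrite NZ rB normrM normfV (gtr0_norm l0) /nu; ring.
pose e z z' := vsub (vsub z z') (vscale (r z - r z') (vsub b a)).
have eN z z' : K z -> K z' -> N (e z z') <= norm_cst N * (2 * d).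
  move=> Kz Kz'; apply: norm_le_coord => // j.
  have h1 := hd j z Kz; have h2 := hd j z' Kz'; rewrite !tnth_mktuple.
  rewrite -!/(r _) in h1 h2.
  have -> : tnth z j - tnth z' j - (r z - r z') * (tnth b j - tnth a j) =
    (tnth z j - tnth a j - r z * (tnth b j - tnth a j)) - (tnth z' j - tnth a j - r z' * (tnth b j - tnth a j)) by ring.
  by apply: le_trans (ler_normB _ _) _; lra.
split => // z z' Kz Kz'.
  have -> : vsub z z' = vadd (vscale (r z - r z') (vsub b a)) (e z z').
    by apply: eq_from_tnth => j; rewrite !tnth_mktuple; ring.
  by apply: le_trans (ND _ _) _; rewrite Nr lerD2l eN.
rewrite -Nr.
have -> : vscale (r z - r z') (vsub b a) = vadd (vsub z z') (vscale (-1) (e z z')).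
  by apply: eq_from_tnth => j; rewrite !tnth_mktuple; ring.
by apply: le_trans (ND _ _) _; rewrite NZ normrN1 mul1r lerD2l eN.
Qed.

(** The final piece K' may also be short in every coordinate. It meets S, so it is then contained in
    S and B, which forces x + c > 1 and contradicts J 1 = 0 < j. Otherwise K' is long in some
    coordinate k and [needle] contradicts the choice of e. *)
Lemma finite_isoperimetry n (lam : {measure set (n.-tuple R) -> \bar R}) (F : n.-tuple R -> R)
    (N : n.-tuple R -> R) (K S B : set (n.-tuple R)) (c0 Q h D j c : R) :
  is_lebesgue lam -> is_norm N -> measurable_fun setT F -> logconcave_density F ->
  (forall x, F x <= c0) -> (dmeasure lam F setT < +oo)%E ->
  measurable K -> is_convex_set K -> (forall x i, K x -> `|tnth x i| <= Q) ->
  (forall a b, K a -> K b -> N (vsub a b) <= D) ->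
  measurable S -> S `<=` K -> measurable B -> nbhd_set N S h `\` S `<=` B ->
  0 < h -> 0 < c -> 0 < j -> D * c < h * j ->
  let x := mass lam F S / mass lam F K in
  0 < mass lam F S ->
  (forall x', x <= x' <= x + c -> x' <= 1 -> j <= J x') ->
  c * mass lam F K <= mass lam F B.
Proof.
move=> hl hN mF lcF Fc iF mK cK KQ KD mS SK mB SB h0 c00 j0 Dc x S0 hJ.
have [F0 _] := lcF; have [N0 Nz NZ ND] := hN.
have SKm : mass lam F S <= mass lam F K by exact: mass_le.
have K0 : 0 < mass lam F K by exact: lt_le_trans SKm.
rewrite leNgt; apply/negP => hB.
have xS : mass lam F S = x * mass lam F K by rewrite divfK// gt_eqF.
have x0 : 0 < x by rewrite divr_gt0.
have bK : bad_piece lam F S B x c K.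
  split => //; first by rewrite setIidl.
  by apply: le_lt_trans hB; apply: mass_le => //; exact: measurableI.
have [s0 Ss0] : S !=set0.
  by apply/set0P/eqP => S00; move: S0; rewrite S00 mass_null ?ltxx.
have D0 : 0 <= D by apply: le_trans (KD _ _ (SK _ Ss0) (SK _ Ss0)); exact: N0.
(* e is the slack left for the thickness of the needle *)
have [e [e0 eh eDc]] : exists e, [/\ 0 < e, 2 * e < h & (D + e) * c < (h - 2 * e) * j].
  have cj : 0 < c + 2 * j by lra.
  exists (Num.min (h / 4) ((h * j - D * c) / (2 * (c + 2 * j)))); split.
  - by rewrite lt_min !divr_gt0//; lra.
  - have : Num.min (h / 4) ((h * j - D * c) / (2 * (c + 2 * j))) <= h / 4 by rewrite ge_min lexx.
    lra.
  - set e := Num.min _ _.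
    have : e <= (h * j - D * c) / (2 * (c + 2 * j)) by rewrite ge_min lexx orbT.
    rewrite ler_pdivlMr; last by lra.
    lra.
have Cn := norm_cst_ge0 hN.
(* Vectors with coordinates at most 8 d have norm at most e. This covers the threshold for a short
   piece as well as twice the error 4 d of [chord_dev]. *)
pose d := e / (8 * (norm_cst N + 1)).
have d0 : 0 < d by rewrite divr_gt0//; lra.
have dC : norm_cst N * (8 * d) <= e.
  have : e = d * (8 * (norm_cst N + 1)) by rewrite divfK// gt_eqF//; lra.
  by move=> E; lra.
pose Q' := Num.max Q 0.
have KQ' z i : K z -> `|tnth z i| <= Q' by move=> Kz; rewrite le_max KQ.
have Q'0 : 0 <= Q' by rewrite le_max lexx orbT.
have [G hG] := grid_exists d0 Q'0.
pose l := [seq (ij, p) | ij <- [seq ij <- enum (predT : pred ('I_n * 'I_n)) | ij.1 != ij.2], p <- [seq (p, q) | p <- G, q <- G]].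
pose l' := [seq (u.1, u.2.1, u.2.2) | u <- l].
have [|K' [K'K bK' hK']] := cut_seq hl mF F0 iF mS mB (s := l') _ bK.
  move=> u /mapP[[[i i'] [p q]] /allpairsP[[[a1 a2] [b1 b2]]]] /= [].
  by rewrite mem_filter /= => /andP[h1 _] _ [-> -> _ _] ->.
have os k i g g' : i != k -> g \in G -> g' \in G -> one_sided K' k i g g'.
  move=> ik gG g'G; apply: (hK' (k, i, g, g')).
  apply/mapP; exists ((k, i), (g, g')) => //.
  apply/allpairsP; exists ((k, i), (g, g')); split => //=.
    by rewrite mem_filter /= eq_sym ik mem_enum.
  by apply/allpairsP; exists (g, g').
have [mK' cK' SK' BK'] := bK'.
have K'0 : 0 < mass lam F K'.
  have := mass_ge0 lam F0 (B `&` K') => h1; rewrite -(pmulr_rgt0 _ c00).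
  exact: le_lt_trans BK'.
have sep s y : S s -> K' s -> K' y -> ~ S y -> ~ B y -> h < N (vsub y s).
  move=> Ss Ks Ky nS nB; rewrite ltNge; apply/negP => hle; apply: nB; apply: SB; split => //.
  by exists s.
have [[k [z0 [z1 [Kz0 Kz1 z01]]]]|small] :=
    pselect (exists k z0 z1, [/\ K' z0, K' z1 & 8 * d <= tnth z1 k - tnth z0 k]); last first.
  have [s [Ss K's]] : S `&` K' !=set0.
    apply/set0P/eqP => E; have := SK'; rewrite E mass_null// => /esym/eqP.
    by rewrite mulf_eq0 !gt_eqF.
  have K'SB : K' `<=` (S `&` K') `|` (B `&` K').
    move=> y K'y; have [Sy|nS] := pselect (S y); first by left.
    have [By|nB] := pselect (B y); first by right.
    have := sep s y Ss K's K'y nS nB; rewrite ltNge => /negP; case.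
    apply: (@le_trans _ _ (norm_cst N * (8 * d))); last by lra.
    apply: norm_le_coord => // i; rewrite !tnth_mktuple ltW// ltNge; apply/negP.
    have [yz|yz] := leP (tnth y i) (tnth s i).
      rewrite ler0_norm ?subr_le0// opprB => hh; apply: small; exists i, y, s; split => //.
    rewrite gtr0_norm ?subr_gt0// => hh; apply: small; exists i, s, y; split => //.
  have mSK' := measurableI _ _ mS mK'; have mBK' := measurableI _ _ mB mK'.
  have : mass lam F K' <= mass lam F (S `&` K') + mass lam F (B `&` K').
    by apply: le_trans (mass_setU_le mF F0 iF mSK' mBK'); apply: mass_le => //; exact: measurableU.
  rewrite SK' => hle.
  have xc : 1 < x + c.
    by rewrite -(ltr_pM2r K'0) mul1r; apply: le_lt_trans hle _; rewrite mulrDl ltrD2l.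
  have x1 : x <= 1 by rewrite ler_pdivrMr// mul1r.
  by have := hJ 1; rewrite x1 (ltW xc) lexx J1 => /(_ isT isT); rewrite leNgt j0.
have K'Q z i : K' z -> `|tnth z i| <= Q' by move=> /K'K; exact: KQ'.
have d8 : 0 < 8 * d by lra.
have [a [b [Ka Kb ab spr]]] := near_max_pair (f := fun z : n.-tuple R => tnth z k) (fun z => @K'Q z k) d8 Kz0 Kz1 z01.
have ab' : tnth a k < tnth b k by lra.
have dev i z : K' z ->
    `|tnth z i - tnth a i - (tnth z k - tnth a k) / (tnth b k - tnth a k) * (tnth b i - tnth a i)| <= 4 * d.
  move=> Kz; have [->|ik] := eqVneq i k.
    by rewrite divfK ?subrr ?normr0; [lra|rewrite gt_eqF// subr_gt0].
  exact: (chord_dev d0 cK' K'Q hG (fun i g g' => @os k i g g')).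
have d4 : 0 <= 4 * d by lra.
have [nu0 nu1 nu2] := norm_vsub_affine hN ab' d4 dev.
set nu := _ / _ in nu0 nu1 nu2.
have e8 : norm_cst N * (2 * (4 * d)) <= e by rewrite mulrA (_ : 2 * 4 = 8)//; lra.
have hne : 0 < h - 2 * e by lra.
have hne' : 0 < h - 2 * e < h - e by lra.
have [|||x' [x'1 x'2 hx']] := @needle R n lam F N K' S B k c0 Q' h e nu (D + e) (h - 2 * e)
   hl mF lcF Fc iF mK' cK' Q'0 K'Q mS mB K'0 sep nu0 _ _ _ hne'.
- by move=> z z' Kz Kz'; apply: le_trans (nu1 _ _ Kz Kz') _; rewrite lerD2l.
- move=> z z' Kz Kz'; apply: le_trans (nu2 _ _ Kz Kz') _; apply: lerD => //.
  by apply: KD; exact: K'K.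
- by exists a, b.
rewrite SK' mulfK ?gt_eqF// in x'1.
have gc : mass lam F (B `&` K') / mass lam F K' < c by rewrite ltr_pdivrMr.
have jx : j <= J x' by apply: hJ => //; move: x'1; lra.
have : (h - 2 * e) * j <= (h - 2 * e) * J x' by rewrite ler_pM2l.
have : (D + e) * (mass lam F (B `&` K') / mass lam F K') <= (D + e) * c.
  by rewrite ler_wpM2l ?(ltW gc)//; lra.
lra.
Qed.

End finite.

(** * The lower bound *)

Section closed_sets.
Context {R : realType} (n : nat).

Definition cell (k : nat) (z : n.-tuple int) : set (n.-tuple R) :=
  [set x | forall i, (tnth z i)%:~R <= k.+1%:R * tnth x i < (tnth z i)%:~R + 1].

Lemma measurable_cell k z : measurable (cell k z).
Proof.
rewrite (_ : cell k z = \bigcap_(i in [set: 'I_n])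
  ([set x | (tnth z i)%:~R <= k.+1%:R * tnth x i] `&` [set x | k.+1%:R * tnth x i < (tnth z i)%:~R + 1])).
  apply: fin_bigcap_measurable => // i _.
  have mk : measurable_fun setT (fun x : n.-tuple R => k.+1%:R * tnth x i).
    by apply: measurable_funM => //; exact: measurable_tnth.
  by apply: measurableI; [exact: measurable_set_le|exact: measurable_set_lt].
apply/seteqP; split => x /= h i; first by move=> _; have /andP[] := h i.
by have [/= h1 h2] := h i I; rewrite h1 h2.
Qed.

(** K is the intersection over k of the union of the cells of side 1 / (k + 1) that meet it: a point
    in all these unions is a limit of points of K. Integer vectors are enumerated by [pickle], and
    codes without a useful cell contribute the empty set. *)
Lemma measurable_closed (K : set (n.-tuple R)) : is_closed_set K -> measurable K.
Proof.
move=> cK.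
pose C k a := if unpickle a is Some z then
  (if pselect (cell k z `&` K !=set0) then cell k z else set0) else set0.
have mC k a : measurable (C k a).
  rewrite /C; case: unpickle => [z|//].
  by case: (pselect _) => h //=; exact: measurable_cell.
rewrite (_ : K = \bigcap_k \bigcup_a C k a).
  by apply: bigcapT_measurable => k; exact: bigcupT_measurable.
apply/seteqP; split => x.
  move=> Kx k _; pose z := [tuple Num.floor (k.+1%:R * tnth x i) | i < n].
  exists (pickle z) => //; rewrite /C pickleK.
  have xz : cell k z x
    by move=> i; rewrite tnth_mktuple; have := floor_itv (k.+1%:R * tnth x i); rewrite intrD; apply.
  by case: (pselect _) => //= h; exfalso; apply: h; exists x.
move=> hx.
have approx k : exists u, K u /\ forall i, `|tnth u i - tnth x i| <= k.+1%:R^-1.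
  have [a _] := hx k I; rewrite /C; case: unpickle => [z|//].
  case: (pselect _) => //= -[u [zu Ku]] zx; exists u; split => // i.
  have := zu i; have := zx i => /andP[h1 h2] /andP[h3 h4].
  have k0 : 0 < k.+1%:R :> R by rewrite ltr0n.
  rewrite -div1r ler_pdivlMr// -[X in _ * X](gtr0_norm k0) -normrM mulrBl ler_norml ![_ * k.+1%:R]mulrC.
  by apply/andP; split; lra.
have [u hu] := choice approx.
apply: (cK u) => [k|i]; first by have [] := hu k.
apply/cvgrPdist_le => e e0; near=> k.
have [_ /(_ i)] := hu k; rewrite distrC => /le_trans; apply.
rewrite -[e]invrK lef_pV2 ?posrE ?invr_gt0 ?ltr0n//.
near: k; exists (Num.truncn e^-1) => // k /= hk.
by apply: ltW; rewrite -truncn_le_nat.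
Unshelve. all: end_near. Qed.
End closed_sets.

Section truncation.
Context {R : realType} (n : nat) (lam : {measure set (n.-tuple R) -> \bar R}).
Variable F : n.-tuple R -> R.

(** Bounded, log-concave and increasing to F, as [finite_isoperimetry] asks for a bounded
    density. *)
Definition ftrunc (m : nat) (x : n.-tuple R) : R := Num.min (F x) m.+1%:R.

Lemma measurable_ftrunc m : measurable_fun setT F -> measurable_fun setT (ftrunc m).
Proof. by move=> mF; apply: measurable_minr. Qed.

Lemma logconcave_ftrunc m : logconcave_density F -> logconcave_density (ftrunc m).
Proof.
move=> [F0 Fc]; split => [x|x y t t01]; first by rewrite le_min F0/=.
have /andP[t0 t1] := t01; have t1' : 0 <= 1 - t by rewrite subr_ge0.
have m0 : 0 <= m.+1%:R :> R by [].
have T0 z : 0 <= ftrunc m z by rewrite le_min F0/=.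
rewrite le_min; apply/andP; split.
  apply: le_trans (Fc _ _ _ t01); apply: ler_pM; rewrite ?powR_ge0//.
    by apply: ge0_ler_powR; rewrite ?nnegrE// ge_min lexx.
  by apply: ge0_ler_powR; rewrite ?nnegrE// ge_min lexx.
have -> : m.+1%:R = m.+1%:R `^ t * m.+1%:R `^ (1 - t) :> R.
  by rewrite -powRD ?subrKC ?powRr1// oner_eq0.
by apply: ler_pM; rewrite ?powR_ge0//; apply: ge0_ler_powR; rewrite ?nnegrE ?ge_min ?lexx ?orbT.
Qed.

Lemma mass_ftrunc_le m A : measurable_fun setT F -> (forall x, 0 <= F x) ->
  (dmeasure lam F setT < +oo)%E -> measurable A ->
  (dmeasure lam (ftrunc m) A <= dmeasure lam F A)%E.
Proof.
move=> mF F0 iF mA; apply: ge0_le_integral => //.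
- by move=> x _; rewrite lee_fin le_min F0/=.
- by apply: measurable_funTS; apply/measurable_EFinP; exact: measurable_ftrunc.
- by apply: measurable_funTS; apply/measurable_EFinP.
- by move=> x _; rewrite lee_fin ge_min lexx.
Qed.

Lemma mass_ftrunc_cvg A : measurable_fun setT F -> (forall x, 0 <= F x) ->
  (dmeasure lam F setT < +oo)%E -> measurable A ->
  mass lam (ftrunc m) A @[m --> \oo] --> mass lam F A.
Proof.
move=> mF F0 iF mA; apply: fine_cvg; rewrite -massE//.
have -> : dmeasure lam F A = (\int[lam]_(x in A) limn (fun m => (ftrunc m x)%:E))%E.
  apply: eq_integral => x _; apply/esym/cvg_lim => //.
  apply: cvg_near_cst; exists (Num.truncn (F x)) => // m /= hm; congr EFin.
  rewrite /ftrunc min_l//; apply: le_trans (ltW (truncnS_gt _)) _.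
  by rewrite ler_nat.
apply: cvg_monotone_convergence => //.
- by move=> m; apply: measurable_funTS; apply/measurable_EFinP; exact: measurable_ftrunc.
- by move=> m x _; rewrite lee_fin le_min F0/=.
- move=> x _ p q pq; rewrite lee_fin /ftrunc le_min ge_min lexx/= ge_min ler_nat ltnS pq orbT//.
Qed.
End truncation.

(** * From a fixed h to the Minkowski content *)

Section isoperimetry.
Context {R : realType} (n : nat) (N : n.-tuple R -> R)
  (lam : {measure set (n.-tuple R) -> \bar R}) (F : n.-tuple R -> R) (K S : set (n.-tuple R)).
Hypotheses (hN : is_norm N) (hl : is_lebesgue lam) (bK : convex_body K)
  (lF : logconcave_prob_on lam F K) (mS : measurable S) (SK : S `<=` K).

(** To the left of x, J y >= (y / x) J x by [J_scale]; [J_right] is the mirror image. The radius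
    lets J lose at most the factor rho = j / J x. *)
Lemma J_near (x : R) (j : R) : 0 < x < 1 -> 0 < j < J x -> exists2 e, 0 < e &
  forall y, `|y - x| <= e -> y <= 1 -> j <= J y.
Proof.
move=> /andP[x0 x1] /andP[j0 jJ].
have J0' : 0 < J x by exact: lt_trans jJ.
pose rho := j / J x.
have rho0 : 0 < rho by rewrite divr_gt0.
have rho1 : rho < 1 by rewrite ltr_pdivrMr// mul1r.
have rJ : rho * J x = j by rewrite divfK// gt_eqF.
exists ((1 - rho) * Num.min x (1 - x)).
  by rewrite mulr_gt0 ?subr_gt0// lt_min x0 subr_gt0.
move=> y; rewrite ler_norml => /andP[y1 y2] y01.
have mx : Num.min x (1 - x) <= x by rewrite ge_min lexx.
have m1x : Num.min x (1 - x) <= 1 - x by rewrite ge_min lexx orbT.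
have a1 : (1 - rho) * Num.min x (1 - x) <= (1 - rho) * x by rewrite ler_wpM2l// subr_ge0 ltW.
have a2 : (1 - rho) * Num.min x (1 - x) <= (1 - rho) * (1 - x) by rewrite ler_wpM2l// subr_ge0 ltW.
rewrite -rJ; have [xy|yx] := leP x y.
  apply: le_trans (J_right (ltW x0) x1 _); last by rewrite xy y01.
  rewrite ler_pM2r// ler_pdivlMr ?subr_gt0//; lra.
have y0 : 0 <= y / x by rewrite divr_ge0 ?(ltW x0)//; have : 0 < rho * x := mulr_gt0 rho0 x0; lra.
have := J_scale (u := y / x) (z := x); rewrite divfK ?gt_eqF// => h.
apply: le_trans (h _ _); last by rewrite (ltW x0) (ltW x1).
  by rewrite ler_pM2r// ler_pdivlMr//; lra.
by rewrite y0 ler_pdivrMr// mul1r ltW.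
Qed.

Lemma isoperimetry_J (l : \bar R) :
  (0 < dmeasure lam F S)%E -> (dmeasure lam F S <= (1 / 2)%:E)%E ->
  minkowski_content_is N lam F S l ->
  ((J (fine (dmeasure lam F S)))%:E <= diam N K * l)%E.
Proof.
move=> S0 S12 hlim.
have [mF lcF F1 FK] := lF; have [F0 _] := lcF.
have [clK [M bM] cK] := bK.
have [N0 Nz NZ ND] := hN.
have mK := measurable_closed clK.
have iF : (dmeasure lam F setT < +oo)%E by rewrite F1 ltry.
pose x := mass lam F S; rewrite -[fine _]/x.
have Sx : dmeasure lam F S = x%:E by exact: massE.
have x0 : 0 < x by rewrite -lte_fin -Sx.
have x12 : x <= 1 / 2 by rewrite -lee_fin -Sx.
have mT : mass lam F setT = 1 by rewrite /mass F1.
have mK1 : mass lam F K = 1.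
  have := massD mF F0 iF measurableT mK.
  by rewrite mT setTI setTD /(mass _ _ (~` K)) FK addr0 => <-.
have Sne : S !=set0.
  by apply/set0P/eqP => E; move: x0; rewrite /x E mass_null ?ltxx.
have [s0 Ss0] := Sne.
have dub : (diam N K <= (norm_cst N * (M + M))%:E)%E.
  apply: ge_ereal_sup => _ [a [b [Ka Kb ->]]]; rewrite lee_fin.
  apply: norm_le_coord => // i; rewrite tnth_mktuple.
  by apply: le_trans (ler_normB _ _) _; apply: lerD; exact: bM.
have dlb : (0 <= diam N K)%E.
  apply: (@le_trans _ _ (N (vsub s0 s0))%:E); first by rewrite lee_fin.
  by apply: ereal_sup_ubound; exists s0, s0; split => //; exact: SK.
have [D DE] : exists D, diam N K = D%:E.
  exists (fine (diam N K)); rewrite fineK// ge0_fin_numE//.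
  exact: le_lt_trans dub (ltry _).
have KD a b : K a -> K b -> N (vsub a b) <= D.
  by move=> Ka Kb; rewrite -lee_fin -DE; apply: ereal_sup_ubound; exists a, b.
rewrite DE in dlb *; rewrite lee_fin in dlb.
(* With D = 0, K would be the single point s0 of S and S would have mass 1. Positivity also settles
   l = +oo, where the product 0 * l would be 0. *)
have D0 : 0 < D.
  rewrite lt_neqAle dlb andbT; apply/eqP => D00.
  have KS : K `<=` S.
    move=> a Ka; rewrite (_ : a = s0)//; apply: eq_from_tnth => i.
    have : N (vsub a s0) = 0 by apply/eqP; rewrite eq_le N0 andbT D00; apply: KD => //; exact: SK.
    by move=> /Nz /(_ i); rewrite tnth_mktuple => /eqP; rewrite subr_eq0 => /eqP.
  have : mass lam F K <= x by exact: mass_le.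
  by rewrite mK1; lra.
have out0 h : (0 <= dmeasure_out lam F (nbhd_set N S h `\` S))%E.
  by apply: le_ereal_inf_tmp => _ [B _ <-]; exact: dmeasure_ge0.
have l0 : (0 <= l)%E.
  apply: cvge_ge hlim; near=> h; rewrite mule_ge0// lee_fin invr_ge0.
  by near: h; exact: nbhs_right_ge.
case: l l0 hlim => [r|_ _|//]; last by rewrite gt0_muley ?leey// lte_fin.
rewrite lee_fin -EFinM lee_fin => r0 hlim; rewrite leNgt; apply/negP => Dr.
pose j := (D * r + J x) / 2.
have Dr0 : 0 <= D * r by rewrite mulr_ge0.
have j1 : D * r < j by rewrite /j; lra.
have j2 : 0 < j < J x by rewrite /j; apply/andP; split; lra.
have x01 : 0 < x < 1 by apply/andP; split; lra.
have [e e0 he] := J_near x01 j2.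
pose r' := (r + j / D) / 2.
have rj : r < j / D by rewrite ltr_pdivlMr// mulrC.
have rr' : r < r' by rewrite /r'; lra.
have r'0 : 0 < r' by lra.
have Dr' : D * r' < j.
  have : r' < j / D by rewrite /r'; lra.
  by rewrite ltr_pdivlMr// mulrC.
have ev : \forall h \near (0 : R)^'+,
   (dmeasure_out lam F (nbhd_set N S h `\` S) * (h^-1)%:E < r'%:E)%E.
  have := hlim [set y | (y < r'%:E)%E]; apply.
  by apply: open_nbhs_nbhs; split; [exact: open_ereal_lt_ereal|rewrite /= lte_fin].
(* Half of e is for c = r' h, the other half for the shift of the proportion of S under
   truncation. *)
have er0 : 0 < e / (2 * r') by rewrite divr_gt0// mulr_gt0.
have [h [[h0 he'] hev]] : exists h, (0 < h /\ h < e / (2 * r')) /\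
   (dmeasure_out lam F (nbhd_set N S h `\` S) * (h^-1)%:E < r'%:E)%E.
  apply: (@filter_ex _ ((0 : R)^'+)); near=> h; split; last by near: h.
  by split; near: h; [exact: nbhs_right_gt|exact: nbhs_right_lt].
pose c := r' * h.
have c0 : 0 < c by rewrite mulr_gt0.
have ce : c <= e / 2.
  move: he'; rewrite ltr_pdivlMr ?mulr_gt0// /c; lra.
have outc : (dmeasure_out lam F (nbhd_set N S h `\` S) < c%:E)%E.
  by rewrite /c EFinM -lte_pdivrMr.
have [_ [B [mB SB] <-] Bc] := ereal_inf_lt outc.
rewrite (massE mF F0 iF mB) lte_fin in Bc.
have cvS := mass_ftrunc_cvg (lam := lam) mF F0 iF mS.
have cvK := mass_ftrunc_cvg (lam := lam) mF F0 iF mK.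
have cvx : mass lam (ftrunc F m) S / mass lam (ftrunc F m) K @[m --> \oo] --> x.
  rewrite -[x in _ --> x]divr1 -mK1; apply: cvgM => //.
  by apply: cvgV => //; rewrite mK1 oner_eq0.
have [m [[m1 m2] m3]] : exists m, (`|x - mass lam (ftrunc F m) S / mass lam (ftrunc F m) K| <= e / 2 /\
    0 < mass lam (ftrunc F m) S) /\ mass lam F B / c < mass lam (ftrunc F m) K.
  apply: (@filter_ex _ (\oo : set_system nat)); near=> m; split; first split; near: m.
  - by move/cvgrPdist_le : cvx; apply; rewrite divr_gt0.
  - exact: (cvgr_gt _ cvS).
  - by apply: (cvgr_gt _ cvK); rewrite mK1 ltr_pdivrMr// mul1r.
have iFm : (dmeasure lam (ftrunc F m) setT < +oo)%E.
  by apply: (le_lt_trans _ iF); exact: mass_ftrunc_le.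
suff : c * mass lam (ftrunc F m) K <= mass lam (ftrunc F m) B.
  apply/negP; rewrite -ltNge.
  have : mass lam (ftrunc F m) B <= mass lam F B.
    rewrite -lee_fin -massE//; last by move=> z; rewrite le_min F0/=.
      by rewrite -massE//; exact: mass_ftrunc_le.
    exact: measurable_ftrunc.
  move=> /le_lt_trans; apply.
  by rewrite mulrC -ltr_pdivrMr.
apply: (@finite_isoperimetry R n lam (ftrunc F m) N K S B m.+1%:R M h D j c hl hN
  (measurable_ftrunc m mF) (logconcave_ftrunc m lcF) _ iFm mK cK _ KD mS SK mB SB h0 c0 _ _ m2).
- by move=> z; rewrite ge_min lexx orbT.
- by move=> z i Kz; exact: bM.
- by case/andP: j2.
- by rewrite /c mulrA [h * j]mulrC ltr_pM2r.
- move=> x' /andP[y1 y2] y3; apply: he => //.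
  by move: m1; rewrite !ler_norml => /andP[m1 m1']; apply/andP; split; lra.
Unshelve. all: end_near. Qed.

End isoperimetry.

(** * The function G *)

Section extremal.
Context {R : realType}.
Implicit Types g x y : R.

Lemma le_of_deriv (f df : R -> R) (a b : R) : a <= b ->
  (forall y, a <= y <= b -> is_derive y 1 f (df y)) ->
  (forall y, a < y < b -> 0 <= df y) -> f a <= f b.
Proof.
rewrite le_eqVlt => /predU1P[->//|ab] hf hdf.
have hf' y : y \in `]a, b[ -> is_derive y 1 f (df y).
  by rewrite in_itv/= => /andP[/ltW h1 /ltW h2]; apply: hf; rewrite h1.
have [|c cab E] := MVT ab hf'.
  apply: derivable_within_continuous => y; rewrite in_itv/= => /hf h.
  exact: (@ex_derive _ _ _ _ _ _ _ h).
rewrite -subr_ge0 E mulr_ge0 ?subr_ge0 ?(ltW ab)//; apply: hdf.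
by move: cab; rewrite in_itv.
Qed.

(** Equivalent to tanh (g / 2) <= g / 2. It gives the sign of the derivative of [phiG], and the
    value of J at 1 / 2. *)
Lemma coth_ineq g : 0 <= g -> expR g * (2 - g) <= 2 + g.
Proof.
move=> g0.
have d (y : R) : is_derive y 1 (fun y => (2 + y) - expR y * (2 - y)) (1 - expR y * (1 - y)).
  by apply: is_derive_eq; rewrite /GRing.scale/=; ring.
have := le_of_deriv g0 (fun y _ => d y) _.
rewrite expR0 mul1r subr0 addr0 subrr subr_ge0; apply => y _.
rewrite subr_ge0 -(ler_pM2l (expR_gt0 (- y))) mulrA -expRD addNr expR0 mul1r mulr1.
by have := expR_ge1Dx (- y); rewrite addrC => h; lra.
Qed.

Definition phiA g : R := expR g * (g - 1) + 1.

Lemma phiA_ge g : 0 <= g -> g ^+ 2 / 2 <= phiA g.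
Proof.
move=> g0.
have d (y : R) : is_derive y 1 (fun y => phiA y - y ^+ 2 / 2) (y * (expR y - 1)).
  by apply: is_derive_eq; rewrite /GRing.scale/=; field.
have := le_of_deriv g0 (fun y _ => d y) _.
rewrite /phiA expR0 mul1r sub0r addNr expr0n /= mul0r subrr subr_ge0; apply.
by move=> y /andP[y0 _]; rewrite mulr_ge0 ?(ltW y0)// subr_ge0 -expR0 ler_expR ltW.
Qed.

Lemma expRB1_gt0 g : 0 < g -> 0 < expR g - 1.
Proof. by move=> g0; rewrite subr_gt0 expR_gt1. Qed.

Lemma is_derive_inv (f : R -> R) (y df : R) : f y != 0 -> is_derive y 1 f df ->
  is_derive y 1 (fun z => (f z)^-1) (- df / f y ^+ 2).
Proof.
move=> fy hf; have df1 := @ex_derive _ _ _ _ _ _ _ hf.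
apply: DeriveDef; first exact: derivableV.
by rewrite deriveV// (@derive_val _ _ _ _ _ _ _ hf) /GRing.scale/= mulNr mulrC mulNr.
Qed.

Lemma is_derive_phiG (y : R) : 0 < y ->
  is_derive y 1 (@phiG R) (expR y * (expR y * (2 - y) - (2 + y)) / (expR y - 1) ^+ 3).
Proof.
move=> y0; have e1 : expR y - 1 != 0 by rewrite gt_eqF// expRB1_gt0.
have e2 : (expR y - 1) ^+ 2 != 0 by rewrite expf_neq0.
have d2 : is_derive y 1 (fun z : R => (expR z - 1) ^+ 2) (2 * (expR y - 1) * expR y).
  by apply: is_derive_eq; rewrite /GRing.scale/=; ring.
have dV := @is_derive_inv (fun z : R => (expR z - 1) ^+ 2) y _ e2 d2.
have dA : is_derive y 1 phiA (y * expR y).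
  by apply: is_derive_eq; rewrite /GRing.scale/=; ring.
have := is_deriveM dA dV => dM.
apply: is_derive_eq; rewrite /GRing.scale/= /phiA; field.
exact: e1.
Qed.

Lemma phiG_nonincr g y : 0 < g -> g <= y -> phiG y <= phiG g.
Proof.
move=> g0 gy; rewrite -lerN2.
have d z : g <= z <= y -> is_derive z 1 (fun z => - phiG z)
     (- (expR z * (expR z * (2 - z) - (2 + z)) / (expR z - 1) ^+ 3)).
  move=> /andP[gz _]; have z0 : 0 < z by exact: lt_le_trans gz.
  have := is_derive_phiG z0 => dz; by apply: is_derive_eq.
apply: (le_of_deriv gy d) => z /andP[gz _].
have z0 : 0 < z by exact: lt_trans gz.
rewrite -mulNr divr_ge0//; last by rewrite exprn_ge0// ltW// expRB1_gt0.
rewrite -mulrN mulr_ge0 ?expR_ge0// opprB subr_ge0.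
exact: coth_ineq (ltW z0).
Qed.

(** The derivative of psi is - [phiG], so the equation that defines G is the critical point equation
    of g x + psi g. *)
Lemma is_derive_affine_psi (x y : R) : 0 < y ->
  is_derive y 1 (fun g => g * x + g / (expR g - 1)) (x - phiG y).
Proof.
move=> y0; have e1 : expR y - 1 != 0 by rewrite gt_eqF// expRB1_gt0.
have d1 : is_derive y 1 (fun z : R => expR z - 1) (expR y).
  by apply: is_derive_eq; rewrite subr0.
have dV := @is_derive_inv (fun z : R => expR z - 1) y _ e1 d1.
have dI := @is_derive_id R R y 1.
have dM := is_deriveM dI dV.
apply: is_derive_eq; rewrite /GRing.scale/= /phiG; field.
exact: e1.
Qed.

Lemma affine_psi_min_pos (x g y : R) : 0 < g -> phiG g = x -> 0 < y ->
  g * x + psi g <= y * x + psi y.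
Proof.
move=> g0 gx y0; rewrite !psiE ?gt_eqF//.
have [gy|/ltW yg] := leP g y.
  apply: (@le_of_deriv (fun g => g * x + g / (expR g - 1)) (fun z => x - phiG z)) => // z /andP[gz _].
    by apply: is_derive_affine_psi; exact: lt_le_trans gz.
  by rewrite subr_ge0 -gx phiG_nonincr// ltW.
rewrite -lerN2.
apply: (@le_of_deriv (fun g => - (g * x + g / (expR g - 1))) (fun z => - (x - phiG z))) => // z /andP[yz zg].
  have := @is_derive_affine_psi x z (lt_le_trans y0 yz) => dz; by apply: is_derive_eq.
by rewrite opprB subr_ge0 -gx phiG_nonincr ?ltW// (lt_trans y0 yz).
Qed.

Lemma psi_le1 g : 0 < g -> psi g <= 1.
Proof.
move=> g0; rewrite psiE ?gt_eqF// ler_pdivrMr ?expRB1_gt0// mul1r.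
by have := expR_ge1Dx g; lra.
Qed.

(* Values at g > 0 determine the infimum: for x <= 1/2 the value at -g is larger than at g. *)
Lemma J_ge_pos (x j : R) : 0 < x <= 1 / 2 -> (forall g, 0 < g -> j <= g * x + psi g) -> j <= J x.
Proof.
move=> /andP[x0 x12] h; apply: J_ge => g; have [g0|g0|<-] := ltgtP 0 g; first exact: h.
  have g0' : 0 < - g by rewrite oppr_gt0.
  have := h _ g0'; rewrite psiN.
  have : 0 <= (- g) * (1 - 2 * x) by rewrite mulr_ge0 ?(ltW g0')//; lra.
  lra.
rewrite mul0r add0r psi0; apply/ler_addgt0Pr => e e0.
have ex : 0 < e / x by rewrite divr_gt0.
apply: le_trans (h _ ex) _; rewrite divfK ?gt_eqF// addrC lerD2r.
exact: psi_le1.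
Qed.

Lemma J_approx (x e : R) : 0 < x <= 1 / 2 -> 0 < e -> exists2 g, 0 < g & g * x + psi g <= J x + e.
Proof.
move=> x12 e0; apply: contrapT => h.
have : J x + e <= J x; last by lra.
apply: J_ge_pos => // g g0; rewrite leNgt; apply/negP => hg; apply: h; exists g => //.
exact: ltW.
Qed.

Lemma phiG_exists (x : R) : 0 < x < 1 / 2 -> exists g, 0 < g /\ phiG g = x.
Proof.
move=> /andP[x0 x12].
(* Chosen so that e^(-2 a) / 2 = x, a lower bound for [phiG a] by phiA a >= a^2 / 2 and e^a - 1 <= a
   e^a. *)
pose a := - ln (2 * x) / 2.
have a0 : 0 < a.
  rewrite /a mulNr oppr_gt0 pmulr_llt0//; apply: ln_lt0; apply/andP; split; lra.
have hxa : x <= phiG a.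
  have h1 := phiA_ge (ltW a0); rewrite /phiG -/(phiA a).
  have e1 := expRB1_gt0 a0.
  rewrite ler_pdivlMr ?exprn_gt0//; apply: le_trans h1.
  have h2 : expR a - 1 <= a * expR a.
    have := expR_ge1Dx (- a); rewrite -(ler_pM2l (expR_gt0 a)) -expRD subrr expR0; lra.
  have h3 : (expR a - 1) ^+ 2 <= (a * expR a) ^+ 2 by rewrite ler_pXn2r// nnegrE ?ltW// mulr_gt0// expR_gt0.
  apply: (@le_trans _ _ (x * (a * expR a) ^+ 2)); first by rewrite ler_pM2l.
  have -> : x * (a * expR a) ^+ 2 = a ^+ 2 * (x * (expR a * expR a)) by ring.
  rewrite ler_pM2l ?exprn_gt0// -expRD.
  have -> : a + a = - ln (2 * x) by rewrite /a; field.
  by rewrite expRN lnK ?posrE ?mulr_gt0// invfM mulrCA divff ?gt_eqF// mulr1.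
(* From b >= 1 follows e^b - 1 >= e^b / 2, hence phiG b <= 4 b / e^b <= 8 / b <= x. *)
pose b := a + (1 + 8 / x).
have x8 : 0 < 8 / x by rewrite divr_gt0.
have ab : a <= b by rewrite /b; lra.
have b1 : 1 <= b by rewrite /b; lra.
have b0 : 0 < b by lra.
have hxb : phiG b <= x.
  rewrite /phiG -/(phiA b) ler_pdivrMr ?exprn_gt0 ?expRB1_gt0//.
  have E1 := expR_ge1Dx b.
  have E2 : expR b / 2 <= expR b - 1 by lra.
  have E3 := @expR_ge1Dxn R b 1 (ltW b0).
  rewrite (_ : 2`!%:R = 2 :> R)// in E3.
  have h1 : phiA b <= b * expR b by rewrite /phiA; lra.
  have h2 : (expR b / 2) ^+ 2 <= (expR b - 1) ^+ 2.
    by rewrite ler_pXn2r// nnegrE ?divr_ge0 ?expR_ge0// ltW// expRB1_gt0.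
  apply: (le_trans h1); apply: (@le_trans _ _ (x * (expR b / 2) ^+ 2)); last by rewrite ler_pM2l.
  have -> : x * (expR b / 2) ^+ 2 = expR b * (x * expR b / 4) by field.
  rewrite mulrC ler_pM2l ?expR_gt0//.
  have h3 : x * (b ^+ 2 / 2) <= x * expR b by rewrite ler_pM2l//; lra.
  have xb : 8 <= x * b.
    have -> : x * b = x * a + x + 8 by rewrite /b; field; rewrite gt_eqF.
    have : 0 < x * a by rewrite mulr_gt0.
    lra.
  have : 8 * b <= x * b * b by rewrite ler_pM2r.
  by move: h3; rewrite expr2; lra.
have cont : {within `[a, b], continuous (@phiG R)}.
  apply: derivable_within_continuous => y; rewrite in_itv/= => /andP[ay _].
  exact: (@ex_derive _ _ _ _ _ _ _ (is_derive_phiG (lt_le_trans a0 ay))).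
have [|c] := IVT ab cont (v := x).
  by rewrite ge_min hxb orbT le_max hxa.
rewrite in_itv/= => /andP[ac _] hc; exists c; split => //.
exact: lt_le_trans ac.
Qed.

(** For x < 1 / 2, x G(1/x) is g x + psi g at the critical point, after substituting x = phiG g. At
    x = 1 / 2 the infimum is attained at g = 0 and equals 1, hence the separate value G(2) = 2. *)
Lemma Gfun_J (x : R) : 0 < x <= 1 / 2 -> x * Gfun x^-1 = J x.
Proof.
move=> x12; have /andP[x0 x1] := x12; rewrite /Gfun.
have [E|xn] := eqVneq x^-1 2.
  have xE : x = 1 / 2 by rewrite -[x]invrK E div1r.
  have -> : x * 2 = 1 by rewrite xE; field.
  apply/eqP; rewrite eq_le; apply/andP; split; last first.
    by apply: le_trans (J_le 0 _) _; rewrite ?mul0r ?add0r ?psi0//; apply/andP; split; lra.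
  apply: J_ge_pos => // g g0; rewrite psiE ?gt_eqF// xE.
  have e0 := expRB1_gt0 g0; rewrite -lerBlDl ler_pdivlMr//.
  have := coth_ineq (ltW g0); lra.
have x12' : 0 < x < 1 / 2.
  rewrite x0 lt_neqAle x1 andbT; apply: contra xn => /eqP ->.
  by rewrite div1r invrK.
have ex := phiG_exists x12'.
set g := xget _ _.
have [g0 gx] : 0 < g /\ phiG g = x.
  have := @xgetPex _ 0 [set g : R | 0 < g /\ phiG g = x^-1^-1]; rewrite invrK => /(_ ex).
  by rewrite /g invrK.
have e1 : expR g - 1 != 0 by rewrite gt_eqF// expRB1_gt0.
have A0 : phiA g != 0.
  by apply/eqP => A0; move: x0; rewrite -gx /phiG -/(phiA g) A0 mul0r ltxx.
have val : x * (g ^+ 2 * expR g / (expR g * (g - 1) + 1)) = g * x + psi g.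
  rewrite psiE ?gt_eqF// -gx /phiG; field.
  by rewrite A0 e1.
rewrite val; apply/eqP; rewrite eq_le; apply/andP; split.
  by apply: J_ge_pos => // y y0; exact: affine_psi_min_pos.
by apply: J_le; apply/andP; split; lra.
Qed.

End extremal.

(** * Extremal tubes *)

Section linear_form.
Context {R : realType} (n : nat).
Implicit Types (l : 'I_n -> R) (y : n.-tuple R).

Definition lform l y : R := \sum_(i < n) l i * tnth y i.

Lemma lformD l y z : lform l (vadd y z) = lform l y + lform l z.
Proof. by rewrite /lform -big_split; apply: eq_bigr => i _; rewrite tnth_mktuple mulrDr. Qed.

Lemma lformZ l c y : lform l (vscale c y) = c * lform l y.
Proof. by rewrite /lform mulr_sumr; apply: eq_bigr => i _; rewrite tnth_mktuple mulrCA. Qed.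

Lemma lformB l y z : lform l (vsub y z) = lform l y - lform l z.
Proof.
by rewrite /lform -sumrB; apply: eq_bigr => i _; rewrite tnth_mktuple mulrBr.
Qed.

Lemma lform_vbasis l i : lform l (vbasis i) = l i.
Proof.
rewrite /lform (bigD1 i)//= tnth_mktuple eqxx mulr1 big1 ?addr0// => j ji.
by rewrite tnth_mktuple (negbTE ji) mulr0.
Qed.

Lemma measurable_lform l : measurable_fun setT (lform l).
Proof.
apply: measurable_sum => i.
by apply: measurable_funM => //; exact: measurable_tnth.
Qed.

End linear_form.

(** * A linear form that norms the first basis vector *)

Section hahn_banach.
Context {R : realType} (n : nat) (N : n.+1.-tuple R -> R).
Hypothesis hN : is_norm N.

Let NZ c x : N (vscale c x) = `|c| * N x. Proof. by case: hN. Qed.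
Let ND x y : N (vadd x y) <= N x + N y. Proof. by case: hN. Qed.
Let N0 x : 0 <= N x. Proof. by case: hN. Qed.

(* Hahn-Banach, adding one basis vector at a time. *)
Lemma norming_form_step (k : nat) : (k < n.+1)%N -> exists l : 'I_n.+1 -> R,
  l ord0 = N (vbasis ord0) /\
  forall y, (forall i : 'I_n.+1, (k < i)%N -> tnth y i = 0) -> lform l y <= N y.
Proof.
elim: k => [_|k IH kn].
  exists (fun i => if i == ord0 then N (vbasis ord0) else 0); split=> // y hy.
  have -> : y = vscale (tnth y ord0) (vbasis ord0).
    apply: eq_from_tnth => i; rewrite !tnth_mktuple.
    have [->|i0] := eqVneq i ord0; first by rewrite mulr1.
    by rewrite hy ?mulr0// lt0n.
  by rewrite lformZ lform_vbasis NZ /= ler_wpM2r// ler_norm.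
have [l [l0 lN]] := IH (ltnW kn).
pose m := Ordinal kn; pose e := vbasis m : n.+1.-tuple R.
pose W := [set w : n.+1.-tuple R | forall i : 'I_n.+1, (k < i)%N -> tnth w i = 0].
(* The value on the new vector e may be any number between these and all N (w' + e) - l(w'); [bnd]
   shows that there is one. *)
pose E := [set lform l w - N (vsub w e) | w in W].
have bnd w w' : W w -> W w' -> lform l w - N (vsub w e) <= N (vadd w' e) - lform l w'.
  move=> Ww Ww'; rewrite lerBlDr addrAC lerBrDr -lformD.
  apply: le_trans (lN _ _) _ => [i ki|]; first by rewrite tnth_mktuple Ww ?Ww'// addr0.
  rewrite addrC; apply: le_trans (ND _ _); rewrite le_eqVlt; apply/orP; left; apply/eqP; congr N.
  by apply: eq_from_tnth => i; rewrite !tnth_mktuple; ring.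
pose vz : n.+1.-tuple R := vzero n.+1.
have W0 : W vz by move=> i _; rewrite tnth_mktuple.
have E0 : E !=set0 by exists (lform l vz - N (vsub vz e)); exists vz.
have Eub w' : W w' -> ubound E (N (vadd w' e) - lform l w') by move=> Ww' _ [w Ww <-]; exact: bnd.
have Esup : has_sup E by split => //; exists (N (vadd vz e) - lform l vz); exact: Eub.
pose a := sup E.
have a_le w : W w -> lform l w + a <= N (vadd w e).
  by move=> Ww; rewrite addrC -lerBrDr; apply: ge_sup => //; exact: Eub.
have a_ge w : W w -> lform l w - a <= N (vsub w e).
  move=> Ww; rewrite lerBlDr -lerBlDl; apply: ub_le_sup; first by case: Esup.
  by exists w.
exists (fun i => if i == m then a else l i); split=> [//|y hy].
pose w := [tuple if i == m then 0 else tnth y i | i < n.+1]; pose s := tnth y m.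
have Ww : W w.
  move=> i ki; rewrite tnth_mktuple; have [//|im] := eqVneq i m.
  apply: hy; rewrite ltn_neqAle ki andbT; apply: contra im => /eqP im.
  by apply/eqP/val_inj; rewrite /= im.
have WZ c : W (vscale c w) by move=> i ki; rewrite tnth_mktuple Ww// mulr0.
have -> : lform (fun i => if i == m then a else l i) y = lform l w + s * a.
  rewrite /lform (bigD1 m)//= eqxx [in RHS](bigD1 m)//= tnth_mktuple eqxx mulr0 add0r.
  rewrite [RHS]addrC [s * a]mulrC; congr (_ + _); apply: eq_bigr => i im.
  by rewrite tnth_mktuple (negbTE im).
have [s0|s0|s0] := ltgtP s 0.
- have -> : y = vscale (- s) (vsub (vscale (- s)^-1 w) e).
    apply: eq_from_tnth => i; rewrite !tnth_mktuple.
    have [->|im] := eqVneq i m; first by rewrite mulr0 sub0r mulrNN mulr1.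
    by rewrite subr0 mulrA mulfV ?mul1r// oppr_eq0 lt_eqF.
  rewrite NZ gtr0_norm ?oppr_gt0//.
  apply: le_trans (ler_wpM2l _ (a_ge _ (WZ _))); last by rewrite oppr_ge0 ltW.
  by rewrite lformZ mulrBr mulrA mulfV ?oppr_eq0 ?lt_eqF// mul1r mulNr opprK.
- have -> : y = vscale s (vadd (vscale s^-1 w) e).
    apply: eq_from_tnth => i; rewrite !tnth_mktuple.
    have [->|im] := eqVneq i m; first by rewrite mulr0 add0r mulr1.
    by rewrite addr0 mulrA mulfV ?mul1r// gt_eqF.
  rewrite NZ gtr0_norm//.
  apply: le_trans (ler_wpM2l (ltW s0) (a_le _ (WZ _))).
  by rewrite lformZ mulrDr mulrA mulfV ?gt_eqF// mul1r.
- rewrite s0 mul0r addr0; apply: le_trans (lN _ Ww) _.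
  rewrite (_ : w = y)//; apply: eq_from_tnth => i; rewrite tnth_mktuple.
  by have [->|//] := eqVneq i m.
Qed.

Lemma norming_form : exists l : 'I_n.+1 -> R,
  l ord0 = 1 /\ forall y, N (vbasis ord0) * lform l y <= N y.
Proof.
have [l [l0 lN]] := norming_form_step (ltnSn n).
have nu0 : N (vbasis ord0) != 0.
  apply/eqP => h; have [_ /(_ _ h ord0) + _ _] := hN.
  by rewrite tnth_mktuple eqxx => /eqP; rewrite oner_eq0.
exists (fun i => l i / N (vbasis ord0)); split=> [|y]; first by rewrite l0 divff.
rewrite (_ : _ * _ = lform l y); last first.
  by rewrite /lform mulr_sumr; apply: eq_bigr => i _; rewrite mulrAC mulrCA mulfV ?mulr1.
by apply: lN => i; rewrite ltnNge -ltnS ltn_ord.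
Qed.

End hahn_banach.

(** * Geometry of the tubes *)

Section tube.
Context {R : realType} (n : nat) (N : n.+1.-tuple R -> R).
Hypothesis hN : is_norm N.
Variable l : 'I_n.+1 -> R.
Hypothesis l1 : l ord0 = 1.

Notation e0 := (vbasis ord0 : n.+1.-tuple R).
Notation nu := (N e0).
Let NZ c x : N (vscale c x) = `|c| * N x. Proof. by case: hN. Qed.
Let ND x y : N (vadd x y) <= N x + N y. Proof. by case: hN. Qed.

Lemma norm_vbasis_gt0 : 0 < nu.
Proof.
have [N0 NN _ _] := hN; rewrite lt_def N0 andbT; apply/eqP => h.
by have /eqP := NN _ h ord0; rewrite tnth_mktuple eqxx oner_eq0.
Qed.

Definition side := \sum_(j < n) `|l (lift ord0 j)|.

Lemma side_ge0 : 0 <= side. Proof. exact: sumr_ge0. Qed.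

Lemma lform_ord0 y : lform l y = tnth y ord0 + \sum_(j < n) l (lift ord0 j) * tnth y (lift ord0 j).
Proof. by rewrite /lform big_ord_recl l1 mul1r. Qed.

Lemma side_le y d : (forall j : 'I_n, `|tnth y (lift ord0 j)| <= d) ->
  `|\sum_(j < n) l (lift ord0 j) * tnth y (lift ord0 j)| <= side * d.
Proof.
move=> h; apply: le_trans (ler_norm_sum _ _ _) _.
by rewrite /side mulr_suml; apply: ler_sum => j _; rewrite normrM ler_wpM2l.
Qed.

(** The width eta T makes tubes with the same eta dilates of each other, so the diameter can be
    prescribed through T after eta has been chosen. *)
Definition tube (T eta : R) : set (n.+1.-tuple R) :=
  [set y | 0 <= lform l y <= T /\ forall j : 'I_n, `|tnth y (lift ord0 j)| <= eta * T].

Lemma tube_convex_body T eta : convex_body (tube T eta).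
Proof.
split.
- move=> u x uK ux.
  have cl : (fun k => lform l (u k)) @ \oo --> lform l x.
    apply: (@cvg_big _ _ +%R) => [|i _]; first exact: add_continuous.
    by apply: cvgMr; exact: ux.
  split=> [|j].
    apply/andP; split.
      by apply: (cvgr_to_ge cl); apply: nearW => k; have [/andP[]] := uK k.
    by apply: (cvgr_to_le cl); apply: nearW => k; have [/andP[]] := uK k.
  apply: (cvgr_to_le (cvg_norm (ux (lift ord0 j)))); apply: nearW => k.
  by have [_] := uK k; exact.
- exists (T + (side + 1) * `|eta * T|) => x [/andP[x0 xT] xj] i.
  have T0 : 0 <= T by exact: le_trans xT.
  have s0 := side_ge0.
  have e1 : 0 <= side * `|eta * T| by rewrite mulr_ge0.
  have [j ->|->] := unliftP ord0 i.
    by have := le_trans (xj j) (ler_norm _); have := normr_ge0 (eta * T); lra.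
  have := side_le (fun j => le_trans (xj j) (ler_norm _)); rewrite ler_norml.
  move: x0 xT; rewrite lform_ord0; set S := (X in _ + X); have := normr_ge0 (eta * T).
  by rewrite -/S => ? ? ? /andP[S1 S2]; rewrite ler_norml; apply/andP; split; lra.
- move=> x y t [/andP[x0 xT] xj] [/andP[y0 yT] yj] /andP[t0 t1]; split.
    rewrite lformD !lformZ; apply/andP; split; nra.
  move=> j; rewrite !tnth_mktuple.
  apply: le_trans (ler_normD _ _) _; rewrite !normrM (ger0_norm t0) (@ger0_norm _ (1 - t)) ?subr_ge0//.
  have := xj j; have := yj j; nra.
Qed.

Lemma tube_scale (c T eta : R) y : 0 < c -> tube T eta y -> tube (c * T) eta (vscale c y).
Proof.
move=> c0 [/andP[y0 yT] yj]; split=> [|j].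
  by rewrite lformZ mulr_ge0 ?(ltW c0)// ler_pM2l.
by rewrite tnth_mktuple normrM gtr0_norm// mulrCA ler_pM2l.
Qed.

Lemma diam_tube_scale_le (c T eta : R) : 0 < c ->
  (c%:E * diam N (tube T eta) <= diam N (tube (c * T) eta))%E.
Proof.
move=> c0; rewrite -lee_pdivlMl//.
apply: ge_ereal_sup => _ [a [b [Ka Kb ->]]].
rewrite lee_pdivlMl//; apply: ereal_sup_ubound; exists (vscale c a), (vscale c b).
split; [exact: tube_scale|exact: tube_scale|].
rewrite -EFinM -{1}(gtr0_norm c0) -NZ; congr (N _)%:E.
by apply: eq_from_tnth => i; rewrite !tnth_mktuple mulrBr.
Qed.

Lemma diam_tube_scale (T eta : R) : 0 < T ->
  diam N (tube T eta) = (T%:E * diam N (tube 1 eta))%E.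
Proof.
move=> T0; apply/le_anti/andP; split; last first.
  by have := @diam_tube_scale_le T 1 eta T0; rewrite mulr1.
have := @diam_tube_scale_le T^-1 T eta; rewrite invr_gt0 mulVf ?gt_eqF// => /(_ T0).
by rewrite lee_pdivrMl.
Qed.

Lemma diam_tube1_ge (eta : R) : 0 <= eta -> (nu%:E <= diam N (tube 1 eta))%E.
Proof.
move=> eta0; apply: ereal_sup_ubound; exists e0, (vzero n.+1); split.
- split; first by rewrite lform_vbasis l1 ler01 lexx.
  by move=> j; rewrite tnth_mktuple /= normr0 mulr1.
- split=> [|j]; last by rewrite tnth_mktuple normr0 mulr1.
  by rewrite /lform big1 ?lexx ?ler01// => i _; rewrite tnth_mktuple mulr0.
- by congr (N _)%:E; apply: eq_from_tnth => i; rewrite !tnth_mktuple subr0.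
Qed.

(** A difference w is xi(w) e_0, with |xi(w)| <= 1, plus a vector in the kernel of xi. All
    coordinates of the latter are of order eta, the first one because it is minus a combination of
    the others. *)
Lemma diam_tube1_le (eta : R) : 0 <= eta ->
  (diam N (tube 1 eta) <= (nu + norm_cst N * (2 * eta * (1 + side)))%:E)%E.
Proof.
move=> eta0; apply: ge_ereal_sup => _ [a [b [[/andP[a0 a1] aj] [/andP[b0 b1] bj] ->]]].
rewrite lee_fin; set w := vsub a b; set c := lform l w.
have s0 := side_ge0.
have wj (j : 'I_n) : `|tnth w (lift ord0 j)| <= 2 * eta.
  rewrite tnth_mktuple; apply: le_trans (ler_normB _ _) _.
  by have := aj j; have := bj j; lra.
have -> : w = vadd (vscale c e0) (vsub w (vscale c e0)).
  by apply: eq_from_tnth => i; rewrite !tnth_mktuple; ring.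
apply: le_trans (ND _ _) _; apply: lerD.
  rewrite NZ ler_piMl//; first exact: ltW norm_vbasis_gt0.
  by rewrite /c lformB ler_norml; apply/andP; split; lra.
apply: norm_le_coord => // i; rewrite !tnth_mktuple.
have [j ->|->] := unliftP ord0 i.
  rewrite (_ : (lift ord0 j == ord0) = false)//= mulr0 subr0.
  have := wj j; rewrite tnth_mktuple => /le_trans; apply.
  by rewrite ler_peMr//; lra.
have := side_le wj.
rewrite eqxx mulr1 /c lform_ord0 tnth_mktuple opprD addNKr normrN => /le_trans; apply.
by rewrite mulrC ler_wpM2l//; lra.
Qed.

End tube.

(** * Exponential densities on the tubes *)

Section tube_density.
Context {R : realType} (n : nat) (N : n.+1.-tuple R -> R)
  (lam : {measure set (n.+1.-tuple R) -> \bar R}).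
Hypotheses (hN : is_norm N) (hl : is_lebesgue lam).
Variable l : 'I_n.+1 -> R.
Hypothesis l1 : l ord0 = 1.
Hypothesis lN : forall y, N (vbasis ord0) * lform l y <= N y.
Variables (T g eta : R).
Hypotheses (T0 : 0 < T) (g0 : 0 < g) (eta0 : 0 < eta).

Notation K := (tube l T eta).
Notation nu := (N (vbasis ord0)).
Notation leb := (@lebesgue_measure R).

(** With the normalising constant inside the exponent, this is the exponential of an affine function
    restricted to a convex set. *)
Definition tube_density y : R :=
  expR (g / T * lform l y + ln (g / T / ((2 * eta * T) ^+ n * (expR g - 1)))) * \1_K y.

Notation F := tube_density.

Definition tube_below (b : R) : set (n.+1.-tuple R) := K `&` [set y | lform l y <= b].

Let gT0 : 0 < g / T. Proof. by rewrite divr_gt0. Qed.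
Let V0 : 0 < (2 * eta * T) ^+ n. Proof. by rewrite exprn_gt0// !mulr_gt0. Qed.
Let c0 : 0 < g / T / ((2 * eta * T) ^+ n * (expR g - 1)).
Proof. by rewrite divr_gt0// mulr_gt0// expRB1_gt0. Qed.

Lemma measurable_tube : measurable K.
Proof. by apply: measurable_closed; case: (tube_convex_body l1 T eta). Qed.

Lemma measurable_tube_below b : measurable (tube_below b).
Proof.
apply: measurableI; first exact: measurable_tube.
apply: measurable_set_le => //; exact: measurable_lform.
Qed.

Lemma tube_densityE y :
  F y = expR (g / T * lform l y) * (g / T / ((2 * eta * T) ^+ n * (expR g - 1))) * \1_K y.
Proof. by rewrite /F expRD lnK. Qed.

Lemma tube_density_ge0 y : 0 <= F y.
Proof. by rewrite /F mulr_ge0 ?expR_ge0. Qed.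

Lemma measurable_tube_density : measurable_fun setT F.
Proof.
apply: measurable_funM; last by apply: measurable_indic; exact: measurable_tube.
apply: measurableT_comp => //; apply: measurable_funD => //.
by apply: measurable_funM => //; exact: measurable_lform.
Qed.

Lemma logconcave_tube_density : logconcave_density F.
Proof.
apply: logconcave_restrict; last by case: (tube_convex_body l1 T eta).
split=> [x|x y t _]; first exact: expR_ge0.
rewrite -!expRM -expRD ler_expR lformD !lformZ le_eqVlt; apply/orP; left; apply/eqP; ring.
Qed.

(** For fixed other coordinates, xi is coordinate 0 shifted by [a], so the inner integral over
    coordinate 0 does not depend on them; the outer one is the volume of a cube. *)
Lemma dmeasure_tube_below (b : R) : 0 <= b <= T ->
  dmeasure lam F (tube_below b) = ((expR (g / T * b) - 1) / (expR g - 1))%:E.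
Proof.
move=> /andP[b0 bT]; have [lam' hl'] := is_lebesgue_pred hl.
rewrite /dmeasure integral_mkcond (lebesgue_fubini_rev ord0 hl hl'); last 2 first.
- apply/(measurable_restrictT _ _).1; first exact: measurable_tube_below.
  by apply: measurable_funTS; apply/measurable_EFinP; exact: measurable_tube_density.
- by apply: erestrict_ge0 => x _; rewrite lee_fin tube_density_ge0.
pose C := g / T / ((2 * eta * T) ^+ n * (expR g - 1)).
pose I := C * ((expR (g / T * b) - 1) / (g / T)).
have step y : (\int[leb]_t ((fun x => (F x)%:E) \_ (tube_below b)) (ins ord0 t y) =
    I%:E * (\1_(@cube R n (eta * T)) y)%:E)%E.
  pose a := \sum_(j < n) l (lift ord0 j) * tnth y j.
  have la (t : R) : lform l (ins ord0 t y) = t + a.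
    rewrite (lform_ord0 l1) tnth_ins; congr (_ + _).
    by apply: eq_bigr => j _; rewrite tnth_ins_lift.
  have [yc|yc] := boolP (y \in cube (eta * T)); last first.
    rewrite indicE (negbTE yc) mule0 integral0_eq// => t _.
    rewrite patchE ifF//; apply/negbTE; move: yc; rewrite !notin_setE => yc [[_ h] _].
    by apply: yc; apply/cubeP => j; have := h j; rewrite tnth_ins_lift.
  rewrite indicE yc mule1.
  have inB (t : R) : (ins ord0 t y \in tube_below b) = (t \in `[- a, b - a]%classic).
    apply/idP/idP; rewrite !inE /tube_below /= in_itv /= la.
      by move=> [[/andP[h _] _] h']; rewrite la in h; apply/andP; split; lra.
    move=> /andP[h h']; split; last by lra.
    split; first by rewrite la; apply/andP; split; lra.
    by move=> j; rewrite tnth_ins_lift; move: yc; rewrite inE => /cubeP.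
  transitivity (\int[leb]_(t in `[(- a)%R, (b - a)%R]) (C%:E * (expR (g / T * (t - - a)))%:E))%E.
    rewrite [RHS]integral_mkcond; apply: eq_integral => t _; rewrite !patchE inB.
    case: ifPn => // tI; rewrite tube_densityE la opprK mulrC -EFinM.
    rewrite indicE (_ : _ \in K) ?mul1r 1?mulrC//.
    by move: tI; rewrite -inB !inE => -[].
  rewrite ge0_integralZl//; last 2 first.
  - apply: measurable_funTS; apply/measurable_EFinP; apply: measurableT_comp => //.
    by apply: measurable_funM => //; apply: measurable_funD => //.
  - by rewrite lee_fin ltW.
  rewrite integral_expR ?gt_eqF//; last by lra.
  rewrite -EFinM /I; congr (_ * (_ / _))%:E.
  by rewrite !opprK subrK addNr mulr0 expR0.
rewrite (eq_integral _ _ (fun y _ => step y)) ge0_integralZl//; last 2 first.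
- by apply/measurable_EFinP; apply: measurable_indic; exact: measurable_box.
- rewrite lee_fin /I mulr_ge0 ?(ltW c0)// divr_ge0 ?(ltW gT0)//.
  by rewrite subr_ge0 -expR0 ler_expR mulr_ge0// ltW.
rewrite integral_indic ?setIT//; last exact: measurable_box.
rewrite /cube hl' => [|i]; last first.
  by rewrite !tnth_mktuple; have := mulr_gt0 eta0 T0; lra.
rewrite (eq_bigr (fun=> 2 * eta * T)) => [|i _]; last by rewrite !tnth_mktuple; ring.
rewrite prodr_const card_ord -EFinM /I /C; congr EFin.
have := expRB1_gt0 g0; have := V0; set V := _ ^+ n; set E := expR g - 1 => V1 E1.
have := gT0; set G := g / T => G1.
by field; rewrite !gt_eqF.
Qed.

Lemma tube_belowT : tube_below T = K.
Proof. by apply/seteqP; split => [y []//|y Ky]; split => //; case: Ky => /andP[]. Qed.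

Lemma dmeasure_tube : dmeasure lam F K = 1%E.
Proof.
rewrite -tube_belowT dmeasure_tube_below; last by rewrite lexx ltW.
rewrite mulfVK ?gt_eqF// divff// gt_eqF//.
exact: expRB1_gt0.
Qed.

Lemma dmeasure_tubeC : dmeasure lam F (~` K) = 0%E.
Proof.
rewrite /dmeasure integral0_eq// => x; rewrite /tube_density indicE => xK.
by rewrite (_ : (x \in K) = false) ?mulr0//; apply/negbTE; rewrite notin_setE.
Qed.

Lemma logconcave_prob_tube : logconcave_prob_on lam F K.
Proof.
split; [exact: measurable_tube_density|exact: logconcave_tube_density| |exact: dmeasure_tubeC].
rewrite -(setUv K) /dmeasure ge0_integral_setU//.
- by rewrite -/(dmeasure lam F K) dmeasure_tube -/(dmeasure lam F (~` K)) dmeasure_tubeC adde0.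
- exact: measurable_tube.
- by apply: measurableC; exact: measurable_tube.
- by apply: measurable_funTS; apply/measurable_EFinP; exact: measurable_tube_density.
- by move=> x _; rewrite lee_fin tube_density_ge0.
- by apply/disj_setPCl.
Qed.

Lemma tube_below_nbhd s h : 0 <= s -> 0 <= h ->
  tube_below (s + h / nu) `\` tube_below s `<=` nbhd_set N (tube_below s) h `\` tube_below s.
Proof.
move=> s0 h0 y [[Ky yh] ys]; split=> //.
have nu0 := norm_vbasis_gt0 hN.
have [[/andP[y0 yT] yj] sy] : K y /\ s < lform l y.
  by split=> //; rewrite ltNge; apply/negP => ?; exact: ys.
exists (vsub y (vscale (lform l y - s) (vbasis ord0))).
  have e : lform l (vsub y (vscale (lform l y - s) (vbasis ord0))) = s.
    by rewrite lformB lformZ lform_vbasis l1 mulr1 subKr.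
  split; last by rewrite /= e.
  split=> [|j]; first by rewrite e s0/=; apply: ltW; exact: lt_le_trans yT.
  by rewrite !tnth_mktuple mulr0 subr0.
have [_ _ NZ _] := hN.
rewrite (_ : vsub _ _ = vscale (lform l y - s) (vbasis ord0)).
  rewrite NZ gtr0_norm ?subr_gt0// -ler_pdivlMr// lerBlDl; exact: yh.
by apply: eq_from_tnth => i; rewrite !tnth_mktuple subKr.
Qed.

(** A step of norm h raises xi by at most h / nu. It may leave the tube, whose complement has mass
    0. *)
Lemma nbhd_tube_below s h :
  nbhd_set N (tube_below s) h `\` tube_below s `<=`
  ~` K `|` (tube_below (s + h / nu) `\` tube_below s).
Proof.
move=> y [[z [Kz zs] yz] ys]; have [Ky|] := pselect (K y); last by left.
have nu0 := norm_vbasis_gt0 hN.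
right; split=> //; split=> //=; rewrite -lerBlDl.
apply: le_trans (_ : lform l (vsub y z) <= _); first by rewrite lformB lerB.
by rewrite ler_pdivlMr// mulrC; exact: le_trans (lN _) _.
Qed.

Lemma dmeasure_out_tube s h : 0 <= s -> 0 <= h -> s + h / nu <= T ->
  dmeasure_out lam F (nbhd_set N (tube_below s) h `\` tube_below s) =
  ((expR (g / T * (s + h / nu)) - expR (g / T * s)) / (expR g - 1))%:E.
Proof.
move=> s0 h0 shT; have nu0 := norm_vbasis_gt0 hN.
have hnu : 0 <= h / nu by rewrite divr_ge0// ltW.
have mF := measurable_tube_density; have F0 := tube_density_ge0.
have mb b := measurable_tube_below b.
have mD := measurableD (mb (s + h / nu)) (mb s).
have mKC := measurableC measurable_tube.
have iF : (dmeasure lam F setT < +oo)%E.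
  by have [_ _ -> _] := logconcave_prob_tube; rewrite ltry.
have Mb b : 0 <= b <= T -> mass lam F (tube_below b) = (expR (g / T * b) - 1) / (expR g - 1).
  by move=> bT; rewrite /mass dmeasure_tube_below.
have -> : (expR (g / T * (s + h / nu)) - expR (g / T * s)) / (expR g - 1) =
    mass lam F (tube_below (s + h / nu) `\` tube_below s).
  have := massD mF F0 iF (mb (s + h / nu)) (mb s).
  rewrite (_ : _ `&` _ = tube_below s); last first.
    apply/seteqP; split=> [y []//|y [Ky ys]]; split=> //; split=> //=.
    by apply: le_trans ys _; rewrite lerDl.
  rewrite !Mb ?s0/= ?addr_ge0//; last by apply: le_trans shT; rewrite lerDl.
  by set M := mass _ _ _; rewrite !mulrBl => ?; lra.
rewrite -massE//; apply/le_anti/andP; split.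
  apply: (@le_trans _ _ (dmeasure lam F (~` K `|` (tube_below (s + h / nu) `\` tube_below s)))).
    apply: ereal_inf_lbound; eexists; last reflexivity.
    by split; [exact: measurableU|exact: nbhd_tube_below].
  have mU := measurableU _ _ mKC mD.
  rewrite (massE mF F0 iF mU) (massE mF F0 iF mD) lee_fin.
  apply: le_trans (mass_setU_le mF F0 iF mKC mD) _.
  by rewrite {1}/mass dmeasure_tubeC add0r.
apply: le_ereal_inf_tmp => _ [B [mB sB] <-].
apply: dmeasure_le => //; apply: subset_trans sB; exact: tube_below_nbhd.
Qed.

(** The content is the derivative at 0 of the explicit mass [f]; s < T keeps s + h / nu inside the
    tube for small h. *)
Lemma minkowski_tube s : 0 <= s < T ->
  minkowski_content_is N lam F (tube_below s)
    (g / T * expR (g / T * s) / (nu * (expR g - 1)))%:E.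
Proof.
move=> /andP[s0 sT]; have nu0 := norm_vbasis_gt0 hN.
pose f (h : R) := (expR (g / T * (s + h / nu)) - expR (g / T * s)) / (expR g - 1).
have cf : (h^-1 * f h) @[h --> 0^'+] --> g / T * expR (g / T * s) / (nu * (expR g - 1)).
  have df : is_derive (0 : R) (1 : R) f (g / T * expR (g / T * s) / (nu * (expR g - 1))).
    apply: is_derive_eq; rewrite /GRing.scale/= mul0r addr0; field.
    by rewrite !gt_eqF ?expRB1_gt0.
  have f0 : f 0 = 0 by rewrite /f mul0r addr0 subrr mul0r.
  have [/cvg_ex[/= L cL] dL] := df.
  apply: cvg_dnbhs_at_right; rewrite -dL /derive (cvg_lim _ cL)//.
  apply: cvg_trans cL; apply: near_eq_cvg; near=> h.
  by rewrite /= [h%:A]mulr1 addr0 f0 subr0.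
rewrite /minkowski_content_is.
apply: cvg_trans; last first.
  by apply: (@cvg_EFin _ _ _ _ (fun h => (h^-1 * f h)%:E)) cf; exact: nearW.
apply: near_eq_cvg; near=> h.
have h0 : 0 < h by near: h; exact: nbhs_right_gt.
have hTs : h < (T - s) * nu.
  by near: h; apply: nbhs_right_lt; rewrite mulr_gt0// subr_gt0.
have hT' : s + h / nu <= T by rewrite -lerBrDl ler_pdivrMr// ltW.
rewrite /= (dmeasure_out_tube s0 (ltW h0) hT').
by rewrite -EFinM mulrC.
Unshelve. all: by end_near.
Qed.

End tube_density.

Lemma near_extremal_tube (R : realType) n (N : n.+1.-tuple R -> R)
    (lam : {measure set (n.+1.-tuple R) -> \bar R}) (x D e : R) :
  is_norm N -> is_lebesgue lam -> 0 < x <= 1 / 2 -> 0 < D -> 0 < e ->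
  exists (K : set (n.+1.-tuple R)) (F : n.+1.-tuple R -> R) S (l : \bar R),
    [/\ convex_body K, logconcave_prob_on lam F K, measurable S, S `<=` K &
      [/\ dmeasure lam F S = x%:E, diam N K = D%:E, minkowski_content_is N lam F S l &
          (diam N K * l * (x^-1)%:E <= (Gfun x^-1 + e)%:E)%E]].
Proof.
move=> hN hl x12 D0 e0; have /andP[x0 x1] := x12.
have [l [l1 lN]] := norming_form hN; have nu0 := norm_vbasis_gt0 hN.
set nu := N (vbasis ord0) in lN nu0 *.
(* Of the error e, half is for a nearly optimal g (the division by x removes the factor) and half
   for the thickness eta. *)
have ex0 : 0 < x * (e / 2) by rewrite mulr_gt0// divr_gt0.
have [g g0 gJ] := J_approx x12 ex0.
rewrite -(Gfun_J x12) in gJ.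
pose E := expR g - 1; have E0 : 0 < E by exact: expRB1_gt0.
have psig : psi g = g / E by rewrite psiE ?gt_eqF.
pose P := g + g / E / x.
have P0 : 0 < P by rewrite addr_gt0// !divr_gt0.
have PG : P <= Gfun x^-1 + e / 2.
  have -> : P = (g * x + psi g) / x by rewrite psig /P; field; rewrite !gt_eqF.
  rewrite ler_pdivrMr//; apply: le_trans gJ _; lra.
pose C := norm_cst N * (2 * (1 + side l)) / nu.
have C0 : 0 <= C.
  by rewrite divr_ge0 ?(ltW nu0)// mulr_ge0 ?norm_cst_ge0// mulr_ge0// addr_ge0// side_ge0.
(* The ratio is d1 / nu * P with d1 / nu <= 1 + C eta, so C eta P <= e / 2 is needed; C + 1 avoids
   dividing by 0. *)
pose eta := e / 2 / ((C + 1) * P).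
have CP0 : 0 < (C + 1) * P by rewrite mulr_gt0// ltr_wpDl.
have eta0 : 0 < eta by rewrite !divr_gt0.
have CetaP : C * eta * P <= e / 2.
  have -> : C * eta * P = e / 2 * (C / (C + 1)).
    by rewrite /eta; field; rewrite !gt_eqF// ltr_wpDl.
  rewrite ler_piMr ?divr_ge0 ?(ltW e0)// ler_pdivrMr ?ltr_wpDl//; lra.
have dge := diam_tube1_ge N l1 (ltW eta0); have dle := diam_tube1_le hN l1 (ltW eta0).
have [d1 dE] : exists d1, diam N (tube l 1 eta) = d1%:E.
  by move: dge dle; case: (diam N _) => // r _ _; exists r.
rewrite dE !lee_fin in dge dle.
have d0 : 0 < d1 by exact: lt_le_trans dge.
pose T := D / d1; have T0 : 0 < T by rewrite divr_gt0.
have diamE : diam N (tube l T eta) = D%:E.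
  by rewrite diam_tube_scale// dE -EFinM /T divfK// gt_eqF.
(* Solution of (e^(g s / T) - 1) / E = x, which gives the set mass x. *)
pose s := T / g * ln (1 + x * E).
have xE0 : 0 < 1 + x * E by rewrite addr_gt0// mulr_gt0.
have gs : expR (g / T * s) = 1 + x * E.
  rewrite (_ : g / T * s = ln (1 + x * E)) ?lnK// /s; field; by rewrite !gt_eqF.
have s0 : 0 <= s.
  by rewrite mulr_ge0 ?divr_ge0 ?ltW// ln_gt0// ltrDl mulr_gt0.
have sT : s < T.
  have xEg : 1 + x * E < expR g by rewrite /E in E0 *; nra.
  rewrite /s -ltr_pdivlMl ?divr_gt0// (_ : (T / g)^-1 * T = g); last first.
    by field; rewrite !gt_eqF.
  by rewrite -ltr_expR lnK.
exists (tube l T eta), (tube_density l T g eta), (tube_below l T eta s).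
exists (g / T * expR (g / T * s) / (nu * (expR g - 1)))%:E.
split.
- exact: tube_convex_body.
- exact: logconcave_prob_tube.
- exact: measurable_tube_below.
- by move=> y [].
split=> //.
- rewrite dmeasure_tube_below//; last by rewrite s0 ltW.
  by rewrite gs addrC addKr mulfK// gt_eqF.
- by apply: minkowski_tube => //; rewrite s0.
rewrite diamE -!EFinM lee_fin gs -/E.
have -> : D * (g / T * (1 + x * E) / (nu * E)) / x = d1 / nu * P.
  by rewrite /T /P; field; rewrite !gt_eqF.
have : d1 / nu <= 1 + C * eta.
  rewrite ler_pdivrMr// /C (_ : (1 + _) * nu = nu + norm_cst N * (2 * eta * (1 + side l)))//.
  by field; rewrite gt_eqF.
by move=> /(ler_wpM2r (ltW P0)) /le_trans; apply; lra.
Qed.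

Theorem theorem1 (R : realType) :
  (forall (n : nat) (N : n.-tuple R -> R)
      (lam : {measure set (n.-tuple R) -> \bar R})
      (F : n.-tuple R -> R) (K S : set (n.-tuple R)) (l : \bar R),
    is_norm N -> is_lebesgue lam ->
    convex_body K -> logconcave_prob_on lam F K ->
    measurable S -> S `<=` K ->
    (0 < dmeasure lam F S)%E -> (dmeasure lam F S <= (1 / 2)%:E)%E ->
    minkowski_content_is N lam F S l ->
    (dmeasure lam F S * (Gfun (fine (dmeasure lam F S))^-1)%:E
       <= diam N K * l)%E)
  /\
  (forall (x D : R) (n : nat) (N : n.-tuple R -> R)
      (lam : {measure set (n.-tuple R) -> \bar R}),
    0 < x <= 1 / 2 -> 0 < D -> (1 <= n)%N ->
    is_norm N -> is_lebesgue lam ->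
    ereal_inf
      [set r | exists (K : set (n.-tuple R)) (F : n.-tuple R -> R)
                      (S : set (n.-tuple R)) (l : \bar R),
         [/\ convex_body K, logconcave_prob_on lam F K,
             measurable S, S `<=` K &
             [/\ dmeasure lam F S = x%:E, diam N K = D%:E,
                 minkowski_content_is N lam F S l &
                 r = ((diam N K * l) * (x^-1)%:E)%E]]]
    = (Gfun x^-1)%:E).
Proof.
split=> [n N lam F K S l hN hl bK lF mS SK S0 S12 hlim|x D n N lam x12 D0 n0 hN hl].
  have := isoperimetry_J hN hl bK lF mS SK S0 S12 hlim.
  move: S0 S12; case: (dmeasure lam F S) => // x.
  by rewrite !lte_fin !lee_fin /= => x0 x1; rewrite -EFinM Gfun_J ?x0.
case: n n0 N lam hN hl => // n _ N lam hN hl; have /andP[x0 x1] := x12.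
apply/le_anti/andP; split.
  apply/lee_addgt0Pr => e e0; rewrite -EFinD.
  have [K [F [S [l [bK lF mS SK [Sx KD hlim le]]]]]] := near_extremal_tube hN hl x12 D0 e0.
  apply: le_trans le; apply: ereal_inf_lbound.
  by exists K, F, S, l; split.
apply: le_ereal_inf_tmp => _ [K [F [S [l [bK lF mS SK [Sx KD hlim ->]]]]]].
have := isoperimetry_J hN hl bK lF mS SK (l := l).
rewrite Sx lte_fin lee_fin => /(_ x0 x1 hlim); rewrite /= -Gfun_J//.
by rewrite mulrC EFinM lee_pdivlMr.
Qed.
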